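(* Up to isometry: the positive-definite selfdual $\mathcal{E}$-lattices in dimensions $\le 6$ are $\mathcal{E}^n$ and $\Lambda_6^{\mathcal{E}}$. The positive-definite selfdual $\mathcal{H}$-lattices in dimensions $\le4$ are $\mathcal{H}^n$ and $\Lambda_4^{\mathcal{H}}$. The positive-definite even selfdual $\mathcal{G}$-lattices in dimensions $\le4$ are $\{0\}$ and $E_8^{\mathcal{G}}$.
   Context: $\mathcal{G}=\mathbb{Z}[i]$; $\mathcal{E}=\mathbb{Z}[\omega]$ with $\omega=(-1+\sqrt{-3})/2$, $\theta=\sqrt{-3}$; $\mathcal{H}$ is the ring of Hurwitz integers, the integral span of $\pm1,\pm i,\pm j,\pm k,(\pm1\pm i\pm j\pm k)/2$ in the quaternions. Let $\mathcal{R}$ be one of these. An $\mathcal{R}$-lattice is a free right $\mathcal{R}$-module $\Lambda$ of finite rank (its dimension) with a biadditive $\mathcal{R}$-valued pairing satisfying $\langle x|y\rangle=\overline{\langle y|x\rangle}$ and $\langle x|y\alpha\rangle=\langle x|y\rangle\alpha$. It is selfdual if it is nonsingular and the natural map $\Lambda\to\mathrm{Hom}_{\mathcal{R}}(\Lambda,\mathcal{R})$ is onto, and even if $v^2=\langle v|v\rangle$ is an even integer for every $v\in\Lambda$. The following carry the form $\sum\bar x_iy_i$: $\mathcal{R}^n$, and $$\Lambda_6^{\mathcal{E}}=\tfrac1\theta\{x\in\mathcal{E}^6: x_i\equiv x_j\ (\mathrm{mod}\ \theta),\ \textstyle\sum x_i\equiv0\ (\mathrm{mod}\ 3)\},$$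 $$\Lambda_4^{\mathcal{H}}=\tfrac{1}{1+i}\{x\in\mathcal{H}^4: x_i\equiv x_j\ (\mathrm{mod}\ (1+i)\mathcal{H}),\ \textstyle\sum x_i\in2\mathcal{H}\},$$ $$E_8^{\mathcal{G}}=\tfrac1{1+i}\{x\in\mathcal{G}^4: x_i\equiv x_j\ (\mathrm{mod}\ 1+i),\ \textstyle\sum x_i\equiv0\ (\mathrm{mod}\ 2)\}.$$ *)

(* Defs.v *)
From HB Require Import structures.
From mathcomp Require Import all_boot all_order all_algebra all_field.
From mathcomp Require Import ring.

Set Implicit Arguments.
Unset Strict Implicit.
Unset Printing Implicit Defensive.

Import Order.TTheory GRing.Theory Num.Theory.
Local Open Scope ring_scope.

(* An order is given as a subring S of a ring D carrying a conjugation cj;    *)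
(* D is algC for the Gaussian and Eisenstein integers, and the division ring  *)
(* of quaternions for the Hurwitz integers.                                   *)

Record subring_of (D : nzRingType) (S : subringClosed D) := SubringOf {
  subring_val : D;
  _ : subring_val \in S
}.

HB.instance Definition _ (D : nzRingType) (S : subringClosed D) :=
  [isSub of subring_of S for @subring_val D S].
HB.instance Definition _ (D : nzRingType) (S : subringClosed D) :=
  [Choice of subring_of S by <:].
HB.instance Definition _ (D : nzRingType) (S : subringClosed D) :=
  [SubChoice_isSubNzRing of subring_of S by <:].

(* Right S-modules are left modules over the converse ring: a *: v in         *)
(* lmodType (subring_of S)^c is the right multiple v a, and                   *)
(* a *: (b *: v) = (b * a) *: v for the product of S.                         *)
Record hermModule (D : unitRingType) (S : subringClosed D) := HermModule {
  herm_sort :> lmodType (subring_of S)^c;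
  pairing : herm_sort -> herm_sort -> D
}.

Section Lattices.
Variables (D : unitRingType) (cj : D -> D) (S : subringClosed D).
Implicit Types L M : hermModule S.

Definition free_of_rank (V : lmodType (subring_of S)^c) (n : nat) : Prop :=
  exists b : 'I_n -> V,
    forall v : V,
      exists! c : {ffun 'I_n -> (subring_of S)^c}, v = \sum_i c i *: b i.

Record is_lattice L (n : nat) : Prop := IsLattice {
  lattice_free : free_of_rank L n;
  pairing_in : forall x y : L, pairing x y \in S;
  pairingDl : forall x1 x2 y : L,
    pairing (x1 + x2) y = pairing x1 y + pairing x2 y;
  pairingDr : forall x y1 y2 : L,
    pairing x (y1 + y2) = pairing x y1 + pairing x y2;
  pairing_conj : forall x y : L, pairing x y = cj (pairing y x);
  pairingZr : forall (x y : L) (a : subring_of S),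
    pairing x ((a : (subring_of S)^c) *: y) = pairing x y * val a
}.

Definition nonsingular L : Prop :=
  forall x : L, (forall y : L, pairing x y = 0) -> x = 0.

(* (subring_of S)^c^o is S as a right module over itself. *)
Definition selfdual L : Prop :=
  nonsingular L /\
  forall f : {linear L -> (subring_of S)^c^o},
    exists x : L, forall y : L, val (f y : subring_of S) = pairing x y.

Definition even L : Prop :=
  forall v : L, exists m : int, pairing v v = (2 * m)%:~R.

(* Norms are fixed by the conjugation, and the elements of the orders below   *)
(* fixed by the conjugation are the rational integers.                        *)
Definition posdef L : Prop :=
  forall v : L, v != 0 -> exists2 m : int, 0 < m & pairing v v = m%:~R.

Definition isometric L M : Prop :=
  exists f : {linear L -> M},
    bijective f /\ forall x y : L, pairing (f x) (f y) = pairing x y.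

Definition std_lattice (n : nat) : hermModule S :=
  @HermModule D S 'cV[(subring_of S)^c]_n
    (fun x y => \sum_i cj (val (x i 0 : subring_of S))
                       * val (y i 0 : subring_of S)).

(* For m invertible in D,                                                     *)
(*   m^-1 {x in S^n | x_i = x_j mod mS, \sum x_i in dS},                      *)
(* where a \in mS is tested as m^-1 * a \in S.                                *)
Definition congr_pred (m d : D) (n : nat) : pred 'cV[D]_n :=
  fun y => let x i := m * y i 0 in
  [&& [forall i, x i \in S],
      [forall i, forall j, m^-1 * (x i - x j) \in S]
    & d^-1 * (\sum_i x i) \in S].

Lemma congr_pred_zmod m d n : zmod_closed (@congr_pred m d n).
Proof.
split=> [|u v].
  apply/and3P; split.
  - by apply/forallP=> i; rewrite mxE mulr0 rpred0.
  - by apply/'forall_forallP=> i j; rewrite !mxE !mulr0 subrr mulr0 rpred0.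
  - by rewrite big1 ?mulr0 ?rpred0 // => i _; rewrite mxE mulr0.
case/and3P=> /forallP u1 /'forall_forallP u2 u3.
case/and3P=> /forallP v1 /'forall_forallP v2 v3.
apply/and3P; split.
- by apply/forallP=> i; rewrite !mxE mulrBr rpredB.
- apply/'forall_forallP=> i j; rewrite !mxE.
  have -> : m * (u i 0 - v i 0) - m * (u j 0 - v j 0)
    = (m * u i 0 - m * u j 0) - (m * v i 0 - m * v j 0).
    by rewrite !mulrBr opprD opprD !opprK addrACA.
  by rewrite mulrBr rpredB.
- rewrite (eq_bigr (fun i => m * u i 0 - m * v i 0)) ?sumrB ?mulrBr ?rpredB //.
  by move=> i _; rewrite !mxE mulrBr.
Qed.

HB.instance Definition _ m d n :=
  GRing.isZmodClosed.Build _ (@congr_pred m d n) (congr_pred_zmod m d n).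

Record congr_vec (m d : D) (n : nat) := CongrVec {
  congr_val : 'cV[D]_n;
  _ : congr_val \in @congr_pred m d n
}.

HB.instance Definition _ m d n := [isSub of congr_vec m d n for @congr_val m d n].
HB.instance Definition _ m d n := [Choice of congr_vec m d n by <:].
HB.instance Definition _ m d n :=
  [SubChoice_isSubZmodule of congr_vec m d n by <:].

Lemma congr_pred_mulr m d n (a : subring_of S) (y : 'cV[D]_n) :
  congr_pred m d y -> congr_pred m d (\col_i (y i 0 * val a)).
Proof.
have Sa := valP a.
case/and3P=> /forallP u1 /'forall_forallP u2 u3; apply/and3P; split.
- by apply/forallP=> i; rewrite mxE mulrA rpredM.
- by apply/'forall_forallP=> i j; rewrite !mxE !mulrA -mulrBl mulrA rpredM.
- rewrite (eq_bigr (fun i => m * y i 0 * val a)) => [|i _].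
    by rewrite -mulr_suml mulrA rpredM.
  by rewrite mxE mulrA.
Qed.

Definition congr_scale m d n (a : (subring_of S)^c) (v : congr_vec m d n) :
  congr_vec m d n := Sub _ (congr_pred_mulr a (valP v)).

Lemma congr_scaleA m d n a b (v : congr_vec m d n) :
  congr_scale a (congr_scale b v) = congr_scale (a * b) v.
Proof. by apply/val_inj/colP=> i; rewrite !mxE -mulrA. Qed.

Lemma congr_scale1 m d n : left_id 1 (@congr_scale m d n).
Proof. by move=> v; apply/val_inj/colP=> i; rewrite !mxE mulr1. Qed.

Lemma congr_scaleDr m d n : right_distributive (@congr_scale m d n) +%R.
Proof. by move=> a u v; apply/val_inj/colP=> i; rewrite !mxE mulrDl. Qed.

Lemma congr_scaleDl m d n v :
  {morph (@congr_scale m d n)^~ v : a b / a + b}.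
Proof. by move=> a b; apply/val_inj/colP=> i; rewrite !mxE mulrDr. Qed.

HB.instance Definition _ m d n :=
  GRing.Zmodule_isLmodule.Build (subring_of S)^c (congr_vec m d n)
    (@congr_scaleA m d n) (@congr_scale1 m d n)
    (@congr_scaleDr m d n) (@congr_scaleDl m d n).

Definition congr_lattice (m d : D) (n : nat) : hermModule S :=
  @HermModule D S (congr_vec m d n)
    (fun x y => \sum_i cj (val x i 0) * val y i 0).

End Lattices.

Section QuadraticIntegers.

Lemma Cint_span2P (w x : algC) :
  reflect (exists a b : int, x = a%:~R + b%:~R * w) (x \in Cint_span [:: 1; w]).
Proof.
apply: (iffP (Cint_spanP _ _)) => [[c ->]|[a [b ->]]].
  exists (c 0), (c 1); rewrite big_ord_recl big_ord1 /=.
  by congr (_ *~ c _ + _); rewrite ?mulrzl //; congr (_ *~ c _); apply/val_inj.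
exists [ffun i : 'I_2 => if i == 0 then a else b].
by rewrite big_ord_recl big_ord1 /= !ffunE /= mulrzl.
Qed.

Lemma Cint_span2_subring (w : algC) :
  w * w \in Cint_span [:: 1; w] -> subring_closed (Cint_span [:: 1; w]).
Proof.
move=> /Cint_span2P[p [q ww]]; split.
- by apply/Cint_span2P; exists 1, 0; rewrite mul0r addr0.
- exact: rpredB.
move=> _ _ /Cint_span2P[a [b ->]] /Cint_span2P[c [e ->]].
apply/Cint_span2P; exists (a * c + b * e * p), (a * e + b * c + b * e * q).
rewrite !rmorphD !rmorphM /=.
transitivity (a%:~R * c%:~R + (a%:~R * e%:~R + b%:~R * c%:~R) * w
  + b%:~R * e%:~R * (w * w) : algC); first by ring.
by rewrite ww; ring.
Qed.

End QuadraticIntegers.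

Definition gaussian : pred algC := Cint_span [:: 1; 'i].

Lemma gaussian_subring : subring_closed gaussian.
Proof.
apply: Cint_span2_subring; apply/Cint_span2P; exists (-1), 0.
by rewrite -expr2 sqrCi mul0r addr0.
Qed.

HB.instance Definition _ :=
  GRing.isSubringClosed.Build algC gaussian gaussian_subring.

Definition theta : algC := sqrtC (-3).
Definition omega : algC := (-1 + theta) / 2.
Definition eisenstein : pred algC := Cint_span [:: 1; omega].

Lemma eisenstein_subring : subring_closed eisenstein.
Proof.
apply: Cint_span2_subring; apply/Cint_span2P; exists (-1), (-1).
have t2 : theta * theta = -3 by rewrite -expr2 sqrtCK.
have n2 : (2 : algC) != 0 by rewrite pnatr_eq0.
rewrite /omega; apply: (mulfI n2); apply: (mulfI n2).
transitivity (1 - 2 * theta + theta * theta); first by field.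
by rewrite t2; field.
Qed.

HB.instance Definition _ :=
  GRing.isSubringClosed.Build algC eisenstein eisenstein_subring.

(* Rational quaternions: all the lattices considered here have rational       *)
(* coordinates with respect to 1, i, j, k.                                    *)
Definition quat : Type := 'rV[rat]_4.
HB.instance Definition _ := Vector.copy quat 'rV[rat]_4.

Definition mkq (a b c d : rat) : quat := \row_(i < 4) [:: a; b; c; d]`_i.
Definition qcoord (k : nat) (x : quat) : rat := x 0 (inord k).

Lemma mkqK k a b c d : (k < 4)%N -> qcoord k (mkq a b c d) = [:: a; b; c; d]`_k.
Proof. by move=> k4; rewrite /qcoord mxE inordK. Qed.

Lemma qcoordB k x y : qcoord k (x - y) = qcoord k x - qcoord k y.
Proof. by rewrite /qcoord !mxE. Qed.

Lemma qcoordD k x y : qcoord k (x + y) = qcoord k x + qcoord k y.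
Proof. by rewrite /qcoord !mxE. Qed.

Lemma quatP x y :
  [/\ qcoord 0 x = qcoord 0 y, qcoord 1 x = qcoord 1 y,
      qcoord 2 x = qcoord 2 y & qcoord 3 x = qcoord 3 y] <-> x = y.
Proof.
split=> [[e0 e1 e2 e3]|->] //; apply/rowP=> i.
rewrite -(inord_val i); case: i => [] [|[|[|[|//]]]] /= _;
  [exact: e0|exact: e1|exact: e2|exact: e3].
Qed.

Definition mulq (x y : quat) : quat :=
  let: (x0, x1, x2, x3) := (qcoord 0 x, qcoord 1 x, qcoord 2 x, qcoord 3 x) in
  let: (y0, y1, y2, y3) := (qcoord 0 y, qcoord 1 y, qcoord 2 y, qcoord 3 y) in
  mkq (x0 * y0 - x1 * y1 - x2 * y2 - x3 * y3)
      (x0 * y1 + x1 * y0 + x2 * y3 - x3 * y2)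
      (x0 * y2 - x1 * y3 + x2 * y0 + x3 * y1)
      (x0 * y3 + x1 * y2 - x2 * y1 + x3 * y0).

Lemma mulqA : associative mulq.
Proof. by move=> x y z; apply/quatP; rewrite /mulq !mkqK //=; split; ring. Qed.
Lemma mul1q : left_id (mkq 1 0 0 0) mulq.
Proof. by move=> x; apply/quatP; rewrite /mulq !mkqK //=; split; ring. Qed.
Lemma mulq1 : right_id (mkq 1 0 0 0) mulq.
Proof. by move=> x; apply/quatP; rewrite /mulq !mkqK //=; split; ring. Qed.
Lemma mulqDl : left_distributive mulq +%R.
Proof.
by move=> x y z; apply/quatP; rewrite /mulq !(mkqK, qcoordD) //=; split; ring.
Qed.
Lemma mulqDr : right_distributive mulq +%R.
Proof.
by move=> x y z; apply/quatP; rewrite /mulq !(mkqK, qcoordD) //=; split; ring.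
Qed.
Lemma oneq_neq0 : mkq 1 0 0 0 != 0.
Proof. by apply/eqP=> /quatP[]; rewrite mkqK // /qcoord mxE. Qed.

HB.instance Definition _ := GRing.Zmodule_isNzRing.Build quat
  mulqA mul1q mulq1 mulqDl mulqDr oneq_neq0.

Definition conjq (x : quat) : quat :=
  mkq (qcoord 0 x) (- qcoord 1 x) (- qcoord 2 x) (- qcoord 3 x).
Definition normq (x : quat) : rat :=
  qcoord 0 x ^+ 2 + qcoord 1 x ^+ 2 + qcoord 2 x ^+ 2 + qcoord 3 x ^+ 2.
Definition invq (x : quat) : quat := (normq x)^-1 *: conjq x.

Lemma normq_eq0 x : (normq x == 0) = (x == 0).
Proof.
rewrite /normq !paddr_eq0 ?addr_ge0 ?sqr_ge0 // !sqrf_eq0.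
apply/idP/eqP => [/andP[/andP[/andP[]]]|->]; last by rewrite /qcoord !mxE !eqxx.
move=> /eqP e0 /eqP e1 /eqP e2 /eqP e3; apply/quatP.
by rewrite e0 e1 e2 e3 /qcoord !mxE.
Qed.

Lemma qcoordZ k a x : qcoord k (a *: x) = a * qcoord k x.
Proof. by rewrite /qcoord mxE. Qed.

Lemma mulVq : {in [pred x : quat | x != 0], left_inverse 1 invq *%R}.
Proof.
move=> x; rewrite inE -normq_eq0 => nx0; apply/quatP.
rewrite /GRing.mul /= /mulq /invq !(qcoordZ, mkqK) //=.
by rewrite /normq in nx0 *; split; field.
Qed.

Lemma mulqV : {in [pred x : quat | x != 0], right_inverse 1 invq *%R}.
Proof.
move=> x; rewrite inE -normq_eq0 => nx0; apply/quatP.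
rewrite /GRing.mul /= /mulq /invq !(qcoordZ, mkqK) //=.
by rewrite /normq in nx0 *; split; field.
Qed.

Lemma unitq (x y : quat) : y * x = 1 /\ x * y = 1 -> x != 0.
Proof.
by case=> yx1 _; apply: contra_eq_neq yx1 => ->; rewrite mulr0 eq_sym oner_neq0.
Qed.

Lemma invq_out : {in [predC [pred x : quat | x != 0]], invq =1 id}.
Proof.
move=> x; rewrite !inE negbK => /eqP->; apply/quatP.
by rewrite /invq !(qcoordZ, mkqK) // /qcoord !mxE !oppr0 mulr0.
Qed.

HB.instance Definition _ := GRing.NzRing_hasMulInverse.Build quat
  mulVq mulqV unitq invq_out.

Definition qi : quat := mkq 0 1 0 0.
Definition qj : quat := mkq 0 0 1 0.
Definition qk : quat := mkq 0 0 0 1.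

Definition half_pairs : seq (rat * rat) :=
  [seq (a, b) | a <- [:: 1/2; - (1/2)], b <- [:: 1/2; - (1/2)]].
Definition hurwitz_gens : seq quat :=
  [:: 1; -1; qi; - qi; qj; - qj; qk; - qk]
  ++ [seq mkq p.1 p.2 q.1 q.2 | p <- half_pairs, q <- half_pairs].

Definition hurwitz : pred quat :=
  fun x => dec_Qint_span (in_tuple hurwitz_gens) x.

Lemma hurwitzP x : reflect (inIntSpan (in_tuple hurwitz_gens) x) (x \in hurwitz).
Proof. by rewrite unfold_in; case: dec_Qint_span => h; constructor. Qed.

Lemma hurwitz_zmod : zmod_closed hurwitz.
Proof.
split=> [|_ _ /hurwitzP[a ->] /hurwitzP[b ->]]; apply/hurwitzP.
  by exists [ffun=> 0]; rewrite big1 // => i _; rewrite ffunE mulr0z.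
exists [ffun i => a i - b i]; rewrite -sumrB; apply: eq_bigr => i _.
by rewrite ffunE mulrzBr.
Qed.

HB.instance Definition _ := GRing.isZmodClosed.Build quat hurwitz hurwitz_zmod.

Lemma mem_hurwitz_gens x : x \in hurwitz_gens -> x \in hurwitz.
Proof.
move=> gx; have ix : (index x hurwitz_gens < size hurwitz_gens)%N
  by rewrite index_mem.
apply/hurwitzP; exists [ffun i => (i == Ordinal ix)%:Z].
rewrite (bigD1 (Ordinal ix)) //= big1 => [|i /negPf ni].
  by rewrite ffunE eqxx mulr1z nth_index ?addr0.
by rewrite ffunE ni mulr0z.
Qed.

Lemma qcoordMz k x (n : int) : qcoord k (x *~ n) = qcoord k x * n%:~R.
Proof. by rewrite -(@scaler_int rat _ n x) qcoordZ mulrC. Qed.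

Definition hurwitz_coord (x : quat) : Prop :=
  exists a b c d : int, let h := a%:~R / 2 in
    x = mkq h (h + b%:~R) (h + c%:~R) (h + d%:~R).

Lemma hurwitz_gens_coord x : x \in hurwitz_gens -> hurwitz_coord x.
Proof.
have wit (a b c d : int) y : y = mkq (a%:~R / 2) (a%:~R / 2 + b%:~R)
    (a%:~R / 2 + c%:~R) (a%:~R / 2 + d%:~R) -> hurwitz_coord y.
  by move=> ->; exists a, b, c, d.
rewrite mem_cat => /orP[|/allpairsP[[p q] [/= pP qP ->]]].
  rewrite !inE => /or4P[/eqP->|/eqP->|/eqP->|].
  - apply: (wit 2 (-1) (-1) (-1)); apply/quatP.
    by rewrite !mkqK.
  - apply: (wit (-2) 1 1 1); apply/quatP.
    by rewrite -[- 1]mulrN1z !qcoordMz !mkqK.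
  - by apply: (wit 0 1 0 0); apply/quatP; rewrite !mkqK.
  case/or4P => [/eqP->|/eqP->|/eqP->|].
  - by apply: (wit 0 (-1) 0 0); apply/quatP; rewrite -mulrN1z !qcoordMz !mkqK.
  - by apply: (wit 0 0 1 0); apply/quatP; rewrite !mkqK.
  - by apply: (wit 0 0 (-1) 0); apply/quatP; rewrite -mulrN1z !qcoordMz !mkqK.
  case/orP => /eqP->.
  - by apply: (wit 0 0 0 1); apply/quatP; rewrite !mkqK.
  - by apply: (wit 0 0 0 (-1)); apply/quatP; rewrite -mulrN1z !qcoordMz !mkqK.
have half (u : rat) : u \in [:: 1/2; - (1/2)] ->
    exists s : bool, u = 1/2 - s%:Z%:~R.
  by rewrite !inE => /orP[]/eqP->; [exists false|exists true].
case/allpairsP: pP => [[u0 u1] /= [/half[s0 ->] /half[s1 ->] ->]].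
case/allpairsP: qP => [[u2 u3] /= [/half[s2 ->] /half[s3 ->] ->]] /=.
apply: (wit (1 - s0%:Z *+ 2) (s0%:Z - s1%:Z) (s0%:Z - s2%:Z) (s0%:Z - s3%:Z)).
by apply/quatP; rewrite !mkqK //=; case: s0 s1 s2 s3 => [] [] [] [].
Qed.

Lemma hurwitz_coordP x : x \in hurwitz <-> hurwitz_coord x.
Proof.
split=> [/hurwitzP[e ->]|[a [b [c [d ->]]]]]; last first.
  pose w := mkq (1/2) (1/2) (1/2) (1/2).
  have -> : mkq (a%:~R / 2) (a%:~R / 2 + b%:~R) (a%:~R / 2 + c%:~R)
      (a%:~R / 2 + d%:~R) = w *~ a + qi *~ b + qj *~ c + qk *~ d.
    apply/quatP.
    by rewrite !(qcoordD, qcoordMz, mkqK) //=; split; ring.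
  have wH : w \in hurwitz.
    apply/mem_hurwitz_gens; rewrite mem_cat; apply/orP; right.
    by apply/allpairsP; exists ((1/2, 1/2), (1/2, 1/2)).
  by rewrite !rpredD ?rpredMz // mem_hurwitz_gens // !inE eqxx ?orbT.
elim/big_rec: _ => [|i z _ [a [b [c [d ->]]]]].
  exists 0, 0, 0, 0; apply/quatP.
  by rewrite !mkqK // /qcoord !mxE /=; split.
have [p [q [r [s ->]]]] : hurwitz_coord hurwitz_gens`_i.
  exact/hurwitz_gens_coord/mem_nth.
exists (p * e i + a), (q * e i + b), (r * e i + c), (s * e i + d).
apply/quatP.
by rewrite !(qcoordD, qcoordMz, mkqK) //= !rmorphD !rmorphM /=; split; field.
Qed.

Lemma hurwitz_subring : subring_closed hurwitz.
Proof.
split; [|exact: rpredB|].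
  by apply: mem_hurwitz_gens; rewrite inE eqxx.
move=> _ _ /hurwitz_coordP[a [b [c [d ->]]]] /hurwitz_coordP[e [f [g [l ->]]]].
apply/hurwitz_coordP.
exists (- (a * e) - a * (f + g + l) - e * (b + c + d)
        - 2 * (b * f + c * g + d * l)).
exists (a * e + a * (f + l) + e * (b + c) + (c * l - d * g)
        + (b * f + c * g + d * l)).
exists (a * e + a * (g + f) + e * (c + d) + (d * f - b * l)
        + (b * f + c * g + d * l)).
exists (a * e + a * (l + g) + e * (d + b) + (b * g - c * f)
        + (b * f + c * g + d * l)).
rewrite /= -[LHS]/(mulq _ _) /mulq !mkqK //=.
by congr mkq; rewrite !(rmorphD, rmorphM, rmorphN, rmorphB) /=; field.
Qed.

HB.instance Definition _ :=
  GRing.isSubringClosed.Build quat hurwitz hurwitz_subring.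

Definition Gau := GRing.SubringClosed.clone algC gaussian _.
Definition Eis := GRing.SubringClosed.clone algC eisenstein _.
Definition Hur := GRing.SubringClosed.clone quat hurwitz _.

Definition Eis_std (n : nat) : hermModule Eis := std_lattice Num.conj Eis n.
Definition Lambda6E : hermModule Eis := congr_lattice Num.conj Eis theta 3 6.

Definition Hur_std (n : nat) : hermModule Hur := std_lattice conjq Hur n.
Definition Lambda4H : hermModule Hur := congr_lattice conjq Hur (1 + qi) 2 4.

Definition Gau_zero : hermModule Gau := std_lattice Num.conj Gau 0.
Definition E8G : hermModule Gau := congr_lattice Num.conj Gau (1 + 'i) 2 4.

(* Main.v *)
Require Import Defs.
From HB Require Import structures.
From mathcomp Require Import all_boot all_order all_algebra all_field.
From mathcomp Require Import ring lra.
From Stdlib Require Import Classical.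
(* Imported last, so that mulq, invq and normq denote the operations on
   quaternions and not those on rationals. *)
Require Import Defs.

(** The three rings are treated together. Write R for the ring, p for its
    distinguished prime (theta, 1 + i, 1 + i for the Eisenstein, Hurwitz and
    Gaussian integers) and pi = 3, 2, 2 for the norm of p. The exceptional
    lattice has dimension 2 pi in each case: it is p^-1 {x in R^(2 pi) | x_i =
    x_j mod p, \sum x_i in pi R}. What is proved is that a positive definite
    selfdual R-lattice of dimension n <= 2 pi is R^n or, when n = 2 pi, the
    exceptional lattice. For Gaussian integers evenness then excludes R^n,
    which contains vectors of norm 1, unless n = 0.

    All three rings embed in the rational quaternions, the Eisenstein integers
    by theta |-> i + j + k. Gram-Schmidt in a basis turns a lattice into a
    subset P of a positive definite hermitian space V over the quaternions that
    is equal to its own dual P^# = {x | <x|y> in R for all y in P}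
    ([model_exists]). In V one can pass freely between P and other selfdual
    sets.

    The induction splits off vectors of norm 1. When P has none, but has a
    vector v of norm pi, consider P' = P_v + v p^-1 R with P_v = {x in P |
    <v|x> in pR}. This neighbour is again selfdual ([neighbor_selfdual]), and it
    contains the unit vector v p^-1, so by induction it has an orthonormal
    basis F. Conversely P = P_v + uR with <v|u> = 1 mod pi, and w = up has
    integral coordinates in F. A basis vector with coordinate in pR would lie in
    P. Any element of R outside pR is congruent to a unit modulo pi, so F can be
    rescaled until all the coordinates of w are 1 modulo pi, and then z = (\sum
    F) p^-1 is in P ([glue_mem]). Its norm n / pi is an integer, so n = pi and z
    is a unit vector after all, or n = 2 pi and P is the exceptional lattice in
    the coordinates of F ([glue_lattice]).

    It remains to find a vector of norm 1 or pi. Projecting along minimal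
    vectors, and using that every element of the fraction field of R is at
    distance at most 1 - beta from R, one gets a minimal vector b and a dual
    vector f with beta^(n-1) |f|^2 |b|^2 <= 1 ([hermite]). For selfdual P both
    are in P, and the minimum m of P satisfies m^2 <= beta^-(n-1). With beta =
    1/2 and n <= 4 this is m^2 <= 8, hence m <= 2 = pi. For the Eisenstein
    integers beta = 2/3 and n <= 6, which gives m <= 2 where norm 1 or 3 is
    wanted. But two vectors of norm 2 whose product is a unit span a vector of
    norm 3; without norms 1 and 3 the projection of P along a vector of norm 2
    therefore has minimum at least 2, and two more applications of [hermite],
    to this projection and to that of the section by a second, orthogonal vector
    of norm 2, are contradictory ([no_short_false]).

    In the other direction a basis of the exceptional lattice is written down,
    selfduality is read off from the vectors p e_i, e_i - e_k and
    p^-1 (1, ..., 1), and a case distinction modulo p shows that there are no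
    vectors of norm 1, so that R^(2 pi) is not isometric to it. *)

Set Implicit Arguments.
Unset Strict Implicit.
Unset Printing Implicit Defensive.

Import Order.TTheory GRing.Theory Num.Theory.
Local Open Scope ring_scope.
Local Notation "x *r a" := ((a : quat^c) *: x) (at level 40, left associativity).

(** * Orders with a distinguished prime *)

(** The arithmetic of (R, p, pi) that does not depend on the ambient ring: it is
    used both for orders in algC and for orders of quaternions. The fields
    [prime_conjl], [prime_conjr] say that pS = Sp, and [prime_cj] that p and its
    conjugate generate the same ideal; [order_frac] that a rational number in S
    is an integer. *)
Record order_with_prime (D : unitRingType) (cj : D -> D) (S : subringClosed D)
    (p : D) (pi : nat) : Prop := OrderWithPrime {
  cjB : {morph cj : x y / x - y};
  cjM : forall x y, cj (x * y) = cj y * cj x;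
  cjK : involutive cj;
  cj_in : forall x, x \in S -> cj x \in S;
  norm_nat : forall x, x \in S ->
    exists k : nat, cj x * x = k%:R /\ (k = 0%N -> x = 0);
  natr_unit : forall k : nat, (0 < k)%N -> (k%:R : D) \is a GRing.unit;
  order_frac : forall k m : nat, (0 < m)%N -> k%:R / m%:R \in S -> (m %| k)%N;
  prime_in : p \in S;
  prime_norm : cj p * p = pi%:R;
  norm_prime : p * cj p = pi%:R;
  prime_unit : p \is a GRing.unit;
  pi_gt1 : (1 < pi)%N;
  prime_conjl : forall x, x \in S -> p^-1 * x * p \in S;
  prime_conjr : forall x, x \in S -> p * x * p^-1 \in S;
  prime_cj : p^-1 * cj p \in S
}.

Section OrderTheory.
Variables (D : unitRingType) (cj : D -> D) (S : subringClosed D).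
Variables (p : D) (pi : nat).
Hypothesis ordS : order_with_prime cj S p pi.

Lemma cj0 : cj 0 = 0. Proof. by rewrite -[in LHS](subrr 0) (cjB ordS) subrr. Qed.
Lemma cjN x : cj (- x) = - cj x.
Proof. by rewrite -[- x]sub0r (cjB ordS) cj0 sub0r. Qed.
Lemma cjD : {morph cj : x y / x + y}.
Proof. by move=> x y; rewrite -{1}[y]opprK (cjB ordS) cjN opprK. Qed.
Lemma cj1 : cj 1 = 1.
Proof. by rewrite -[LHS]mulr1 -{2}(cjK ordS 1) -(cjM ordS) mulr1 (cjK ordS). Qed.
Lemma cj_sum I (r : seq I) (P : pred I) F :
  cj (\sum_(i <- r | P i) F i) = \sum_(i <- r | P i) cj (F i).
Proof. by apply: (big_morph cj cjD cj0). Qed.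
Lemma cj_unit x : x \is a GRing.unit -> cj x \is a GRing.unit.
Proof.
move=> ux; apply/unitrP; exists (cj x^-1).
by rewrite -!(cjM ordS) divrr // mulVr // cj1.
Qed.
Lemma cjV x : x \is a GRing.unit -> cj x^-1 = (cj x)^-1.
Proof.
move=> ux; apply: (mulIr (cj_unit ux)).
by rewrite mulVr ?cj_unit // -(cjM ordS) divrr // cj1.
Qed.
Lemma natr_comm (k : nat) (x : D) : k%:R * x = x * k%:R.
Proof. by rewrite mulr_natl mulr_natr. Qed.
Lemma natrV_comm (k : nat) (x : D) : k%:R^-1 * x = x * k%:R^-1.
Proof. by apply/esym/commrV/commr_sym/natr_comm. Qed.

Let pU := prime_unit ordS.
Let pi_gt0 : (0 < pi)%N := ltnW (pi_gt1 ordS).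
Let piU := natr_unit ordS pi_gt0.

Lemma piV : pi%:R * p^-1 = cj p.
Proof. by rewrite -(prime_norm ordS) mulrK. Qed.
Lemma pVcjp : (cj p)^-1 * p^-1 = pi%:R^-1.
Proof. by rewrite -(norm_prime ordS) invrM // cj_unit. Qed.
Lemma pVpi : pi%:R^-1 * p = (cj p)^-1.
Proof. by rewrite -pVcjp mulrVK. Qed.

(** Divisibility by p is tested as p^-1 * x \in S; the ideal pS being two-sided and
    stable under conjugation, the side and p or its conjugate do not matter. *)
Lemma prime_dvdC x : (x * p^-1 \in S) = (p^-1 * x \in S).
Proof.
apply/idP/idP => h.
  by rewrite -[x](mulrVK pU) mulrA (prime_conjl ordS).
by rewrite -[x](mulVKr pU) (prime_conjr ordS).
Qed.
Lemma prime_dvd_cjp x : ((cj p)^-1 * x \in S) = (p^-1 * x \in S).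
Proof.
apply/idP/idP => h.
  rewrite -[x](mulVKr (cj_unit pU)) mulrA rpredM ?(prime_cj ordS) //.
have cjpS : p * (cj p)^-1 \in S.
  have := cj_in ordS (prime_cj ordS).
  by rewrite (cjM ordS) (cjK ordS) cjV.
rewrite -[x](mulVKr pU) mulrA rpredM //.
have -> : (cj p)^-1 * p = p^-1 * (p * (cj p)^-1) * p by rewrite mulKr.
exact: (prime_conjl ordS cjpS).
Qed.

(** Integrality of the exceptional lattice. Modulo S^(2 pi) both vectors are
    constant, equal to x_0 and y_0; the constant parts contribute
    2 pi (conj x_0) y_0 = 2 (conj (p x_0)) (p y_0), and the mixed terms are
    integral because the sums of x_i - x_0 and of y_i - y_0 are divisible by p. *)
Lemma congr_integral (I : eqType) (r : seq I) (x y : I -> D) :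
  size r = (2 * pi)%N ->
  {in r, forall i, p * x i \in S} -> {in r &, forall i j, p^-1 * (p * x i - p * x j) \in S} ->
  pi%:R^-1 * (\sum_(i <- r) p * x i) \in S ->
  {in r, forall i, p * y i \in S} -> {in r &, forall i j, p^-1 * (p * y i - p * y j) \in S} ->
  pi%:R^-1 * (\sum_(i <- r) p * y i) \in S ->
  \sum_(i <- r) cj (x i) * y i \in S.
Proof.
have sizeE : size r = (2 * pi)%N -> {i0 | i0 \in r}.
  case: r => [|i0 r] /=; last by exists i0; rewrite mem_head.
  by move/esym/eqP; rewrite muln_eq0 -[pi == 0%N]leqn0 leqNgt pi_gt0.
move=> sr; have [i0 i0r] := sizeE sr.
have shift z : {in r, forall i, p * z i \in S} ->
    {in r &, forall i j, p^-1 * (p * z i - p * z j) \in S} ->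
    pi%:R^-1 * (\sum_(i <- r) p * z i) \in S ->
    {in r, forall i, z i - z i0 \in S} /\
    (cj p)^-1 * (\sum_(i <- r) (z i - z i0)) \in S.
  move=> z1 z2 z3; split.
    by move=> i ir; have := z2 i i0 ir i0r; rewrite -mulrBr mulKr.
  have -> : (cj p)^-1 * (\sum_(i <- r) (z i - z i0)) =
     pi%:R^-1 * (\sum_(i <- r) p * z i) - (p * z i0) *+ 2.
    rewrite sumrB mulrBr big_const_seq count_predT iter_addr_0 sr.
    rewrite -mulr_sumr mulrA pVpi; congr (_ - _).
    rewrite mulnC mulrnA mulrnAr; congr (_ *+ _).
    by rewrite -mulr_natl -(prime_norm ordS) -mulrA mulKr ?cj_unit.
  by rewrite rpredB // rpredMn // z1.
move=> x1 x2 x3 y1 y2 y3; have [dx sx] := shift x x1 x2 x3.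
have [dy sy] := shift y y1 y2 y3.
have cjx0 : cj (x i0) * cj p \in S by rewrite -(cjM ordS) (cj_in ordS) ?x1.
have -> : \sum_(i <- r) cj (x i) * y i =
  \sum_(i <- r) cj (x i - x i0) * (y i - y i0) + cj (x i0) * (\sum_(i <- r) (y i - y i0))
   + cj (\sum_(i <- r) (x i - x i0)) * y i0 + cj (x i0) * y i0 *+ (2 * pi).
  rewrite -sr -(count_predT r) -iter_addr_0 -big_const_seq cj_sum mulr_sumr mulr_suml.
  rewrite -!big_split /=; apply: eq_bigr => i _.
  by rewrite (cjB ordS) -mulrDl subrK -addrA -mulrDl subrK -mulrDr subrK.
rewrite !rpredD //.
- rewrite big_seq rpred_sum // => i ir; rewrite rpredM ?dy //.
  exact/(cj_in ordS)/dx.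
- by rewrite -[cj (x i0)](mulrK (cj_unit pU)) -mulrA rpredM.
- rewrite -[y i0](mulKr pU) mulrA rpredM ?y1 //.
  have := cj_in ordS sx; rewrite (cjM ordS) -cjV // (cjK ordS).
  by [].
rewrite mulnC mulrnA rpredMn // -mulrnAr -mulr_natl -(prime_norm ordS) -mulrA mulrA.
by rewrite rpredM // y1.
Qed.

Lemma norms_fun (I : finType) (x : I -> D) : (forall i, x i \in S) ->
  exists k : I -> nat, forall i, cj (x i) * x i = (k i)%:R /\ (k i = 0%N -> x i = 0).
Proof.
move=> xS; have kP i : {k : nat | (cj (x i) * x i == k%:R) && ((k == 0%N) ==> (x i == 0))}.
  apply/sig_eqW; have [k [kE k0]] := norm_nat ordS (xS i); exists k.
  by rewrite kE eqxx; apply/implyP => /eqP/k0->.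
exists (fun i => sval (kP i)) => i; case: (kP i) => k /= /andP[/eqP kE /implyP k0].
by split=> // /eqP/k0/eqP.
Qed.

Lemma sum_norms (I : finType) (x : I -> D) : (forall i, x i \in S) ->
  exists K : nat, \sum_i cj (x i) * x i = K%:R /\ (K = 0%N -> forall i, x i = 0).
Proof.
move=> /norms_fun[k kP]; exists (\sum_i k i)%N; split.
  by rewrite natr_sum; apply: eq_bigr => i _; have [] := kP i.
by move=> /eqP; rewrite sum_nat_eq0 => /forallP k0 i; apply: (proj2 (kP i)); apply/eqP/(k0 i).
Qed.

Lemma natr_inj (k m : nat) : k%:R = m%:R :> D -> k = m.
Proof.
wlog km : k m / (k <= m)%N => [th|km_eq].
  by have [/th//|/ltnW/th h /esym/h] := leqP k m.
apply/eqP; rewrite eqn_leq km leqNgt; apply/negP => lt.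
have := natr_unit ordS (k := m - k); rewrite subn_gt0 natrB // km_eq subrr => /(_ lt).
by rewrite unitr0.
Qed.

End OrderTheory.

(** * Quaternions *)

Lemma qcoordM (x y : quat) :
  [/\ qcoord 0 (x * y) = qcoord 0 x * qcoord 0 y - qcoord 1 x * qcoord 1 y
                         - qcoord 2 x * qcoord 2 y - qcoord 3 x * qcoord 3 y,
      qcoord 1 (x * y) = qcoord 0 x * qcoord 1 y + qcoord 1 x * qcoord 0 y
                         + qcoord 2 x * qcoord 3 y - qcoord 3 x * qcoord 2 y,
      qcoord 2 (x * y) = qcoord 0 x * qcoord 2 y - qcoord 1 x * qcoord 3 y
                         + qcoord 2 x * qcoord 0 y + qcoord 3 x * qcoord 1 y
    & qcoord 3 (x * y) = qcoord 0 x * qcoord 3 y + qcoord 1 x * qcoord 2 y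
                         - qcoord 2 x * qcoord 1 y + qcoord 3 x * qcoord 0 y].
Proof. have -> : x * y = mulq x y :> quat by []. by rewrite /mulq !mkqK. Qed.

Lemma qcoord0M (x y : quat) : qcoord 0 (x * y) = qcoord 0 x * qcoord 0 y - qcoord 1 x * qcoord 1 y
                         - qcoord 2 x * qcoord 2 y - qcoord 3 x * qcoord 3 y.
Proof. by case: (qcoordM x y). Qed.
Lemma qcoord1M (x y : quat) : qcoord 1 (x * y) = qcoord 0 x * qcoord 1 y + qcoord 1 x * qcoord 0 y
                         + qcoord 2 x * qcoord 3 y - qcoord 3 x * qcoord 2 y.
Proof. by case: (qcoordM x y). Qed.
Lemma qcoord2M (x y : quat) : qcoord 2 (x * y) = qcoord 0 x * qcoord 2 y - qcoord 1 x * qcoord 3 y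
                         + qcoord 2 x * qcoord 0 y + qcoord 3 x * qcoord 1 y.
Proof. by case: (qcoordM x y). Qed.
Lemma qcoord3M (x y : quat) : qcoord 3 (x * y) = qcoord 0 x * qcoord 3 y + qcoord 1 x * qcoord 2 y
                         - qcoord 2 x * qcoord 1 y + qcoord 3 x * qcoord 0 y.
Proof. by case: (qcoordM x y). Qed.
Lemma qcoordN k x : qcoord k (- x) = - qcoord k x.
Proof. by rewrite /qcoord !mxE. Qed.
Lemma qcoord_0 k : qcoord k 0 = 0.
Proof. by rewrite /qcoord !mxE. Qed.

Lemma qcoordC x : [/\ qcoord 0 (conjq x) = qcoord 0 x,
  qcoord 1 (conjq x) = - qcoord 1 x, qcoord 2 (conjq x) = - qcoord 2 x &
  qcoord 3 (conjq x) = - qcoord 3 x].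
Proof. by rewrite /conjq !mkqK. Qed.
Lemma qcoord0C x : qcoord 0 (conjq x) = qcoord 0 x.
Proof. by case: (qcoordC x). Qed.
Lemma qcoord1C x : qcoord 1 (conjq x) = - qcoord 1 x.
Proof. by case: (qcoordC x). Qed.
Lemma qcoord2C x : qcoord 2 (conjq x) = - qcoord 2 x.
Proof. by case: (qcoordC x). Qed.
Lemma qcoord3C x : qcoord 3 (conjq x) = - qcoord 3 x.
Proof. by case: (qcoordC x). Qed.

Definition qrat (r : rat) : quat := mkq r 0 0 0.

Lemma qcoord0rat r : qcoord 0 (qrat r) = r. Proof. by rewrite mkqK. Qed.
Lemma qcoord1rat r : qcoord 1 (qrat r) = 0. Proof. by rewrite mkqK. Qed.
Lemma qcoord2rat r : qcoord 2 (qrat r) = 0. Proof. by rewrite mkqK. Qed.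
Lemma qcoord3rat r : qcoord 3 (qrat r) = 0. Proof. by rewrite mkqK. Qed.

(** Rewriting with [qE] turns an identity between quaternions into four rational
    identities. *)
Definition qE := (qcoord0M, qcoord1M, qcoord2M, qcoord3M,
  (qcoord0C, qcoord1C, qcoord2C, qcoord3C),
  (qcoord0rat, qcoord1rat, qcoord2rat, qcoord3rat),
  (qcoordD, qcoordB, qcoordN, qcoord_0)).

Ltac quat_ring := apply/quatP; rewrite ?qE; split; ring.

Lemma conjqB : {morph conjq : x y / x - y}.
Proof. by move=> x y; quat_ring. Qed.
Lemma conjq0 : conjq 0 = 0.
Proof. by quat_ring. Qed.
Lemma conjqN x : conjq (- x) = - conjq x.
Proof. by quat_ring. Qed.
Lemma conjqM x y : conjq (x * y) = conjq y * conjq x.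
Proof. by quat_ring. Qed.
Lemma conjqK : involutive conjq.
Proof. by move=> x; quat_ring. Qed.
Lemma qratB : {morph qrat : x y / x - y}.
Proof. by move=> x y; quat_ring. Qed.
Lemma qratD : {morph qrat : x y / x + y}.
Proof. by move=> x y; quat_ring. Qed.
Lemma qratM : {morph qrat : x y / x * y}.
Proof. by move=> x y; quat_ring. Qed.
Lemma qratC r x : qrat r * x = x * qrat r.
Proof. by quat_ring. Qed.
Lemma qratCA r (x y : quat) : x * (qrat r * y) = qrat r * (x * y).
Proof. by rewrite !mulrA qratC. Qed.
Lemma qrat1 : qrat 1 = 1. Proof. by []. Qed.
Lemma qrat0 : qrat 0 = 0.
Proof. by quat_ring. Qed.
Lemma conjq_rat r : conjq (qrat r) = qrat r.
Proof. by quat_ring. Qed.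
Lemma qrat_nat (k : nat) : qrat k%:R = k%:R.
Proof. by elim: k => [|k IH]; rewrite ?qrat0 // !mulrS qratD IH. Qed.
Lemma qrat_inj : injective qrat.
Proof. by move=> r s e; rewrite -(qcoord0rat r) e qcoord0rat. Qed.
Lemma qratVl r : r != 0 -> qrat r^-1 * qrat r = 1.
Proof. by move=> r0; rewrite -qratM mulVf. Qed.
Lemma quat_unit (x : quat) : (x \is a GRing.unit) = (x != 0). Proof. by []. Qed.
Lemma qratV r : qrat r^-1 = (qrat r)^-1.
Proof.
have [->|r0] := eqVneq r 0; first by rewrite invr0 qrat0 invr0.
have u : qrat r \is a GRing.unit.
  by rewrite quat_unit; apply: contraNneq r0 => /(congr1 (qcoord 0)); rewrite !qE => ->.
by apply: (mulIr u); rewrite qratVl // mulVr.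
Qed.
Lemma qrat_natV (k : nat) : qrat k%:R^-1 = k%:R^-1.
Proof. by rewrite qratV qrat_nat. Qed.

Lemma conjq_mul x : conjq x * x = qrat (normq x).
Proof. by rewrite /normq; quat_ring. Qed.
Lemma mul_conjq x : x * conjq x = qrat (normq x).
Proof. by rewrite /normq; quat_ring. Qed.
Lemma normqM x y : normq (x * y) = normq x * normq y.
Proof. by rewrite /normq !qE; ring. Qed.
Lemma normq_rat r : normq (qrat r) = r ^+ 2.
Proof. by rewrite /normq !qE; ring. Qed.
Lemma normq_ge0 x : 0 <= normq x.
Proof. by rewrite /normq !addr_ge0 ?sqr_ge0. Qed.
Lemma normqC x : normq (conjq x) = normq x.
Proof. by rewrite /normq !qE; ring. Qed.
Lemma normq0 : normq 0 = 0.
Proof. by apply/eqP; rewrite normq_eq0. Qed.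

(* Unification would otherwise unfold products of quaternions. *)
#[global] Opaque mulq mkq conjq.

(** * Hermitian spaces over the quaternions *)

Section Families.
Variables (V : lmodType quat^c) (h : V -> V -> quat).

Definition nrm (x : V) : rat := qcoord 0 (h x x).
Definition orthogonal (s : seq V) : bool :=
  all (fun x => x != 0) s && pairwise (fun x y => h x y == 0) s.
Definition orthonormal (s : seq V) : Prop :=
  uniq s /\ {in s &, forall x y, h x y = (x == y)%:R}.
End Families.

(** The dimension is expressed by orthogonal families: they have at most n members,
    and fewer than n vectors have a common orthogonal vector. This form
    of linear algebra over a division ring does without bases. *)
Record herm_space (V : lmodType quat^c) (h : V -> V -> quat) (n : nat) : Prop :=
  HermSpace {
  hBr : forall x y z, h x (y - z) = h x y - h x z;
  hZr : forall x y (a : quat), h x (y *r a) = h x y * a;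
  hC : forall x y, h x y = conjq (h y x);
  h_pos : forall x, x != 0 -> 0 < nrm h x;
  h_dim_le : forall s, orthogonal h s -> (size s <= n)%N;
  h_dim_ge : forall s, (size s < n)%N ->
    exists2 z, z != 0 & forall x, x \in s -> h x z = 0
}.

Section HermSpace.
Variables (V : lmodType quat^c) (h : V -> V -> quat) (n : nat).
Hypothesis hsp : herm_space h n.
Local Notation nrm := (nrm h).

Lemma rsA (x : V) (a b : quat) : x *r a *r b = x *r (a * b).
Proof. by rewrite scalerA. Qed.
Lemma h0r x : h x 0 = 0.
Proof. by rewrite -{1}(subrr (0 : V)) (hBr hsp) subrr. Qed.
Lemma hNr x y : h x (- y) = - h x y.
Proof. by rewrite -sub0r (hBr hsp) h0r sub0r. Qed.
Lemma hDr x y z : h x (y + z) = h x y + h x z.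
Proof. by rewrite -[z in LHS]opprK (hBr hsp) hNr opprK. Qed.
Lemma h0l x : h 0 x = 0.
Proof. by rewrite (hC hsp) h0r conjq0. Qed.
Lemma hBl x y z : h (x - y) z = h x z - h y z.
Proof. by rewrite (hC hsp) (hBr hsp) conjqB -!(hC hsp). Qed.
Lemma hDl x y z : h (x + y) z = h x z + h y z.
Proof. by rewrite -[y in LHS]opprK hBl -[- y]sub0r hBl h0l sub0r opprK. Qed.
Lemma hZl x y (a : quat) : h (x *r a) y = conjq a * h x y.
Proof. by rewrite (hC hsp) (hZr hsp) conjqM -(hC hsp). Qed.
Lemma h_sumr I (r : seq I) (P : pred I) F x :
  h x (\sum_(i <- r | P i) F i) = \sum_(i <- r | P i) h x (F i).
Proof. by apply: (big_morph (h x) (hDr x) (h0r x)). Qed.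
Lemma h_suml I (r : seq I) (P : pred I) F x :
  h (\sum_(i <- r | P i) F i) x = \sum_(i <- r | P i) h (F i) x.
Proof. by apply: (big_morph (h^~ x) (fun y z => hDl y z x) (h0l x)). Qed.

Lemma hnrm x : h x x = qrat (nrm x).
Proof.
have := hC hsp x x => /(congr1 (fun y => (qcoord 1 y, qcoord 2 y, qcoord 3 y))).
rewrite !qE => -[e1 e2 e3]; apply/quatP; rewrite !qE.
by split=> //; lra.
Qed.

Lemma nrm0 : nrm 0 = 0. Proof. by rewrite /nrm h0r qcoord_0. Qed.
Lemma nrm_eq0 x : (nrm x == 0) = (x == 0).
Proof.
apply/eqP/eqP => [e|->]; last exact: nrm0.
by apply/eqP; apply: contraTT isT => /(h_pos hsp); rewrite e ltxx.
Qed.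
Lemma nrm_ge0 x : 0 <= nrm x.
Proof. by have [->|/(h_pos hsp)/ltW//] := eqVneq x 0; rewrite nrm0. Qed.
Lemma nrmZ x (a : quat) : nrm (x *r a) = normq a * nrm x.
Proof.
apply: qrat_inj; rewrite -hnrm (hZr hsp) hZl hnrm -[conjq a * _]qratC -mulrA.
by rewrite conjq_mul -qratM mulrC.
Qed.
Lemma nrmD x y : nrm (x + y) = nrm x + nrm y + 2 * qcoord 0 (h x y).
Proof. by rewrite /nrm hDl !hDr (hC hsp y x) !qE; ring. Qed.
Lemma nrmD_orth x y : h x y = 0 -> nrm (x + y) = nrm x + nrm y.
Proof. by move=> e; rewrite nrmD e qcoord_0 mulr0 addr0. Qed.

Definition proj b x := x - b *r (qrat (nrm b)^-1 * h b x).

Lemma h_proj b x : b != 0 -> h b (proj b x) = 0.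
Proof.
move=> b0; rewrite (hBr hsp) (hZr hsp) hnrm mulrA -qratM.
by rewrite divff ?mul1r ?subrr // nrm_eq0.
Qed.
Lemma projK b x : proj b x + b *r (qrat (nrm b)^-1 * h b x) = x.
Proof. exact: subrK. Qed.
Lemma h_projr b x y : b != 0 -> h (proj b x) (proj b y) = h (proj b x) y.
Proof.
by move=> b0; rewrite [LHS](hBr hsp) (hZr hsp) (hC hsp _ b) h_proj // conjq0 mul0r subr0.
Qed.
Lemma proj_orth b x y : h y b = 0 -> h y (proj b x) = h y x.
Proof. by move=> e; rewrite (hBr hsp) (hZr hsp) e mul0r subr0. Qed.
Lemma projB b x y : proj b (x - y) = proj b x - proj b y.
Proof. by rewrite /proj (hBr hsp) mulrBr scalerBl !opprD !opprK addrACA. Qed.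
Lemma projZ b x (a : quat) : proj b (x *r a) = proj b x *r a.
Proof. by rewrite /proj (hZr hsp) scalerBr rsA mulrA. Qed.
Lemma proj_b b : b != 0 -> proj b b = 0.
Proof.
by move=> b0; rewrite /proj hnrm qratVl ?nrm_eq0 // scale1r subrr.
Qed.
Lemma nrm_proj b x : b != 0 ->
  nrm x = nrm (proj b x) + normq (qrat (nrm b)^-1 * h b x) * nrm b.
Proof.
move=> b0; rewrite -{1}(projK b x) nrmD_orth ?nrmZ //.
by rewrite (hZr hsp) (hC hsp) h_proj // conjq0 mul0r.
Qed.
Lemma hsym0 x y : h x y = 0 -> h y x = 0.
Proof. by move=> e; rewrite (hC hsp) e conjq0. Qed.

End HermSpace.

(** * Minimal vectors and dual vectors *)

(** [covering] bounds by 1 - beta the squared covering radius of S in its field of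
    fractions, whose elements are written x / k. [units_mod_pi] makes it possible
    to normalise coordinates modulo pi by rescaling basis vectors. *)
Record euclidean_order (S : subringClosed quat) (p : quat) (pi : nat) (beta : rat) :
    Prop := EuclideanOrder {
  order_prime : order_with_prime conjq S p pi;
  beta_gt0 : 0 < beta;
  beta_le1 : beta <= 1;
  covering : forall x k, x \in S -> (0 < k)%N ->
    exists2 a, a \in S & normq (k%:R^-1 * x - a) <= 1 - beta;
  units_mod_pi : forall x, x \in S -> p^-1 * x \in S \/
    exists e, [/\ e \in S, normq e = 1 & pi%:R^-1 * (x - e) \in S]
}.

Section Integrality.
Variables (S : subringClosed quat) (p : quat) (pi : nat).
Hypothesis ordS : order_with_prime conjq S p pi.

Lemma qrat_int_mem (r : rat) : qrat r \in S -> exists z : int, r = z%:~R.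
Proof.
wlog r0 : r / 0 <= r => [th|].
  case: (ger0P r) => [|r0 rS]; first exact: th.
  have [||z e] := th (- r); first by rewrite oppr_ge0 ltW.
    by rewrite -[- r]sub0r qratB qrat0 sub0r rpredN.
  by exists (- z); rewrite rmorphN /= -e opprK.
move=> rS; have [n [d [d0 rE]]] : exists n d : nat, (0 < d)%N /\ r = n%:R / d%:R.
  exists `|numq r|%N, `|denq r|%N; split; first by rewrite absz_gt0 denq_neq0.
  rewrite -[LHS]divq_num_den; congr (_ / _).
    by rewrite natr_absz ger0_norm // numq_ge0.
  by rewrite natr_absz ger0_norm // denq_ge0.
have := order_frac ordS (k := n) d0.
rewrite -!qrat_nat -qratV -qratM -rE => /(_ rS)/dvdnP[k kE].
exists k%:Z; rewrite rE kE natrM mulfK // pnatr_eq0 -lt0n //.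
Qed.

Lemma qrat_nat_mem (r : rat) : qrat r \in S -> 0 <= r -> exists k : nat, r = k%:R.
Proof.
move=> /qrat_int_mem[z ->]; rewrite ler0z; case: z => // k _; by exists k.
Qed.
End Integrality.

Lemma least_nat (P : nat -> Prop) : (exists k, P k) ->
  exists k, P k /\ forall j, P j -> (k <= j)%N.
Proof.
case=> k Pk; apply: NNPP => noleast; elim/ltn_ind: k Pk => k IH Pk.
apply: noleast; exists k; split=> // j Pj.
by rewrite leqNgt; apply/negP => /IH/(_ Pj).
Qed.

Section Reduction.
Variables (V : lmodType quat^c) (h : V -> V -> quat) (n : nat).
Hypothesis hsp : herm_space h n.
Variables (S : subringClosed quat) (p : quat) (pi : nat) (beta : rat).
Hypothesis eucS : euclidean_order S p pi beta.
Let ordS := order_prime eucS.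
Local Notation nrm := (nrm h).
Local Notation proj := (proj h).

Record submodule (T : V -> Prop) : Prop := Submodule {
  submod0 : T 0;
  submodB : forall x y, T x -> T y -> T (x - y);
  submodZ : forall x (a : quat), T x -> a \in S -> T (x *r a)
}.

(** Projections of a lattice are not integral, but their norms lie in (1/M) Z, so
    that minimal vectors still exist. *)
Definition bounded_denom (T : V -> Prop) :=
  exists2 M : nat, (0 < M)%N & forall x y, T x -> T y -> M%:R * h x y \in S.

Lemma min_vector T : bounded_denom T -> (exists2 x, T x & x != 0) ->
  exists b, [/\ T b, b != 0 & forall x, T x -> x != 0 -> nrm b <= nrm x].
Proof.
case=> M M0 MT [x Tx x0].
have Mnat y : T y -> exists k : nat, M%:R * nrm y = k%:R.
  move=> Ty; apply: (qrat_nat_mem ordS); last by rewrite mulr_ge0 ?(nrm_ge0 hsp).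
  by rewrite qratM qrat_nat -(hnrm hsp) MT.
have [] := @least_nat (fun k => exists y, [/\ T y, y != 0 & M%:R * nrm y = k%:R]).
  by have [k e] := Mnat _ Tx; exists k, x.
move=> k [[b [Tb b0 be]] kmin]; exists b; split=> // y Ty y0.
have [j je] := Mnat _ Ty.
have := kmin j (ex_intro _ y (And3 Ty y0 je)).
rewrite -(ler_nat rat) -be -je ler_pM2l // ltr0n //.
Qed.

(** The coefficient of a projection along b is a quotient x / k with x in S, and
    can be approximated by the covering property. *)
Lemma proj_coef_approx T b x M : (0 < M)%N -> b != 0 -> T b -> T x ->
  (forall x y, T x -> T y -> M%:R * h x y \in S) ->
  exists2 a, a \in S & normq (qrat (nrm b)^-1 * h b x - a) <= 1 - beta.
Proof.
move=> M0 b0 Tb Tx MT.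
have [k kE] : exists k : nat, M%:R * nrm b = k%:R.
  apply: (qrat_nat_mem ordS); last by rewrite mulr_ge0 ?(nrm_ge0 hsp).
  by rewrite qratM qrat_nat -(hnrm hsp) MT.
have k0 : (0 < k)%N.
  by rewrite -(ltr0n rat) -kE mulr_gt0 ?ltr0n // (h_pos hsp).
have [a aS ah] := covering eucS (MT _ _ Tb Tx) k0; exists a => //.
suff -> : qrat (nrm b)^-1 * h b x = k%:R^-1 * (M%:R * h b x) by [].
rewrite mulrA -qrat_natV -qrat_nat -qratM -kE invfM mulrAC mulVf ?mul1r //.
by rewrite pnatr_eq0 -lt0n.
Qed.

Lemma bounded_denom_proj T b : submodule T -> bounded_denom T -> T b -> b != 0 ->
  submodule (fun z => exists2 x, T x & z = proj b x) /\
  bounded_denom (fun z => exists2 x, T x & z = proj b x).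
Proof.
move=> sT [M M0 MT] Tb b0; split.
  split; first by exists 0; [exact: submod0 sT|by have := projB hsp b 0 0; rewrite !subrr => ->].
    move=> _ _ [x Tx ->] [y Ty ->]; exists (x - y); first exact: (submodB sT).
    by rewrite (projB hsp).
  move=> _ a [x Tx ->] aS; exists (x *r a); first exact: (submodZ sT).
  by rewrite (projZ hsp).
have [k kE] : exists k : nat, M%:R * nrm b = k%:R.
  apply: (qrat_nat_mem ordS); last by rewrite mulr_ge0 ?(nrm_ge0 hsp).
  by rewrite qratM qrat_nat -(hnrm hsp) MT.
have k0 : (0 < k)%N.
  by rewrite -(ltr0n rat) -kE mulr_gt0 ?ltr0n // (h_pos hsp).
exists (M * k)%N; first by rewrite muln_gt0 M0.
move=> _ _ [x Tx ->] [y Ty ->].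
have -> : (M * k)%:R * h (proj b x) (proj b y) =
  k%:R * (M%:R * h x y) - (M%:R * h x b) * (M%:R * h b y).
  have e : conjq (qrat (nrm b)^-1 * h b x) = h x b * qrat (nrm b)^-1.
    by rewrite conjqM conjq_rat -(hC hsp).
  rewrite (h_projr hsp) // (hBl hsp) (hZl hsp) e mulrBr natrM.
  rewrite -!qrat_nat; congr (_ - _); first by rewrite -mulrA qratCA.
  rewrite -[h x b * _ * _]mulrA (qratCA _ (h x b)).
  rewrite -[RHS]mulrA (qratCA _ (h x b)).
  rewrite !mulrA -!qratM.
  have -> // : M%:R * k%:R / nrm b = M%:R * M%:R.
  by rewrite -kE mulrA mulfK // (nrm_eq0 hsp).
by rewrite rpredB // rpredM ?MT // rpred_nat.
Qed.

Definition perp (s : seq V) (x : V) := forall y, y \in s -> h y x = 0.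

Lemma orthogonal_cons b s : b != 0 -> perp s b -> orthogonal h s ->
  orthogonal h (b :: s).
Proof.
move=> b0 bs /andP[s0 s1]; rewrite /orthogonal /= b0 s0 s1 !andbT /=.
by apply/allP=> y /bs/(hsym0 hsp)/eqP.
Qed.

(** When T lies on the line of its minimal vector b it is equal to b S: the
    difference of x and its approximation b a is shorter than b. Hence b / |b|^2
    is a dual vector. *)
Lemma dual_of_line T b M : submodule T -> (0 < M)%N -> T b -> b != 0 ->
  (forall x y, T x -> T y -> M%:R * h x y \in S) ->
  (forall x, T x -> x != 0 -> nrm b <= nrm x) ->
  (forall x, T x -> proj b x = 0) ->
  forall x, T x -> h (b *r qrat (nrm b)^-1) x \in S.
Proof.
move=> sT M0 Tb b0 MT bmin T1 x Tx; rewrite (hZl hsp) conjq_rat.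
set c := qrat _; have bpos := h_pos hsp b0.
have [a aS] := proj_coef_approx M0 b0 Tb Tx MT; rewrite -/c => ha.
have xE : x = b *r (c * h b x) by rewrite -[LHS](projK h b) T1 // add0r.
suff e : x - b *r a = 0.
  have /eqP := congr1 (h b) e; rewrite (hBr hsp) (hZr hsp) (hnrm hsp) (h0r hsp).
  by rewrite subr_eq0 => /eqP ->; rewrite mulrA -qratM mulVf ?mul1r // lt0r_neq0.
apply/eqP; apply: contraT => nz.
have := bmin _ (submodB sT Tx (submodZ sT Tb aS)) nz.
have -> : x - b *r a = b *r (c * h b x - a) by rewrite {1}xE -scalerBl.
rewrite (nrmZ hsp); move: ha; move: (normq _) => q ha.
have := beta_gt0 eucS; nra.
Qed.

(** Hermite's bound in its dual form. Let b' be minimal in the projection of T along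
    b, lifted to x' with coefficient along b of norm at most 1 - beta; minimality
    of b gives |b|^2 <= |b'|^2 + (1 - beta) |b|^2, so beta |b|^2 <= |b'|^2. The
    dual vector f of the projection is orthogonal to b and so is dual to T as
    well. The norm of a dual vector stands here for the determinant of the usual bound. *)
Lemma hermite m s T : orthogonal h s -> (n <= size s + m.+1)%N ->
  submodule T -> bounded_denom T -> (forall x, T x -> perp s x) ->
  (exists2 x, T x & x != 0) ->
  exists b f, [/\ T b, b != 0 & forall x, T x -> x != 0 -> nrm b <= nrm x]
    /\ [/\ perp s f, f != 0, forall x, T x -> h f x \in S
         & beta ^+ m * (nrm f * nrm b) <= 1].
Proof.
elim: m s T => [|m IH] s T os ns sT dT Ts Tnz;
  have [b [Tb b0 bmin]] := min_vector dT Tnz;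
  have [M M0 MT] := dT;
  have bpos := h_pos hsp b0;
  have [b_beta b_le1] := (beta_gt0 eucS, beta_le1 eucS);
  have obs : orthogonal h (b :: s) by [apply: orthogonal_cons => //; apply: Ts];
  (have [[x Tx px]|T1] := classic (exists2 x, T x & proj b x != 0);
   last by [
   exists b, (b *r qrat (nrm b)^-1); split=> //; split;
   [ by move=> y ys; rewrite (hZr hsp) (Ts _ Tb) // mul0r
   | by rewrite -(nrm_eq0 hsp) (nrmZ hsp) normq_rat mulf_neq0 ?expf_neq0 ?invr_eq0 //;
     exact: lt0r_neq0
   | apply: (dual_of_line sT M0 Tb b0 MT bmin) => x Tx; apply/eqP;
     apply: contraT => px; case: T1; exists x
   | rewrite (nrmZ hsp) normq_rat;
     (have -> : (nrm b)^-1 ^+ 2 * nrm b * nrm b = 1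
       by [field; exact: lt0r_neq0]);
     rewrite mulr1 exprn_ile1 // ltW ]]).
  have pperp : perp (b :: s) (proj b x).
    move=> y; rewrite inE => /predU1P[->|ys]; first exact: (h_proj hsp).
    by rewrite (proj_orth hsp) ?Ts.
  have := h_dim_le hsp (orthogonal_cons px pperp obs).
  by rewrite /= => /leq_trans/(_ ns); rewrite addn1 ltnn.
(* T has rank at least 2: pass to the projection along b. *)
have [sT' dT'] := bounded_denom_proj sT dT Tb b0.
have [|||b' [f [[[x' Tx' ->] b'0 _] [fp f0 fS fb]]]] := IH _ _ obs _ sT' dT'.
- by rewrite /= addSnnS.
- move=> _ [z Tz ->] y; rewrite inE => /predU1P[->|ys]; first exact: (h_proj hsp).
  by rewrite (proj_orth hsp) ?Ts.
- by exists (proj b x) => //; exists x.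
exists b, f; split=> //; split=> //.
- by move=> y ys; rewrite fp // inE ys orbT.
- move=> z Tz; rewrite -(proj_orth hsp z (b := b)); first by apply: fS; exists z.
  by apply/(hsym0 hsp)/fp; rewrite inE eqxx.
have [a aS ha] := proj_coef_approx M0 b0 Tb Tx' MT.
pose y := x' - b *r a; have Ty : T y by apply: (submodB sT) => //; apply: (submodZ sT).
have pyE : proj b y = proj b x' by rewrite (projB hsp) (projZ hsp) (proj_b hsp) // scaler0 subr0.
have y0 : y != 0.
  by apply: contraNneq b'0 => e; rewrite -pyE e; have := projB hsp b 0 0; rewrite !subrr => ->.
have := bmin _ Ty y0; rewrite (nrm_proj hsp y b0) pyE.
have -> : qrat (nrm b)^-1 * h b y = qrat (nrm b)^-1 * h b x' - a.
  rewrite (hBr hsp) (hZr hsp) (hnrm hsp) mulrBr mulrA -qratM mulVf ?lt0r_neq0 //.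
  by rewrite mul1r.
move: ha; move: (normq _) => q ha; move: fb; have := h_pos hsp f0.
have := h_pos hsp b'0; move: (nrm (proj b x')) => c'; move: (nrm f) => F.
rewrite exprS; have := exprn_gt0 m b_beta; move: (beta ^+ m) => B B0 c0 F0 fb nb.
have bc : beta * nrm b <= c' by nra.
apply: le_trans fb; rewrite [beta * B]mulrC -mulrA ler_pM2l //.
by rewrite mulrCA ler_pM2l.
Qed.

End Reduction.

(** * Orthonormal families *)

Section Frames.
Variables (V : lmodType quat^c) (h : V -> V -> quat) (n : nat).
Hypothesis hsp : herm_space h n.
Local Notation nrm := (nrm h).
Local Notation orthonormal := (orthonormal h).
Local Notation perp := (perp h).

Lemma orthonormal_sum e g y : orthonormal e -> y \in e ->
  h y (\sum_(z <- e) z *r g z) = g y.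
Proof.
move=> [ue he] ye; rewrite (h_sumr hsp) (bigD1_seq y) //= big_seq_cond big1.
  by rewrite addr0 (hZr hsp) he // eqxx mul1r.
by move=> z /andP[ze /negPf zy]; rewrite (hZr hsp) he // eq_sym zy mul0r.
Qed.

Definition perp_part e x := x - \sum_(z <- e) z *r h z x.

Lemma perp_part_perp e x : orthonormal e -> perp e (perp_part e x).
Proof.
by move=> oe y ye; rewrite (hBr hsp) (orthonormal_sum (h^~ x)) // subrr.
Qed.

Lemma h1_neq0 x : h x x = 1 -> x != 0.
Proof.
by move=> e; apply: contra_eq_neq e => ->; rewrite (h0r hsp) eq_sym oner_neq0.
Qed.

Lemma orthonormal_orthogonal e : orthonormal e -> orthogonal h e.
Proof.
move=> [ue he]; apply/andP; split.
  by apply/allP=> x xe; apply: h1_neq0; rewrite he // eqxx.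
apply/(pairwiseP 0) => i j; rewrite !inE => ie je ij.
rewrite he ?mem_nth // nth_uniq // ltn_eqF //.
Qed.

Lemma orthonormal_rcons e x : orthonormal e -> perp e x -> h x x = 1 ->
  orthonormal (rcons e x).
Proof.
move=> [ue he] ex x1; have xe : x \notin e.
  by apply/negP => xe; have := ex x xe; rewrite x1 => /eqP; rewrite oner_eq0.
split; first by rewrite rcons_uniq xe.
move=> y z; rewrite !mem_rcons !inE.
case/predU1P=> [->|ye] /predU1P[->|ze]; [by rewrite eqxx | | | exact: he].
  rewrite (hsym0 hsp (ex z ze)); case: eqP => // xz; by rewrite xz ze in xe.
by rewrite (ex y ye); case: eqP => // xy; rewrite -xy ye in xe.
Qed.

Lemma orthonormal_catl e f : orthonormal (e ++ f) -> orthonormal e.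
Proof.
move=> [+ hef]; rewrite cat_uniq => /and3P[ue _ _]; split=> // x y xe ye.
by apply: hef; rewrite mem_cat ?xe ?ye.
Qed.

Lemma orthonormal_catr e f : orthonormal (e ++ f) -> orthonormal f.
Proof.
move=> [+ hef]; rewrite cat_uniq => /and3P[_ _ uf]; split=> // x y xe ye.
by apply: hef; rewrite mem_cat ?xe ?ye orbT.
Qed.

Lemma orthonormal_cat_perp e f x : orthonormal (e ++ f) -> x \in f -> perp e x.
Proof.
move=> [+ hef] xf y ye; rewrite cat_uniq => /and3P[_ /hasPn ef _].
rewrite hef ?mem_cat ?xf ?ye ?orbT //; case: eqP => // yx.
by have := ef x xf; rewrite -yx /= ye.
Qed.

Section Frame.
Variable F : seq V.
Hypotheses (oF : orthonormal F) (sF : size F = n).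

Lemma frame_sum x : x = \sum_(z <- F) z *r h z x.
Proof.
apply/eqP; rewrite -subr_eq0; apply: contraT => nz.
have := h_dim_le hsp (orthogonal_cons hsp nz (perp_part_perp x oF) (orthonormal_orthogonal oF)).
by rewrite /= sF ltnn.
Qed.

Lemma frame_h x y : h x y = \sum_(z <- F) conjq (h z x) * h z y.
Proof.
rewrite {1}(frame_sum y) (h_sumr hsp); apply: eq_bigr => z _.
by rewrite (hZr hsp) [h x z](hC hsp).
Qed.

End Frame.

Lemma orthonormal_rescale e f (d : V -> quat) : orthonormal (e ++ f) ->
  {in f, forall x, normq (d x) = 1} -> orthonormal (e ++ [seq x *r d x | x <- f]).
Proof.
move=> oef d1; have [[ue he] [uf hf]] := (orthonormal_catl oef, orthonormal_catr oef).
have inj : {in f &, injective (fun x => x *r d x)}.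
  move=> x y xf yf /= /(congr1 (h x)); rewrite !(hZr hsp) !hf // eqxx mul1r.
  case: eqP => // _; rewrite mul0r => /(congr1 normq); rewrite d1 // normq0.
  by move/eqP; rewrite oner_eq0.
have ef0 y x : y \in e -> x \in [seq x *r d x | x <- f] -> h y x = 0.
  by move=> ye /mapP[z zf ->]; rewrite (hZr hsp) (orthonormal_cat_perp oef zf ye) mul0r.
have f1 x : x \in [seq x *r d x | x <- f] -> h x x = 1.
  move=> /mapP[z zf ->]; rewrite (hZr hsp) (hZl hsp) hf // eqxx mulr1.
  by rewrite conjq_mul d1.
split.
  rewrite cat_uniq ue map_inj_in_uniq // uf andbT; apply/hasPn => x xf.
  apply/negP => /= xe; have := ef0 x x xe xf.
  by rewrite f1 // => /eqP; rewrite oner_eq0.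
move=> x y; rewrite !mem_cat => /orP[xe|xf] /orP[ye|yf].
- exact: he.
- rewrite ef0 //; case: eqP => // xy; have := ef0 x y xe yf.
  by rewrite xy f1 // => /eqP; rewrite oner_eq0.
- rewrite (hsym0 hsp) ?ef0 //; case: eqP => // xy; have := ef0 y x ye xf.
  by rewrite -xy f1 // => /eqP; rewrite oner_eq0.
case: (mapP xf) (mapP yf) => [a af ->] [b bf ->]; rewrite (inj_in_eq inj) //.
rewrite (hZr hsp) (hZl hsp) hf //; case: eqP => [->|_]; last by rewrite mulr0 mul0r.
by rewrite mulr1 conjq_mul d1.
Qed.

End Frames.

(** * Selfdual lattices and their neighbours *)

Section SelfDual.
Variables (V : lmodType quat^c) (h : V -> V -> quat) (n : nat).
Hypothesis hsp : herm_space h n.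
Local Notation nrm := (nrm h).
Local Notation orthonormal := (orthonormal h).
Local Notation perp := (perp h).
Variables (S : subringClosed quat) (p : quat) (pi : nat) (beta : rat).
Hypothesis eucS : euclidean_order S p pi beta.
Let ordS := order_prime eucS.
Let pU := prime_unit ordS.
Let cjS x : x \in S -> conjq x \in S := cj_in ordS (x := x).

(** P is equal to its own dual. By [h_dim_ge] such a P spans the space, so this one
    condition contains integrality, selfduality and full rank. *)
Definition selfdual_in (P : V -> Prop) :=
  forall x, P x <-> forall y, P y -> h x y \in S.

Section Theory.
Variable P : V -> Prop.
Hypothesis sdP : selfdual_in P.

Lemma sd_in x y : P x -> P y -> h x y \in S.
Proof. by move/sdP=> hx /hx. Qed.

Lemma sd_sub : submodule S P.
Proof.
split; first by apply/sdP => y _; rewrite (h0l hsp) rpred0.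
  by move=> x y Px Py; apply/sdP => z Pz; rewrite (hBl hsp) rpredB // sd_in.
by move=> x a Px aS; apply/sdP => z Pz; rewrite (hZl hsp) rpredM ?sd_in ?cjS.
Qed.

Lemma sdB x y : P x -> P y -> P (x - y). Proof. exact: (submodB sd_sub). Qed.
Lemma sdZ x (a : quat) : P x -> a \in S -> P (x *r a).
Proof. exact: (submodZ sd_sub). Qed.
Lemma sdD x y : P x -> P y -> P (x + y).
Proof. by move=> Px Py; rewrite -[y]opprK -[- y]sub0r; do !apply: sdB => //; exact: (submod0 sd_sub). Qed.
Lemma sd_sum (r : seq V) F : {in r, forall x, P (F x)} -> P (\sum_(x <- r) F x).
Proof.
elim: r => [|z r IH] Pr; first by rewrite big_nil; exact: (submod0 sd_sub).
rewrite big_cons; apply: sdD; first by apply: Pr; rewrite mem_head.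
by apply: IH => x xr; apply: Pr; rewrite inE xr orbT.
Qed.

Lemma sd_nrm x : P x -> exists k : nat, nrm x = k%:R.
Proof.
move=> Px; apply: (qrat_nat_mem ordS); last exact: (nrm_ge0 hsp).
by rewrite -(hnrm hsp) sd_in.
Qed.

Lemma sd_perp_part e x : {in e, forall y, P y} -> P x -> P (perp_part h e x).
Proof.
by move=> Pe Px; apply: sdB => //; apply: sd_sum => z ze; apply: sdZ; rewrite ?sd_in //; apply: Pe.
Qed.

Lemma perp_part_h e x y : perp e x -> h x (perp_part h e y) = h x y.
Proof.
move=> ex; rewrite (hBr hsp) (h_sumr hsp) big_seq big1 ?subr0 // => z ze.
by rewrite (hZr hsp) (hsym0 hsp (ex z ze)) mul0r.
Qed.

(** The orthogonal complement in P of an orthonormal family of P is selfdual, as the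
    family splits off. *)
Lemma perp_mem e x : orthonormal e -> {in e, forall y, P y} -> perp e x ->
  (forall y, P y -> perp e y -> h x y \in S) -> P x.
Proof.
move=> oe Pe ex hx; apply/sdP => y Py; rewrite -(perp_part_h y ex).
by apply: hx; [apply: sd_perp_part|apply: (perp_part_perp hsp)].
Qed.

(** Both vectors of [hermite] are in P, so the minimum bounds the norm of either. *)
Lemma sd_hermite e m : orthonormal e -> {in e, forall y, P y} ->
  (size e < n <= size e + m.+1)%N ->
  exists v, [/\ P v, perp e v, v != 0, beta ^+ m * nrm v ^+ 2 <= 1
     & forall x, P x -> perp e x -> x != 0 -> nrm v <= nrm x].
Proof.
move=> oe Pe /andP[en nm]; pose T x := P x /\ perp e x.
have sT : submodule S T.
  split; first by split; [exact: (submod0 sd_sub)|move=> y _; rewrite (h0r hsp)].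
    move=> x y [Px ex] [Py ey]; split; first exact: sdB.
    by move=> z ze; rewrite (hBr hsp) ex // ey // subr0.
  move=> x a [Px ex] aS; split; first exact: sdZ.
  by move=> z ze; rewrite (hZr hsp) ex // mul0r.
have dT : bounded_denom h S T.
  by exists 1%N => // x y [Px _] [Py _]; rewrite mul1r sd_in.
(* A nonzero vector orthogonal to e and to T would be in the dual of P. *)
have Tnz : exists2 x, T x & x != 0.
  apply: NNPP => T0; have [z z0 ez] := h_dim_ge hsp en.
  have Teq0 y : T y -> y = 0.
    by move=> Ty; apply/eqP; apply: contraT => y0; case: T0; exists y.
  case: T0; exists z => //; split=> //; apply: (perp_mem oe Pe ez) => y Py ey.
  by rewrite (Teq0 y) // (h0r hsp) rpred0.
have Tperp x : T x -> perp e x by case.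
have [b [f [[[Pb eb] b0 bmin] [ef f0 fT fb]]]] :=
  hermite hsp eucS (orthonormal_orthogonal hsp oe) nm sT dT Tperp Tnz.
exists b; split=> //; last by move=> x Px ex; apply: bmin.
have Pf : P f by apply: (perp_mem oe Pe ef) => y Py ey; apply: fT.
have bf : nrm b <= nrm f by apply: bmin.
apply: le_trans fb; rewrite ler_pM2l ?exprn_gt0 ?(beta_gt0 eucS) //.
by rewrite expr2 ler_wpM2r // (nrm_ge0 hsp).
Qed.

End Theory.

Lemma in_conj x y : (h x y \in S) = (h y x \in S).
Proof. by apply/idP/idP => /cjS; rewrite -(hC hsp). Qed.

Section Neighbor.
Variables (P : V -> Prop) (v u : V).
Hypotheses (sdP : selfdual_in P) (Pv : P v) (Pu : P u).
Hypotheses (nv : nrm v = pi%:R) (uv : pi%:R^-1 * (h v u - 1) \in S).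
Let w := v *r p^-1.
Let piU : (pi%:R : quat) \is a GRing.unit := natr_unit ordS (ltnW (pi_gt1 ordS)).

Lemma pS_unit_mod x : pi%:R^-1 * (x - 1) \in S -> p^-1 * (x - 1) \in S.
Proof.
move=> xS; rewrite -[x - 1](mulVKr piU) mulrA rpredM //.
by rewrite -natr_comm (piV ordS) (cj_in ordS) // (prime_in ordS).
Qed.

Lemma neighbor_h_w x : h w x = (conjq p)^-1 * h v x.
Proof. by rewrite (hZl hsp) (cjV ordS) ?(prime_unit ordS). Qed.

Lemma neighbor_w_in x : (h w x \in S) = (p^-1 * h v x \in S).
Proof. by rewrite neighbor_h_w (prime_dvd_cjp ordS). Qed.

Lemma neighbor_ww : h w w = 1.
Proof.
rewrite neighbor_h_w (hZr hsp) (hnrm hsp) nv qrat_nat (piV ordS) mulVr //.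
exact: (cj_unit ordS).
Qed.

(** The lattice P_v + v p^-1 S, with P_v the set of y in P such that <v|y> is
    divisible by p; v p^-1 has norm 1. *)
Definition neighbor x := exists y (a : quat),
  [/\ P y, p^-1 * h v y \in S, a \in S & x = y + w *r a].

(** As <v|u> is 1 modulo pi, P is generated by P_v and u. *)
Lemma neighbor_decomp x : P x -> exists y (a : quat),
  [/\ P y, p^-1 * h v y \in S, a \in S & x = y + u *r a].
Proof.
move=> Px; have aS := sd_in sdP Pv Px.
exists (x - u *r h v x), (h v x); split=> //; last by rewrite subrK.
  by apply: (sdB sdP) => //; apply: (sdZ sdP).
rewrite (hBr hsp) (hZr hsp) -{1}[h v x]mul1r -mulrBl mulrA rpredM //.
by rewrite -opprB mulrN rpredN pS_unit_mod.
Qed.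

Lemma neighbor_up : p^-1 * h v (u *r p) \in S.
Proof. by rewrite (hZr hsp) mulrA (prime_conjl ordS) // (sd_in sdP). Qed.

(** Let x be dual to the neighbour. Its product b with u satisfies b p \in S because
    up is in the neighbour; subtracting v p^-1 (p b) makes the product with u
    integral and keeps those with P_v integral, so the difference is in P^# = P, and in
    P_v as its product with v is divisible by p. *)
Lemma neighbor_selfdual : selfdual_in neighbor.
Proof.
move=> x; split=> [[y [a [Py vy aS ->]]] _ [y' [a' [Py' vy' aS' ->]]]|hx].
  have yw : h y w \in S by rewrite in_conj neighbor_w_in.
  have wy' : h w y' \in S by rewrite neighbor_w_in.
  rewrite (hDl hsp) !(hDr hsp) !(hZl hsp w) !(hZr hsp _ w) neighbor_ww mul1r.
  by rewrite !rpredD ?rpredM ?cjS // (sd_in sdP).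
have hxw : h w x \in S.
  rewrite in_conj; apply: hx; exists 0, 1; rewrite scale1r add0r rpred1; split=> //.
    exact: (submod0 (sd_sub sdP)).
  by rewrite (h0r hsp) mulr0 rpred0.
have upN : neighbor (u *r p).
  exists (u *r p), 0; rewrite scale0r addr0 rpred0 neighbor_up; split=> //.
  by apply: (sdZ sdP) => //; exact: (prime_in ordS).
pose b := h u x.
have pb : conjq p * b \in S by rewrite -(hZl hsp) in_conj hx.
have bp : b * p \in S.
  rewrite -[b](mulKr (cj_unit ordS pU)) -mulrA (prime_dvd_cjp ordS) mulrA.
  exact: (prime_conjl ordS).
have aS : p * b \in S.
  by rewrite -[b](mulrK pU) mulrA (prime_conjr ordS).
have hvw a : h v (w *r a) = conjq p * a.
  by rewrite (hZr hsp) (hZr hsp) (hnrm hsp) nv qrat_nat (piV ordS).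
have Px' : P (x - w *r (p * b)).
  apply/sdP => z /neighbor_decomp[y [d [Py vy dS ->]]].
  have yN : neighbor y by exists y, 0; rewrite scale0r addr0 rpred0; split.
  rewrite (hDr hsp) rpredD //.
    rewrite (hBl hsp) (hZl hsp) rpredB ?hx // rpredM ?cjS //.
    by rewrite neighbor_w_in.
  rewrite (hZr hsp) rpredM // in_conj (hBr hsp) (hZr hsp) (hZr hsp) -/b.
  rewrite mulrA -[_ / p * p]mulrA mulVr // mulr1 -{1}[b]mul1r -mulrBl.
  have := cjS uv; rewrite conjqM conjqB -(hC hsp) -qrat_natV conjq_rat qrat_natV.
  have -> : conjq 1 = 1 by rewrite -qrat1 conjq_rat.
  move=> uv'.
  have -> : (1 - h u v) * b = (1 - h u v) / pi%:R * (pi%:R * b) by rewrite mulrA mulrVK.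
  rewrite rpredM //.
    by rewrite -opprB mulNr rpredN.
  by rewrite -(prime_norm ordS) -mulrA rpredM // cjS ?(prime_in ordS).
exists (x - w *r (p * b)), (p * b); split=> //; last by rewrite subrK.
rewrite (hBr hsp) hvw mulrBr rpredB //; first by rewrite -neighbor_w_in.
have -> : p^-1 * (conjq p * (p * b)) = p^-1 * conjq p * (p * b) by rewrite -[RHS]mulrA.
by apply: rpredM => //; exact: (prime_cj ordS).
Qed.

Section Glue.
Variables e G : seq V.
Hypotheses (oF : orthonormal (e ++ G)) (sF : size (e ++ G) = n).
Hypotheses (eP : {in e, forall x, P x}) (FN : {in e ++ G, forall x, neighbor x}).
Hypothesis Gup : {in G, forall x, pi%:R^-1 * (h x (u *r p) - 1) \in S}.

(** The coordinates of u p in the orthonormal basis e ++ G of the neighbour are in pS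
    on e and congruent to 1 modulo pi on G. So u differs by a vector with
    integral coordinates from [glue], whose coordinates are 0 on e and p^-1 on
    G. *)
Definition glue := (\sum_(x <- G) x) *r p^-1.

Lemma glue_coord x : x \in G -> h x glue = p^-1.
Proof.
move=> xG; rewrite (hZr hsp).
have := orthonormal_sum hsp (fun _ => 1) (orthonormal_catr oF) xG.
rewrite (eq_bigr id) => [->|z _]; by rewrite ?mul1r ?scale1r.
Qed.

Lemma glue_perp : perp e glue.
Proof.
move=> x xe; rewrite (hZr hsp) (h_sumr hsp) big_seq big1 ?mul0r // => z zG.
exact: (orthonormal_cat_perp oF zG).
Qed.

Lemma h_glue x : h glue x = (conjq p)^-1 * \sum_(y <- G) h y x.
Proof. by rewrite (hZl hsp) (h_suml hsp) (cjV ordS). Qed.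

Let y := u - glue.

(** The coordinates of u p being 1 modulo pi, and not just modulo p, those of
    u - glue are integral and even divisible by the conjugate of p, which is what
    makes the product of glue and u - glue integral. *)
Lemma glue_defect_coord x : x \in G -> exists2 s, s \in S & h x y = s * conjq p.
Proof.
move=> xG; exists (pi%:R^-1 * (h x (u *r p) - 1)); first exact: Gup.
rewrite (hBr hsp) glue_coord // (hZr hsp) natrV_comm -mulrA -(piV ordS).
by rewrite [_^-1 * (_ * _)]mulKr // mulrBl mulrK // mul1r.
Qed.

Lemma glue_defect_int x : x \in e ++ G -> h x y \in S.
Proof.
rewrite mem_cat => /orP[xe|xG].
  by rewrite (hBr hsp) (glue_perp xe) subr0; apply: (sd_in sdP) => //; apply: eP.
have [s sS ->] := glue_defect_coord xG.
by rewrite rpredM ?cjS //; exact: (prime_in ordS).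
Qed.

Lemma h_glue_defect : h glue y \in S.
Proof.
rewrite h_glue mulr_sumr big_seq rpred_sum // => x xG.
have [s sS ->] := glue_defect_coord xG; rewrite (prime_dvd_cjp ordS) mulrA.
rewrite -[conjq p](mulVKr pU) mulrA rpredM ?(prime_conjl ordS) //.
exact: (prime_cj ordS).
Qed.

Lemma h_defect_int x : neighbor x -> h y x \in S.
Proof.
move=> Nx; rewrite (frame_h hsp oF sF) big_seq rpred_sum // => z zF.
rewrite rpredM ?cjS ?glue_defect_int //.
by apply: (sd_in neighbor_selfdual) => //; apply: FN.
Qed.

Let uE : u = glue + y. Proof. by rewrite addrC subrK. Qed.

Lemma h_glue_glue : h glue glue \in S.
Proof.
have yy : h y y \in S.
  rewrite (frame_h hsp oF sF) big_seq rpred_sum // => z zF.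
  by rewrite rpredM ?cjS ?glue_defect_int.
have -> : h glue glue = h u u - h glue y - (h y glue + h y y).
  by rewrite {1 2}uE (hDl hsp glue y) !(hDr hsp _ glue y) [_ - h glue y]addrAC !addrK.
apply: rpredB; first by apply: rpredB; [exact: (sd_in sdP)|exact: h_glue_defect].
by apply: rpredD => //; rewrite in_conj; exact: h_glue_defect.
Qed.

Lemma glue_nrm : nrm glue = (size G)%:R / pi%:R.
Proof.
apply: qrat_inj; rewrite -(hnrm hsp) h_glue big_seq (eq_bigr (fun _ => p^-1)) => [|x xG].
  rewrite -big_seq big_const_seq count_predT iter_addr_0 mulrnAr (pVcjp ordS).
  by rewrite -mulr_natl qratM qrat_natV qrat_nat.
exact: glue_coord.
Qed.

(** The norm of glue is integral because those of u and of u - glue are, as well as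
    the product of glue and u - glue. *)
Lemma glue_dvd : (pi %| size G)%N.
Proof.
apply: (order_frac ordS (ltnW (pi_gt1 ordS))).
by rewrite -qrat_natV -qrat_nat -qratM -glue_nrm -(hnrm hsp) h_glue_glue.
Qed.

Lemma glue_mem : P glue.
Proof.
apply/sdP => z /neighbor_decomp[z0 [c [Pz0 vz0 cS ->]]].
have N0 : neighbor z0 by exists z0, 0; rewrite scale0r addr0 rpred0; split.
rewrite (hDr hsp) (hZr hsp) rpredD //.
  have -> : glue = u - y by rewrite uE addrK.
  by rewrite (hBl hsp) rpredB ?h_defect_int // (sd_in sdP).
by rewrite rpredM // uE (hDr hsp) rpredD ?h_glue_glue ?h_glue_defect.
Qed.

(** The defining congruences of the exceptional lattice, in the coordinates of F. *)
Definition congr_coord (F : seq V) x :=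
  [/\ {in F, forall f, p * h f x \in S},
      {in F &, forall f g, p^-1 * (p * h f x - p * h g x) \in S}
    & pi%:R^-1 * (\sum_(f <- F) p * h f x) \in S].

(** P is generated by P_v, whose coordinates are integral with sum divisible by p, and
    by glue = p^-1 (1, ..., 1); this puts P into the exceptional lattice. As the
    latter is integral it is contained in the dual of P, which is P. *)
Lemma glue_lattice : e = [::] -> size G = (2 * pi)%N ->
  forall x, P x <-> congr_coord G x.
Proof.
move=> e0 sG.
have FE : e ++ G = G by rewrite e0.
have congrP x : P x -> congr_coord G x.
  move=> /neighbor_decomp[x0 [c [Px0 vx0 cS ->]]].
  have N0 : neighbor x0 by exists x0, 0; rewrite scale0r addr0 rpred0; split.
  pose r := x0 + y *r c.
  have rG f : f \in G -> h f r \in S.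
    move=> fG; have fF : f \in e ++ G by rewrite FE.
    rewrite (hDr hsp) (hZr hsp) rpredD ?rpredM ?glue_defect_int //.
    by apply: (sd_in neighbor_selfdual) => //; apply: FN.
  have -> : x0 + u *r c = r + glue *r c.
    by rewrite /r -addrA -scalerDr [y + _]addrC -uE.
  have E f : f \in G -> p * h f (r + glue *r c) = p * h f r + c.
    by move=> fG; rewrite (hDr hsp) (hZr hsp) glue_coord // mulrDr mulVKr.
  split=> [f fG|f g fG gG|].
  - by rewrite E // rpredD // rpredM ?rG //; exact: (prime_in ordS).
  - rewrite !E // opprD addrACA subrr addr0 -mulrBr mulKr //.
    by rewrite rpredB ?rG.
  rewrite big_seq (eq_bigr (fun f => p * h f r + c)) => [|f]; last exact: E.
  rewrite -big_seq big_split /= mulrDr rpredD //.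
    rewrite -mulr_sumr mulrA (pVpi ordS) -h_glue.
    rewrite (hDr hsp) (hZr hsp) rpredD ?rpredM ?h_glue_defect //.
    by apply: (sd_in sdP) => //; exact: glue_mem.
  rewrite big_const_seq count_predT iter_addr_0 sG mulnC mulrnA.
  by rewrite -[c *+ pi]mulr_natl mulrnAr mulKr // rpredMn.
move=> x; split=> [|[x1 x2 x3]]; first exact: congrP.
apply/sdP => z /congrP[z1 z2 z3]; rewrite (frame_h hsp oF sF) FE.
exact: (congr_integral ordS).
Qed.

End Glue.
End Neighbor.
End SelfDual.

(** * Orthonormal bases and the exceptional lattice *)

Lemma choice_on_seq (T : eqType) (U : Type) (u0 : U) (R : T -> U -> Prop) (s : seq T) :
  (forall x, x \in s -> exists y, R x y) ->
  exists f : T -> U, forall x, x \in s -> R x (f x).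
Proof.
elim: s => [|a s IH] Rs; first by exists (fun=> u0).
have [x xs|f fP] := IH; first by apply: Rs; rewrite inE xs orbT.
have [y Ray] := Rs a (mem_head a s).
exists (fun x => if x == a then y else f x) => x.
by rewrite inE; case: eqP => [-> _|_ /= xs] //; apply: fP.
Qed.

Section Classification.
Variables (V : lmodType quat^c) (h : V -> V -> quat) (n : nat).
Hypothesis hsp : herm_space h n.
Variables (S : subringClosed quat) (p : quat) (pi : nat) (beta : rat).
Hypothesis eucS : euclidean_order S p pi beta.
Let ordS := order_prime eucS.
Let pU := prime_unit ordS.
Let cjS x : x \in S -> conjq x \in S := cj_in ordS (x := x).
Local Notation nrm := (nrm h).
Local Notation orthonormal := (orthonormal h).
Local Notation perp := (perp h).
Local Notation selfdual_in := (selfdual_in h S).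

(** One neighbour step: if the neighbour of P at v has an orthonormal basis
    extending e, then P either has a further vector of norm 1 or is the
    exceptional lattice. *)
Lemma neighbor_frame P e v : (n <= 2 * pi)%N ->
  selfdual_in P -> orthonormal e -> {in e, forall x, P x} ->
  P v -> perp e v -> nrm v = pi%:R ->
  (forall P' e', selfdual_in P' -> orthonormal e' -> {in e', forall x, P' x} ->
     size e' = (size e).+1 -> exists f, [/\ size (e' ++ f) = n,
       orthonormal (e' ++ f) & {in f, forall x, P' x}]) ->
  (exists x, [/\ P x, perp e x & nrm x = 1]) \/
  [/\ e = [::], n = (2 * pi)%N & exists F, [/\ size F = n, orthonormal F
     & forall x, P x <-> congr_coord h S p pi F x]].
Proof.
move=> n_le sdP oe eP Pv ev nv IH.
have sN x : h x x = qrat (nrm x) := hnrm hsp x.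
have piU : (pi%:R : quat) \is a GRing.unit := natr_unit ordS (ltnW (pi_gt1 ordS)).
pose w := v *r p^-1.
have ew : perp e w by move=> x xe; rewrite (hZr hsp) ev // mul0r.
(* If <v|P> is contained in pS then v p^-1 is dual to P, hence a vector of norm 1 of P. *)
have [all_pS|] := classic (forall y, P y -> p^-1 * h v y \in S).
  left; exists w; split=> //.
    apply/sdP => y Py; rewrite (neighbor_w_in hsp eucS); exact: all_pS.
  by apply: qrat_inj; rewrite -sN (neighbor_ww hsp eucS).
move=> nall; have [y0 nall0] := not_all_ex_not _ _ nall.
have [Py0 vy0] := imply_to_and _ _ nall0.
have [vS|[d [dS d1 vd]]] := units_mod_pi eucS (sd_in sdP Pv Py0); first by case: vy0.
pose u := y0 *r conjq d.
have Pu : P u by apply: (sdZ hsp eucS sdP) => //; exact: cjS.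
have uv : pi%:R^-1 * (h v u - 1) \in S.
  have -> : h v u - 1 = (h v y0 - d) * conjq d.
    by rewrite (hZr hsp) mulrBl mul_conjq d1.
  by rewrite mulrA rpredM ?cjS.
pose P' := neighbor h S p P v.
have sdP' : selfdual_in P' by exact: (neighbor_selfdual hsp eucS sdP Pv Pu nv uv).
have N_w : P' w.
  exists 0, 1; rewrite scale1r add0r rpred1 (h0r hsp) mulr0 rpred0; split=> //.
  exact: (submod0 (sd_sub hsp eucS sdP)).
have N_P x : P x -> p^-1 * h v x \in S -> P' x.
  by move=> Px vx; exists x, 0; rewrite scale0r addr0 rpred0; split.
have N_e x : x \in e -> P' x.
  by move=> xe; apply: N_P; [exact: eP|rewrite (hsym0 hsp (ev x xe)) mulr0 rpred0].
have N_up : P' (u *r p).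
  apply: N_P; last exact: (neighbor_up hsp eucS).
  by apply: (sdZ hsp eucS sdP) => //; exact: (prime_in ordS).
have w1 : h w w = 1 by exact: (neighbor_ww hsp eucS).
have [f [sf of_ fN]] : exists f, [/\ size (e ++ w :: f) = n,
    orthonormal (e ++ w :: f) & {in w :: f, forall x, P' x}].
  have [||||f [sf of_ fN]] := IH P' (rcons e w) => //.
  - exact: (orthonormal_rcons hsp).
  - by move=> x; rewrite mem_rcons inE => /predU1P[->|/N_e].
  - by rewrite size_rcons.
  exists f; rewrite -cat_rcons; split=> // x.
  by rewrite inE => /predU1P[->|/fN].
have up_int x : P' x -> h x (u *r p) \in S by move=> Nx; exact: (sd_in sdP').
(* A basis vector whose coordinate of u p is divisible by p is dual to P = P_v + uS. *)
have [/hasP[x xf xp]|/hasPn nof] := boolP (has (fun x => p^-1 * h x (u *r p) \in S) (w :: f)).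
  left; exists x; split; last first.
  - apply: qrat_inj; rewrite -sN (proj2 of_) ?eqxx //; by rewrite mem_cat xf orbT.
  - exact: (orthonormal_cat_perp of_).
  apply/sdP => z /(neighbor_decomp hsp eucS sdP Pv Pu uv)[z0 [c [Pz0 vz0 cS ->]]].
  rewrite (hDr hsp) (hZr hsp) rpredD //.
    by apply: (sd_in sdP'); [exact: fN|exact: N_P].
  rewrite rpredM // -[h x u](mulrK pU) -(hZr hsp).
  by rewrite (prime_dvdC ordS).
have [x xf|dl dlP] := @choice_on_seq V quat 0 (fun x e => [/\ e \in S, normq e = 1 &
    pi%:R^-1 * (h x (u *r p) - e) \in S]) (w :: f).
  have := units_mod_pi eucS (up_int x (fN x xf)).
  by case=> [xp|//]; have := nof x xf; rewrite xp.
pose G := [seq x *r dl x | x <- w :: f].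
have oG : orthonormal (e ++ G).
  by apply: (orthonormal_rescale hsp) => // x /dlP[].
have sG : size (e ++ G) = n by rewrite -sf !size_cat size_map.
have GN : {in e ++ G, forall x, P' x}.
  move=> x; rewrite mem_cat => /orP[/N_e//|/mapP[z zf ->]].
  by have [dS' _ _] := dlP z zf; apply: (sdZ hsp eucS sdP') => //; apply: fN.
have Gup : {in G, forall x, pi%:R^-1 * (h x (u *r p) - 1) \in S}.
  move=> x /mapP[z zf ->]; have [zS z1 hz] := dlP z zf.
  have -> : h (z *r dl z) (u *r p) - 1 = conjq (dl z) * (h z (u *r p) - dl z).
    by rewrite (hZl hsp z) mulrBr conjq_mul z1.
  by rewrite mulrA natrV_comm -mulrA rpredM ?cjS.
have g_in := glue_mem hsp eucS sdP Pv Pu nv uv oG sG eP GN Gup.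
have g_dvd := glue_dvd hsp eucS sdP Pu oG sG eP Gup.
have g_nrm := glue_nrm hsp eucS oG.
have pi0 : (0 < pi)%N := ltnW (pi_gt1 ordS).
have sG_le : (size G <= 2 * pi)%N by apply: leq_trans n_le; rewrite -sG size_cat leq_addl.
(* The size of G is a multiple of pi between 1 and 2 pi. *)
have /dvdnP[[|[|[|k]]] sGE] := g_dvd.
- by move: sGE; rewrite mul0n size_map.
- left; exists (glue p G); split=> //; first exact: (glue_perp hsp).
  by rewrite g_nrm sGE mul1n divff // pnatr_eq0 -lt0n.
- right; have nE : n = (2 * pi)%N.
    by apply/eqP; rewrite eqn_leq n_le -sGE -sG size_cat leq_addl.
  have e0 : e = [::] by apply/nilP; move: sG; rewrite size_cat sGE nE -[RHS]add0n => /addIn/eqP.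
  split=> //; exists G; split.
  + by rewrite sGE.
  + by move: oG; rewrite e0.
  exact: (glue_lattice hsp eucS sdP Pv Pu nv uv oG sG eP GN Gup).
by move: sG_le; rewrite sGE leq_pmul2r.
Qed.

Hypothesis short : forall P e, selfdual_in P -> orthonormal e -> {in e, forall x, P x} ->
  (size e < n)%N -> exists v, [/\ P v, perp e v & nrm v = 1 \/ nrm v = pi%:R].

(** Induction on the number d of missing basis vectors. The exceptional case needs
    2 pi missing vectors and so does not occur for the neighbour, which has one
    more vector of norm 1. *)
Theorem frame_or_congr : (n <= 2 * pi)%N -> forall d P e, selfdual_in P ->
  orthonormal e -> {in e, forall x, P x} -> (size e + d)%N = n ->
  (exists f, [/\ size f = d, orthonormal (e ++ f) & {in f, forall x, P x}]) \/
  [/\ e = [::], n = (2 * pi)%N & exists F, [/\ size F = n, orthonormal F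
     & forall x, P x <-> congr_coord h S p pi F x]].
Proof.
move=> n_le; elim=> [|d IH] P e sdP oe eP sE.
  by left; exists [::]; rewrite cats0.
have IHframe P' e' : selfdual_in P' -> orthonormal e' -> {in e', forall x, P' x} ->
    size e' = (size e).+1 ->
    exists f, [/\ size f = d, orthonormal (e' ++ f) & {in f, forall x, P' x}].
  move=> sdP' oe' eP' se'; have [||[e'0]] := IH P' e' sdP' oe' eP' => //.
    by rewrite se' addSnnS.
  by rewrite e'0 in se'.
have [v [Pv ev nv]] : exists v, [/\ P v, perp e v & nrm v = 1 \/ nrm v = pi%:R].
  by apply: short => //; rewrite -sE -addSnnS leq_addr.
have norm1 x : P x -> perp e x -> nrm x = 1 ->
    exists f, [/\ size f = d.+1, orthonormal (e ++ f) & {in f, forall x, P x}].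
  move=> Px ex nx; have [||||f [sf of_ fP]] := IHframe P (rcons e x) => //.
  - by apply: (orthonormal_rcons hsp) => //; rewrite (hnrm hsp) nx.
  - by move=> y; rewrite mem_rcons inE => /predU1P[->|/eP].
  - by rewrite size_rcons.
  exists (x :: f); rewrite -cat_rcons; split=> //; first by rewrite /= sf.
  by move=> y; rewrite inE => /predU1P[->|/fP].
case: nv => nv; first by left; apply: norm1 ev nv.
have [|[x [Px ex nx]]|] := neighbor_frame n_le sdP oe eP Pv ev nv.
- move=> P' e' sdP' oe' eP' se'; have [f [sf of_ fP]] := IHframe P' e' sdP' oe' eP' se'.
  by exists f; split=> //; rewrite size_cat se' sf addSnnS.
- by left; apply: norm1 nx.
by right.
Qed.
End Classification.

(** * Short vectors *)

Section Short.
Variables (V : lmodType quat^c) (h : V -> V -> quat) (n : nat).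
Hypothesis hsp : herm_space h n.
Variables (S : subringClosed quat) (p : quat) (pi : nat) (beta : rat).
Hypothesis eucS : euclidean_order S p pi beta.
Let ordS := order_prime eucS.
Let cjS x : x \in S -> conjq x \in S := cj_in ordS (x := x).
Local Notation nrm := (nrm h).
Local Notation orthonormal := (orthonormal h).
Local Notation perp := (perp h).
Local Notation selfdual_in := (selfdual_in h S).

(** If m is the minimum, m^2 <= 2^3 = 8. *)
Lemma short_half P e : beta = 1 / 2 -> (n <= 4)%N ->
  selfdual_in P -> orthonormal e -> {in e, forall x, P x} ->
  (size e < n)%N -> exists v, [/\ P v, perp e v & nrm v = 1 \/ nrm v = 2%:R].
Proof.
move=> bE n4 sdP oe eP en.
have em : (size e < n <= size e + 4)%N by rewrite en (leq_trans n4) ?leq_addl.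
have [v [Pv ev v0 bv _]] := sd_hermite hsp eucS sdP oe eP em.
exists v; split=> //; have [k kE] := sd_nrm hsp eucS sdP Pv.
have := h_pos hsp v0; move: bv; rewrite kE bE.
case: k {kE} => [|[|[|k]]]; [by rewrite ltxx|by left|by right|].
rewrite -[k.+3]addn3 natrD; have : 0 <= k%:R :> rat by rewrite ler0n.
move: (k%:R : rat) => x; rewrite -[3%:R]/(3 : rat); nra.
Qed.

Hypotheses (beta23 : beta = 2 / 3) (n6 : (n <= 6)%N).
Hypothesis units_mod2 : forall x, x \in S -> 2%:R^-1 * x \in S \/
  exists e, [/\ e \in S, normq e = 1 & 2%:R^-1 * (x - e) \in S].
Variable om : quat.
Hypotheses (omS : om \in S) (om1 : normq om = 1) (om0 : qcoord 0 om = - (1 / 2)).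

Section NoShort.
Variables (P : V -> Prop) (e : seq V).
Hypotheses (sdP : selfdual_in P) (oe : orthonormal e) (eP : {in e, forall x, P x}).
Hypothesis en : (size e < n)%N.
Let T x := P x /\ perp e x.
Hypothesis no1 : forall x, T x -> nrm x <> 1.
Hypothesis no3 : forall x, T x -> nrm x <> 3.

Lemma subT : submodule S T.
Proof.
split; first by split; [exact: (submod0 (sd_sub hsp eucS sdP))|move=> y _; rewrite (h0r hsp)].
  move=> x y [Px ex] [Py ey]; split; first exact: (sdB hsp eucS sdP).
  by move=> z ze; rewrite (hBr hsp) ex // ey // subr0.
move=> x a [Px ex] aS; split; first exact: (sdZ hsp eucS sdP).
by move=> z ze; rewrite (hZr hsp) ex // mul0r.
Qed.

Lemma addT x y : T x -> T y -> T (x + y).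
Proof.
move=> Tx Ty; rewrite -[y]opprK -[- y]sub0r.
by do !apply: (submodB subT) => //; exact: (submod0 subT).
Qed.

Lemma intT x y : T x -> T y -> h x y \in S.
Proof. by case=> Px _ [Py _]; exact: (sd_in sdP). Qed.

Lemma dual_T f : perp e f -> (forall x, T x -> h f x \in S) -> T f.
Proof.
by move=> ef hf; split=> //; apply: (perp_mem hsp eucS sdP oe eP ef) => y Py ey; apply: hf.
Qed.

Lemma nrm_T x : T x -> x != 0 -> exists k : nat, [/\ nrm x = k%:R, (1 < k)%N & k != 3].
Proof.
move=> Tx x0; have [k kE] := sd_nrm hsp eucS sdP (proj1 Tx); exists k.
have := h_pos hsp x0; have := no1 Tx; have := no3 Tx.
by rewrite kE; case: k {kE} => [|[|[|[|k]]]]; rewrite ?ltxx.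
Qed.

Lemma nrm_half f : nrm f = 1 / 2 -> ~ T f.
Proof.
move=> fn Tf; have f0 : f != 0 by apply/negP => /eqP e0; move: fn; rewrite e0 (nrm0 hsp).
have [k [kE k1 _]] := nrm_T Tf f0; move: k1; rewrite -(ltr_nat rat) -kE fn.
by [].
Qed.

(** Modulo 2 every element of S is 0 or a unit, so adding multiples of a vector v of
    norm 2 normalises the product with v without changing the projection. *)
Lemma proj_T v x : T v -> nrm v = 2 -> T x ->
  exists x' (a : quat), [/\ T x', proj h v x' = proj h v x, h v x' = a
    & a = 0 \/ a \in S /\ normq a = 1].
Proof.
move=> Tv nv Tx.
have v0 : v != 0 by rewrite -(nrm_eq0 hsp) nv.
have u2 : (2%:R : quat) \is a GRing.unit by exact: (natr_unit ordS).
have hv (s : quat) : h v (x - v *r s) = h v x - 2%:R * s.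
  by rewrite (hBr hsp) (hZr hsp) (hnrm hsp) nv -(qrat_nat 2).
have pv (s : quat) : proj h v (x - v *r s) = proj h v x.
  by rewrite (projB hsp) (projZ hsp) (proj_b hsp) // scaler0 subr0.
have T' (s : quat) : s \in S -> T (x - v *r s).
  by move=> sS; apply: (submodB subT) => //; apply: (submodZ subT).
have [sS|[d [dS d1 sS]]] := units_mod2 (intT Tv Tx).
  exists (x - v *r (2%:R^-1 * h v x)), 0; split; [exact: T'|exact: pv| |by left].
  by rewrite hv mulVKr // subrr.
exists (x - v *r (2%:R^-1 * (h v x - d))), d; split; [exact: T'|exact: pv| |by right].
by rewrite hv mulVKr // opprB addrC subrK.
Qed.

(** Take the representative x' of [proj_T]. If x' is orthogonal to v it is its own
    projection, of norm at least 2. Otherwise <v|x'> is a unit, and the norm of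
    the projection is |x'|^2 - 1/2. Here |x'|^2 = 2 is impossible, as
    v + x' a has norm 2 + 2 - 1 = 3 for a suitable unit a (om has real part
    -1/2); so |x'|^2 is at least 4. *)
Lemma nrm_proj_ge2 v x : T v -> nrm v = 2 -> T x -> proj h v x != 0 ->
  2 <= nrm (proj h v x).
Proof.
move=> Tv nv Tx; have [x' [a [Tx' <- hx' ha]]] := proj_T Tv nv Tx => px.
have v0 : v != 0 by rewrite -(nrm_eq0 hsp) nv.
have x'0 : x' != 0.
  by apply: contraNneq px => ->; have := projB hsp v 0 0; rewrite !subrr => ->.
have [k [kE k1 k3]] := nrm_T Tx' x'0.
have := nrm_proj hsp x' v0; rewrite hx' normqM normq_rat nv kE => E.
case: ha E => [->|[aS na]]; first by rewrite normq0 mulr0 mul0r addr0 => <-; rewrite ler_nat.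
rewrite na => E; have [k4|] := leqP 4 k.
  have : (4 : rat) <= k%:R by rewrite (ler_nat _ 4).
  rewrite E; lra.
move=> k4; have k2 : k = 2%N by case: k k1 k3 k4 {kE E} => [|[|[|[|k]]]].
have aO : conjq a * om \in S by rewrite rpredM ?cjS.
have := no3 (addT Tv (submodZ subT Tx' aO)).
rewrite (nrmD hsp) (nrmZ hsp) (hZr hsp) hx' mulrA mul_conjq na qrat1 mul1r om0.
by rewrite normqM normqC na om1 nv kE k2; case; lra.
Qed.

(** Otherwise v / 2 would be dual to T, hence a vector of norm 1/2 in T. *)
Lemma proj_coef_unit v : T v -> nrm v = 2 -> exists2 u, T u & h v u = 1.
Proof.
move=> Tv nv.
have u2 : (2%:R : quat) \is a GRing.unit by exact: (natr_unit ordS).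
have [all2|] := classic (forall x, T x -> 2%:R^-1 * h v x \in S).
  case: (@nrm_half (v *r qrat 2%:R^-1)).
    by rewrite (nrmZ hsp) nv normq_rat.
  apply: dual_T => [y ye|x Tx]; first by rewrite (hZr hsp) (proj2 Tv) ?mul0r.
  by rewrite (hZl hsp) conjq_rat qrat_natV all2.
move=> nall; have [x nall0] := not_all_ex_not _ _ nall.
have [Tx vx] := imply_to_and _ _ nall0.
have [/vx//|[d [dS d1 sS]]] := units_mod2 (intT Tv Tx).
exists ((x - v *r (2%:R^-1 * (h v x - d))) *r conjq d).
  apply: (submodZ subT); last exact: cjS.
  by apply: (submodB subT) => //; apply: (submodZ subT).
rewrite (hZr hsp) (hBr hsp) (hZr hsp) (hnrm hsp) nv -[qrat 2]/(qrat 2%:R) qrat_nat.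
by rewrite mulVKr // opprB addrC subrK mul_conjq d1.
Qed.

(** The dual of the section of T by the orthogonal complement of w is the projection
    of T along w, to which [nrm_proj_ge2] applies. *)
Lemma dual_section_ge2 w f : T w -> nrm w = 2 -> perp (w :: e) f -> f != 0 ->
  (forall x, T x -> h w x = 0 -> h f x \in S) -> 2 <= nrm f.
Proof.
move=> Tw nw wef f0 hf.
have ef : perp e f by move=> y ye; apply: wef; rewrite inE ye orbT.
have wf : h w f = 0 by apply: wef; rewrite mem_head.
have w0 : w != 0 by rewrite -(nrm_eq0 hsp) nw.
have [u Tu wu] := proj_coef_unit Tw nw.
pose y := f + w *r - conjq (h f u).
have yu : h y u = 0.
  by rewrite (hDl hsp) (hZl hsp) wu mulr1 conjqN conjqK subrr.
have Ty : T y.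
  apply: dual_T => [z ze|x Tx].
    by rewrite (hDr hsp) (hZr hsp) ef // (proj2 Tw) // mul0r addr0.
  have aS := intT Tw Tx; pose x' := x - u *r h w x.
  have Tx' : T x' by apply: (submodB subT) => //; apply: (submodZ subT).
  have wx' : h w x' = 0 by rewrite (hBr hsp) (hZr hsp) wu mul1r subrr.
  rewrite -[x](subrK (u *r h w x)) (hDr hsp) (hZr hsp) yu mul0r addr0 -/x'.
  by rewrite (hDl hsp) (hZl hsp) wx' mulr0 addr0 hf.
have py : proj h w y = f.
  rewrite /proj (hDr hsp) (hZr hsp) wf add0r (hnrm hsp) mulrA -qratM.
  by rewrite mulVf ?mul1r ?addrK // nw.
by have := nrm_proj_ge2 Tw nw Ty; rewrite py; apply.
Qed.

(** The minimum is 2 by [sd_hermite], since (3/2)^5 < 9. Let v have norm 2. The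
    projection of T along v has minimum at least 2 and [hermite] gives a dual
    vector w, orthogonal to v, of norm at most (3/2)^4 / 2 < 3, hence 2. Apply
    [hermite] once more to the projection along v of the section orthogonal to
    w: the dual vector has norm at most (3/2)^3 / 2 < 2, against
    [dual_section_ge2]. If one of the projected lattices is zero, then v / 2
    takes the place of the dual vector. *)
Lemma no_short_false : False.
Proof.
have em : (size e < n <= size e + 6)%N by rewrite en (leq_trans n6) ?leq_addl.
have [v [Pv ev v0 bv vmin]] := sd_hermite hsp eucS sdP oe eP em.
have Tv : T v by [].
have nv : nrm v = 2.
  have [k [kE k1 _]] := nrm_T Tv v0; move: bv; rewrite kE beta23 => bk.
  suff k2 : (k <= 2)%N by have /eqP -> : k == 2%N by rewrite eqn_leq k2.
  rewrite leqNgt; apply/negP; rewrite -(ler_nat rat) => k3.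
  move: bk k3; move: (k%:R : rat) => x bk x3.
  have x9 : 9 <= x ^+ 2 by nra.
  by move: bk x9; move: (x ^+ 2) => y; lra.
have oe' := orthonormal_orthogonal hsp oe.
have ove : orthogonal h (v :: e) by apply: (orthogonal_cons hsp).
have line_or (R : V -> Prop) : submodule S R -> R v -> (forall x, R x -> T x) ->
  (forall x, R x -> h (v *r qrat (nrm v)^-1) x \in S) \/ exists2 x, R x & proj h v x != 0.
  move=> sR Rv RT; have [[x Rx px]|nR] := classic (exists2 x, R x & proj h v x != 0).
    by right; exists x.
  left; apply: (dual_of_line hsp eucS sR (ltn0Sn 0) Rv v0) => [x y Rx Ry|x Rx|x Rx].
  - by rewrite mul1r intT //; apply: RT.
  - by have [Px ex] := RT x Rx; apply: vmin.
  - by apply/eqP; apply: contraT => px; case: nR; exists x.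
have nhalf : nrm (v *r qrat (nrm v)^-1) = 1 / 2.
  by rewrite (nrmZ hsp) normq_rat nv.
have ehalf y : h y v = 0 -> h y (v *r qrat (nrm v)^-1) = 0.
  by move=> yv; rewrite (hZr hsp) yv mul0r.
have proj_perp s x : perp s v -> perp s x -> perp (v :: s) (proj h v x).
  move=> sv sx y; rewrite inE => /predU1P[->|ys]; first exact: (h_proj hsp).
  by rewrite (proj_orth hsp) ?sx // sv.
have imageP (R : V -> Prop) : submodule S R -> R v -> (forall x, R x -> T x) ->
    submodule S (fun z => exists2 x, R x & z = proj h v x) /\
    bounded_denom h S (fun z => exists2 x, R x & z = proj h v x).
  move=> sR Rv RT; apply: (bounded_denom_proj hsp eucS sR _ Rv v0).
  by exists 1%N => // x y Rx Ry; rewrite mul1r intT //; apply: RT.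
have [w [Tw nw wv]] : exists w, [/\ T w, nrm w = 2 & h v w = 0].
  have [half_in|[x Tx px]] := line_or T subT Tv (fun _ => id).
    by case: (nrm_half nhalf); apply: dual_T => // y ye; apply: ehalf; apply: ev.
  have [sI dI] := imageP T subT Tv (fun _ => id).
  have [|||b [f [[[b' Tb' ->] b0 _] [vef f0 hf bf]]]] :=
    hermite hsp eucS (m := 4) ove _ sI dI.
  - by rewrite /= addSnnS (leq_trans n6) ?leq_addl.
  - by move=> _ [y [Py ey] ->]; apply: proj_perp.
  - by exists (proj h v x) => //; exists x.
  have vf : h v f = 0 by apply: vef; rewrite mem_head.
  have Tf : T f.
    apply: dual_T => [y ye|y Ty]; first by apply: vef; rewrite inE ye orbT.
    by rewrite -(proj_orth hsp y (hsym0 hsp vf)); apply: hf; exists y.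
  exists f; split=> //; have [k [kE k1 _]] := nrm_T Tf f0.
  have := nrm_proj_ge2 Tv nv Tb' b0; move: bf; rewrite kE beta23.
  move=> bk nb; suff k2 : (k <= 2)%N by have /eqP -> : k == 2%N by rewrite eqn_leq k2.
  rewrite leqNgt; apply/negP; rewrite -(ler_nat rat) => k3.
  move: bk k3 nb; move: (k%:R : rat) (nrm _) => r t bk r3 t2.
  have rt6 : 6 <= r * t by nra.
  by move: bk rt6; move: (r * t) => z; lra.
pose R x := T x /\ h w x = 0.
have vw := hsym0 hsp wv.
have Rv : R v by [].
have RT x : R x -> T x by case.
have sR : submodule S R.
  split; first by split; [exact: (submod0 subT)|rewrite (h0r hsp)].
    move=> x y [Tx wx] [Ty wy]; split; first exact: (submodB subT).
    by rewrite (hBr hsp) wx wy subr0.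
  move=> x a [Tx wx] aS; split; first exact: (submodZ subT).
  by rewrite (hZr hsp) wx mul0r.
have w0 : w != 0 by rewrite -(nrm_eq0 hsp) nw.
have dual_ge2 f : perp (w :: e) f -> f != 0 -> (forall x, R x -> h f x \in S) -> 2 <= nrm f.
  by move=> wef f0 hf; apply: (dual_section_ge2 Tw nw wef f0) => x Tx wx; apply: hf.
have [half_in|[x Rx px]] := line_or R sR Rv RT.
  suff : 2 <= nrm (v *r qrat (nrm v)^-1) by rewrite nhalf.
  apply: dual_ge2 => //; last by rewrite -(nrm_eq0 hsp) nhalf.
  by move=> y; rewrite inE => /predU1P[->|/ev]; apply: ehalf.
have [sI dI] := imageP R sR Rv RT.
have owe : orthogonal h (w :: e) by apply: (orthogonal_cons hsp) => //; case: Tw.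
have wev : perp (w :: e) v by move=> y; rewrite inE => /predU1P[->|/ev].
have ovwe : orthogonal h (v :: w :: e) by apply: (orthogonal_cons hsp).
have [|||b [f [[[b' Rb' ->] b0 _] [vwef f0 hf bf]]]] :=
    hermite hsp eucS (m := 3) ovwe _ sI dI.
- by rewrite /= !addSnnS (leq_trans n6) ?leq_addl.
- move=> _ [y [[Py ey] wy] ->]; apply: proj_perp => // z.
  by rewrite inE => /predU1P[->|/ey].
- by exists (proj h v x) => //; exists x.
have vf : h v f = 0 by apply: vwef; rewrite mem_head.
have := nrm_proj_ge2 Tv nv (RT _ Rb') b0.
have : 2 <= nrm f.
  apply: dual_ge2 => // [y ye|y Ry]; first by apply: vwef; rewrite inE ye orbT.
  by rewrite -(proj_orth hsp y (hsym0 hsp vf)); apply: hf; exists y.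
move: bf; rewrite beta23; move: (nrm f) (nrm (proj h v b')) => r t bf r2 t2.
have rt4 : 4 <= r * t by nra.
by move: bf rt4; move: (r * t) => z; lra.
Qed.

End NoShort.

Lemma short_two_thirds P e : selfdual_in P -> orthonormal e -> {in e, forall x, P x} ->
  (size e < n)%N -> exists v, [/\ P v, perp e v & nrm v = 1 \/ nrm v = 3%:R].
Proof.
move=> sdP oe eP en; apply: NNPP => nov; apply: (no_short_false sdP oe eP en).
  by move=> x [Px ex] nx; case: nov; exists x; split=> //; left.
by move=> x [Px ex] nx; case: nov; exists x; split=> //; right.
Qed.

End Short.

(** * The Hurwitz order *)

Lemma quatV (x : quat) : x^-1 = qrat (normq x)^-1 * conjq x.
Proof.
have [->|x0] := eqVneq x 0; first by rewrite invr0 conjq0 mulr0.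
by apply: (mulIr (x := x) x0); rewrite mulVr // -mulrA conjq_mul qratVl // normq_eq0.
Qed.

Lemma qcoord0mk a b c d : qcoord 0 (mkq a b c d) = a. Proof. by rewrite mkqK. Qed.
Lemma qcoord1mk a b c d : qcoord 1 (mkq a b c d) = b. Proof. by rewrite mkqK. Qed.
Lemma qcoord2mk a b c d : qcoord 2 (mkq a b c d) = c. Proof. by rewrite mkqK. Qed.
Lemma qcoord3mk a b c d : qcoord 3 (mkq a b c d) = d. Proof. by rewrite mkqK. Qed.
Definition mkE := (qcoord0mk, qcoord1mk, qcoord2mk, qcoord3mk).

Definition castE := (rmorphD, rmorphB, rmorphN, rmorphM, rmorph1, rmorph_nat).

Lemma parity (a : int) : exists q : int, a = 2 * q \/ a = 2 * q + 1.
Proof.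
exists (a %/ 2)%Z; have := divz_eq a 2; have := modz_ge0 a (isT : 2 != 0 :> int).
have := ltz_pmod a (isT : 0 < 2 :> int).
by move: (a %/ 2)%Z (a %% 2)%Z => q [[|[|k]]|k] // _ _ ->; rewrite mulrC ?addr0; [left|right].
Qed.

Lemma residue3 (a : int) : exists q : int, [\/ a = 3 * q, a = 3 * q + 1 | a = 3 * q + 2].
Proof.
exists (a %/ 3)%Z; have := divz_eq a 3; have := modz_ge0 a (isT : 3 != 0 :> int).
have := ltz_pmod a (isT : 0 < 3 :> int).
by move: (a %/ 3)%Z (a %% 3)%Z => q [[|[|[|k]]]|k] // _ _ ->; rewrite mulrC ?addr0;
  [constructor 1|constructor 2|constructor 3].
Qed.

Lemma round (r : rat) : exists z : int, - (1 / 2) <= r - z%:~R <= 1 / 2.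
Proof.
exists (Num.floor (r + 1 / 2)); have := floor_le (r + 1 / 2).
have := floorD1_gt (r + 1 / 2); rewrite intrD; move: (_%:~R) => z; lra.
Qed.

Section Builder.
Variables (S : subringClosed quat) (p : quat) (pi : nat).

(** For an order of quaternions most of [order_with_prime] follows from the formulas
    for the norm. *)
Lemma quat_order :
  (forall x, x \in S -> conjq x \in S) ->
  (forall r : rat, qrat r \in S -> r \is a Num.int) ->
  p \in S -> normq p = pi%:R -> (1 < pi)%N ->
  (forall x, x \in S -> p^-1 * x * p \in S) ->
  (forall x, x \in S -> p * x * p^-1 \in S) ->
  p^-1 * conjq p \in S ->
  order_with_prime conjq S p pi.
Proof.
move=> cS ratS pS np pi1 cl cr pp.
have p0 : p != 0 by rewrite -normq_eq0 np pnatr_eq0 -lt0n ltnW.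
split=> //.
- exact: conjqB.
- exact: conjqM.
- exact: conjqK.
- move=> x xS; have nS : qrat (normq x) \in S by rewrite -conjq_mul rpredM ?cS.
  have /intrP[z zE] := ratS _ nS.
  have := normq_ge0 x; rewrite zE ler0z; case: z zE => // k kE _.
  exists k; rewrite conjq_mul kE -qrat_nat; split=> // k0.
  by apply/eqP; rewrite -normq_eq0 kE k0.
- move=> k k0; rewrite quat_unit -qrat_nat; apply/eqP => /(congr1 (qcoord 0)).
  by rewrite !qE => /eqP; rewrite pnatr_eq0; case: k k0.
- move=> k m m0; rewrite -!qrat_nat -qratV -qratM => /ratS/intrP[z zE].
  have mU : (m%:R : rat) != 0 by rewrite pnatr_eq0 -lt0n.
  have {zE} : (k%:Z)%:~R = (z * m%:Z)%:~R :> rat.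
    by rewrite intrM -zE -mulrA mulVf ?mulr1.
  move/eqP; rewrite eqr_int => /eqP kE.
  by apply/dvdnP; exists `|z|%N; rewrite -[LHS]/(`|k%:Z|%N) kE abszM.
- by rewrite conjq_mul np qrat_nat.
- by rewrite mul_conjq np qrat_nat.
Qed.
End Builder.

Ltac qcoords := apply/quatP; rewrite ?(qE, mkE); split.

Lemma hurP x : x \in hurwitz <-> exists a b c d : int,
  x = mkq (a%:~R / 2) (a%:~R / 2 + b%:~R) (a%:~R / 2 + c%:~R) (a%:~R / 2 + d%:~R).
Proof. exact: hurwitz_coordP. Qed.

Lemma qcoord1_1 : [/\ qcoord 0 1 = 1, qcoord 1 1 = 0, qcoord 2 1 = 0 & qcoord 3 1 = 0].
Proof. by rewrite -qrat1 !qE. Qed.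
Lemma qcoord01 : qcoord 0 1 = 1. Proof. by case: qcoord1_1. Qed.
Lemma qcoord11 : qcoord 1 1 = 0. Proof. by case: qcoord1_1. Qed.
Lemma qcoord21 : qcoord 2 1 = 0. Proof. by case: qcoord1_1. Qed.
Lemma qcoord31 : qcoord 3 1 = 0. Proof. by case: qcoord1_1. Qed.
Definition q1E := (qcoord01, qcoord11, qcoord21, qcoord31).

Lemma normq_1i : normq (1 + qi) = 2%:R.
Proof. by rewrite /normq !(qE, mkE, q1E). Qed.
Lemma conjq_1i : conjq (1 + qi) = 1 - qi.
Proof. by qcoords; rewrite ?(q1E, mkE); ring. Qed.

Lemma pVcoords_1i : (1 + qi)^-1 = mkq (1/2) (- (1/2)) 0 0.
Proof. by rewrite quatV normq_1i conjq_1i; qcoords; rewrite ?(q1E, mkE); field. Qed.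

Lemma hurwitz_order : order_with_prime conjq Hur (1 + qi) 2.
Proof.
apply: quat_order.
- move=> _ /hurP[a [b [c [d ->]]]]; apply/hurP.
  exists a, (- a - b), (- a - c), (- a - d).
  by rewrite !castE /=; qcoords; field.
- move=> r /hurP[a [b [c [d /quatP]]]]; rewrite !(qE, mkE) => -[-> e _ _].
  have -> : (a%:~R / 2 : rat) = (- b)%:~R by rewrite !castE /=; lra.
  exact: intr_int.
- by apply/hurP; exists 2, 0, (-1), (-1); qcoords; rewrite ?(q1E, mkE).
- exact: normq_1i.
- by [].
- move=> _ /hurP[a [b [c [d ->]]]]; apply/hurP; rewrite pVcoords_1i.
  by exists a, b, d, (- a - c); rewrite !castE /=; qcoords; rewrite ?(q1E, mkE); field.
- move=> _ /hurP[a [b [c [d ->]]]]; apply/hurP; rewrite pVcoords_1i.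
  by exists a, b, (- a - d), c; rewrite !castE /=; qcoords; rewrite ?(q1E, mkE); field.
apply/hurP; exists 0, (-1), 0, 0; rewrite pVcoords_1i.
by rewrite !castE /=; qcoords; rewrite ?(qE, q1E, mkE); field.
Qed.

Lemma normq_coords x : normq x = qcoord 0 x ^+ 2 + qcoord 1 x ^+ 2
  + qcoord 2 x ^+ 2 + qcoord 3 x ^+ 2.
Proof. by []. Qed.

(** The deviations from the nearest integer and from the nearest half-integer in Z +
    1/2 add up to 1/2, so their squares add up to at most 1/4. *)
Lemma half_shift (r : rat) : - (1 / 2) <= r <= 1 / 2 ->
  exists s : int, r ^+ 2 + (r - (1 / 2 + s%:~R)) ^+ 2 <= 1 / 4.
Proof.
move=> /andP[r1 r2]; have [r0|r0] := leP 0 r; [exists 0|exists (-1)].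
  by rewrite addr0; nra.
by rewrite rmorphN1; nra.
Qed.

(** Approximate by the nearest integral quaternion and by the nearest one with all
    coordinates in Z + 1/2. By [half_shift] the squared errors add up to at most
    1, so one of them is at most 1/2. *)
Lemma hurwitz_covering (t : quat) : exists2 a, a \in hurwitz & normq (t - a) <= 1 - 1 / 2.
Proof.
have [z0 h0] := round (qcoord 0 t); have [z1 h1] := round (qcoord 1 t).
have [z2 h2] := round (qcoord 2 t); have [z3 h3] := round (qcoord 3 t).
have [s0] := half_shift h0; have [s1] := half_shift h1.
have [s2] := half_shift h2; have [s3] := half_shift h3.
set r0 := qcoord 0 t - _; set r1 := qcoord 1 t - _.
set r2 := qcoord 2 t - _; set r3 := qcoord 3 t - _ => e3 e2 e1 e0.
have [le|gt] := leP (r0 ^+ 2 + r1 ^+ 2 + r2 ^+ 2 + r3 ^+ 2) (1 - 1 / 2).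
  exists (mkq z0%:~R z1%:~R z2%:~R z3%:~R).
    apply/hurP; exists (2 * z0), (z1 - z0), (z2 - z0), (z3 - z0).
    by rewrite !castE /=; qcoords; field.
  by rewrite normq_coords !(qE, mkE).
exists (mkq (z0%:~R + 1/2 + s0%:~R) (z1%:~R + 1/2 + s1%:~R)
            (z2%:~R + 1/2 + s2%:~R) (z3%:~R + 1/2 + s3%:~R)).
  apply/hurP; exists (2 * z0 + 1 + 2 * s0), (z1 + s1 - z0 - s0),
    (z2 + s2 - z0 - s0), (z3 + s3 - z0 - s0).
  by rewrite !castE /=; qcoords; field.
rewrite normq_coords !(qE, mkE).
have shift (a z s : rat) : a - (z + 1 / 2 + s) = a - z - (1 / 2 + s) by ring.
rewrite (shift (qcoord 0 t)) (shift (qcoord 1 t)) (shift (qcoord 2 t)) (shift (qcoord 3 t)).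
rewrite -/r0 -/r1 -/r2 -/r3.
move: e0 e1 e2 e3 gt; clearbody r0 r1 r2 r3.
move: (r0 ^+ 2) (r1 ^+ 2) (r2 ^+ 2) (r3 ^+ 2) (_ ^+ 2) (_ ^+ 2) (_ ^+ 2) (_ ^+ 2).
by clear; intros; lra.
Qed.

Lemma normq_mk a b c d : normq (mkq a b c d) = a ^+ 2 + b ^+ 2 + c ^+ 2 + d ^+ 2.
Proof. by rewrite normq_coords !mkE. Qed.

(** A number in Z + 1/2 is congruent to 1/2 or to -1/2 modulo 2. *)
Lemma half_unit (r : rat) (b : int) : r = b%:~R + 1 / 2 -> exists e q : int,
  [/\ (1 / 2 + e%:~R) ^+ 2 = 1 / 4 :> rat & r = 1 / 2 + e%:~R + 2 * q%:~R].
Proof.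
move=> ->; have [q [->|->]] := parity b; [exists 0, q|exists (-1), (q + 1)];
  by rewrite !castE /=; split; field.
Qed.

Lemma natV2 : (2%:R : quat)^-1 = qrat (1 / 2).
Proof. by rewrite -qrat_natV. Qed.

Definition mkqz (a b c d : int) : quat := mkq a%:~R b%:~R c%:~R d%:~R.

Lemma mkqz_hurwitz a b c d : mkqz a b c d \in hurwitz.
Proof.
by apply/hurP; exists (2 * a), (b - a), (c - a), (d - a); rewrite !castE /=; qcoords; field.
Qed.

Lemma half_diff_hurwitz n0 n1 n2 n3 d0 d1 d2 d3 (b c d : int) :
  n1 - d1 = n0 - d0 + 2 * b -> n2 - d2 = n0 - d0 + 2 * c -> n3 - d3 = n0 - d0 + 2 * d ->
  2%:R^-1 * (mkqz n0 n1 n2 n3 - mkqz d0 d1 d2 d3) \in hurwitz.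
Proof.
move=> /(canRL (subrK _)) -> /(canRL (subrK _)) -> /(canRL (subrK _)) ->.
apply/hurP; exists (n0 - d0), b, c, d.
by rewrite natV2 !castE /=; qcoords; field.
Qed.

(** An integral quaternion is divisible by 1 + i when its coordinate sum is even.
    Otherwise one or three coordinates are odd, and the exceptional one marks the
    unit 1, i, j or k to which it is congruent: two integral quaternions are
    congruent modulo 2 in the Hurwitz order as soon as the four differences of
    coordinates have the same parity. *)
Lemma hurwitz_int_units n0 n1 n2 n3 : (1 + qi)^-1 * mkqz n0 n1 n2 n3 \in hurwitz \/
  exists e, [/\ e \in hurwitz, normq e = 1 & 2%:R^-1 * (mkqz n0 n1 n2 n3 - e) \in hurwitz].
Proof.
have [m []] := parity (n0 + n1 + n2 + n3).
  move=> /(canRL (addKr _)) ->; left; apply/hurP; rewrite pVcoords_1i.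
  exists (n0 + n1), (- n0), (m - n0 - n1), (m - n2 - n0 - n1).
  by rewrite !castE /=; qcoords; field.
move=> /(canRL (addKr _)) ->; right.
have norm1 d0 d1 d2 d3 : d0 ^+ 2 + d1 ^+ 2 + d2 ^+ 2 + d3 ^+ 2 = 1 ->
    normq (mkqz d0 d1 d2 d3) = 1.
  by move=> e; rewrite normq_mk -!rmorphXn -!rmorphD /= e.
have unit d0 d1 d2 d3 b c d N0 N1 N2 N3 : d0 ^+ 2 + d1 ^+ 2 + d2 ^+ 2 + d3 ^+ 2 = 1 ->
   N1 - d1 = N0 - d0 + 2 * b -> N2 - d2 = N0 - d0 + 2 * c -> N3 - d3 = N0 - d0 + 2 * d ->
   exists e, [/\ e \in hurwitz, normq e = 1 & 2%:R^-1 * (mkqz N0 N1 N2 N3 - e) \in hurwitz].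
  move=> e eb ec ed; exists (mkqz d0 d1 d2 d3); split; first exact: mkqz_hurwitz.
    exact: norm1.
  exact: half_diff_hurwitz eb ec ed.
have [q0 [] ->] := parity n0; have [q1 [] ->] := parity n1;
  have [q2 [] ->] := parity n2; pose s := m - q0 - q1 - q2 - q0.
- by apply: (unit 0 0 0 1 (q1 - q0) (q2 - q0) s); rewrite /s //; ring.
- by apply: (unit 0 0 1 0 (q1 - q0) (q2 - q0) s); rewrite /s //; ring.
- by apply: (unit 0 1 0 0 (q1 - q0) (q2 - q0) s); rewrite /s //; ring.
- by apply: (unit 1 0 0 0 (q1 - q0 + 1) (q2 - q0 + 1) s); rewrite /s //; ring.
- by apply: (unit 1 0 0 0 (q1 - q0) (q2 - q0) s); rewrite /s //; ring.
- by apply: (unit 0 1 0 0 (q1 - q0 - 1) (q2 - q0) (s - 1)); rewrite /s //; ring.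
- by apply: (unit 0 0 1 0 (q1 - q0) (q2 - q0 - 1) (s - 1)); rewrite /s //; ring.
- by apply: (unit 0 0 0 1 (q1 - q0) (q2 - q0) (s - 2)); rewrite /s //; ring.
Qed.

(** A quaternion with coordinates in Z + 1/2 is congruent to one of the units
    (+-1 +-i +-j +-k) / 2, by [half_unit] in each coordinate. *)
Lemma hurwitz_units x : x \in hurwitz -> (1 + qi)^-1 * x \in hurwitz \/
  exists e, [/\ e \in hurwitz, normq e = 1 & 2%:R^-1 * (x - e) \in hurwitz].
Proof.
move=> /hurP[a [b [c [d ->]]]]; have [a' [->|->]] := parity a.
  rewrite (_ : mkq _ _ _ _ = mkqz a' (a' + b) (a' + c) (a' + d)).
    exact: hurwitz_int_units.
  by rewrite /mkqz !castE /=; qcoords; field.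
have E (k : int) : exists e q : int, [/\ (1 / 2 + e%:~R) ^+ 2 = 1 / 4 :> rat
    & (2 * a' + 1)%:~R / 2 + k%:~R = 1 / 2 + e%:~R + 2 * q%:~R :> rat].
  by apply: (@half_unit _ (a' + k)); rewrite !castE /=; field.
have [e1 [q1 [n1 ->]]] := E b; have [e2 [q2 [n2 ->]]] := E c.
have [e3 [q3 [n3 ->]]] := E d; have [e0 [q0 [n0]]] := E 0; rewrite addr0 => ->; right.
exists (mkq (1 / 2 + e0%:~R) (1 / 2 + e1%:~R) (1 / 2 + e2%:~R) (1 / 2 + e3%:~R)); split.
- apply/hurP; exists (1 + 2 * e0), (e1 - e0), (e2 - e0), (e3 - e0).
  by rewrite !castE /=; qcoords; field.
- by rewrite normq_mk n0 n1 n2 n3.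
rewrite (_ : _ * _ = mkqz q0 q1 q2 q3) ?mkqz_hurwitz //.
by rewrite natV2 /mkqz; qcoords; field.
Qed.

Theorem hurwitz_euclidean : euclidean_order Hur (1 + qi) 2 (1 / 2).
Proof.
split=> //; first exact: hurwitz_order.
  by move=> x k _ _; apply: hurwitz_covering.
exact: hurwitz_units.
Qed.

(** * The Gaussian order in the quaternions *)

Definition gauq : pred quat := fun x =>
  [&& qcoord 0 x \is a Num.int, qcoord 1 x \is a Num.int, qcoord 2 x == 0 & qcoord 3 x == 0].

Lemma gauqP x : x \in gauq <-> exists a b : int, x = mkq a%:~R b%:~R 0 0.
Proof.
split=> [/and4P[/intrP[a e0] /intrP[b e1] /eqP e2 /eqP e3]|[a [b ->]]].
  by exists a, b; qcoords; rewrite ?(e0, e1, e2, e3).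
by rewrite unfold_in !mkE !intr_int eqxx.
Qed.

Lemma gauq_subring : subring_closed gauq.
Proof.
split=> [|_ _ /gauqP[a [b ->]] /gauqP[c [d ->]]|_ _ /gauqP[a [b ->]] /gauqP[c [d ->]]];
  apply/gauqP.
- by exists 1, 0; qcoords; rewrite ?q1E.
- by exists (a - c), (b - d); rewrite !castE /=; qcoords; ring.
- by exists (a * c - b * d), (a * d + b * c); rewrite !castE /=; qcoords; ring.
Qed.
HB.instance Definition _ := GRing.isSubringClosed.Build quat gauq gauq_subring.
Definition Gauq := GRing.SubringClosed.clone quat gauq _.

Lemma gauq_order : order_with_prime conjq Gauq (1 + qi) 2.
Proof.
apply: quat_order => //.
- move=> _ /gauqP[a [b ->]]; apply/gauqP; exists a, (- b).
  by rewrite !castE /=; qcoords; ring.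
- by move=> r /and4P[+ _ _ _]; rewrite qE.
- by apply/gauqP; exists 1, 1; qcoords; rewrite ?(q1E, mkE); ring.
- exact: normq_1i.
- move=> _ /gauqP[a [b ->]]; apply/gauqP; exists a, b.
  by rewrite pVcoords_1i; qcoords; rewrite ?(q1E, mkE); field.
- move=> _ /gauqP[a [b ->]]; apply/gauqP; exists a, b.
  by rewrite pVcoords_1i; qcoords; rewrite ?(q1E, mkE); field.
apply/gauqP; exists 0, (-1).
by rewrite pVcoords_1i !castE /=; qcoords; rewrite ?(qE, q1E, mkE); field.
Qed.

Theorem gauq_euclidean : euclidean_order Gauq (1 + qi) 2 (1 / 2).
Proof.
split=> //; first exact: gauq_order.
  move=> _ k /gauqP[a [b ->]] _; set r : rat := k%:R^-1.
  have -> : k%:R^-1 = qrat r by rewrite -qrat_natV.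
  have [z0 h0] := round (r * a%:~R); have [z1 h1] := round (r * b%:~R).
  exists (mkq z0%:~R z1%:~R 0 0); first by apply/gauqP; exists z0, z1.
  have -> : normq (qrat r * mkq a%:~R b%:~R 0 0 - mkq z0%:~R z1%:~R 0 0) =
      (r * a%:~R - z0%:~R) ^+ 2 + (r * b%:~R - z1%:~R) ^+ 2.
    by rewrite normq_coords !(qE, mkE); ring.
  move: h0 h1; move: (r * a%:~R - _) (r * b%:~R - _) => x y; clear.
  move=> /andP[x1 x2] /andP[y1 y2]; nra.
move=> _ /gauqP[a [b ->]].
have [a' ea] := parity a; have [b' eb] := parity b.
have unit (d0 d1 q0 q1 : int) : d0 ^+ 2 + d1 ^+ 2 = 1 -> a = 2 * q0 + d0 -> b = 2 * q1 + d1 ->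
    exists e, [/\ e \in Gauq, normq e = 1 & 2%:R^-1 * (mkq a%:~R b%:~R 0 0 - e) \in Gauq].
  move=> d1E -> ->; exists (mkq d0%:~R d1%:~R 0 0); split.
  - by apply/gauqP; exists d0, d1.
  - by rewrite normq_mk expr0n /= !addr0 -!rmorphXn -rmorphD /= d1E.
  by apply/gauqP; exists q0, q1; rewrite natV2 !castE /=; qcoords; field.
have even (m : int) : a + b = 2 * m -> (1 + qi)^-1 * mkq a%:~R b%:~R 0 0 \in Gauq.
  move=> /(canRL (addKr _)) ->; apply/gauqP; exists m, (m - a).
  by rewrite pVcoords_1i !castE /=; qcoords; field.
case: ea eb => [ea|ea] [eb|eb].
- by left; apply: (even (a' + b')); rewrite ea eb; ring.
- by right; apply: (unit 0 1 a' b') => //; rewrite ea addr0.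
- by right; apply: (unit 1 0 a' b') => //; rewrite eb addr0.
by left; apply: (even (a' + b' + 1)); rewrite ea eb; ring.
Qed.

(** * The Eisenstein order in the quaternions *)

(** The span of 1 and omega = (-1 + i + j + k) / 2. *)
Definition eisq : pred quat := fun x =>
  [&& qcoord 0 x + qcoord 1 x \is a Num.int, 2 * qcoord 1 x \is a Num.int,
      qcoord 2 x == qcoord 1 x & qcoord 3 x == qcoord 1 x].
(** The quaternion a + b omega. *)
Definition eismk (a b : rat) : quat := mkq (a - b / 2) (b / 2) (b / 2) (b / 2).

Lemma eisqP x : x \in eisq <-> exists a b : int, x = eismk a%:~R b%:~R.
Proof.
split=> [/and4P[/intrP[a e0] /intrP[b e1] /eqP e2 /eqP e3]|[a [b ->]]].
  have e1' : qcoord 1 x = b%:~R / 2 by rewrite -e1; field.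
  by exists a, b; rewrite /eismk -e0; qcoords; rewrite ?e2 ?e3 -?e1'; ring.
rewrite unfold_in !mkE subrK (_ : 2 * _ = b%:~R) ?intr_int ?eqxx //.
by field.
Qed.

Lemma eisq_subring : subring_closed eisq.
Proof.
split=> [|_ _ /eisqP[a [b ->]] /eisqP[c [d ->]]|_ _ /eisqP[a [b ->]] /eisqP[c [d ->]]];
  apply/eisqP.
- by exists 1, 0; rewrite /eismk; qcoords; rewrite ?q1E.
- by exists (a - c), (b - d); rewrite !castE /= /eismk; qcoords; field.
- by exists (a * c - b * d), (a * d + b * c - b * d); rewrite !castE /= /eismk; qcoords; field.
Qed.
HB.instance Definition _ := GRing.isSubringClosed.Build quat eisq eisq_subring.
Definition Eisq := GRing.SubringClosed.clone quat eisq _.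

Definition thetaq : quat := mkq 0 1 1 1.

Lemma normq_theta : normq thetaq = 3%:R.
Proof. by rewrite normq_mk. Qed.
Lemma thetaqV : thetaq^-1 = mkq 0 (- (1/3)) (- (1/3)) (- (1/3)).
Proof. by rewrite quatV normq_theta; qcoords; field. Qed.

Lemma eisq_order : order_with_prime conjq Eisq thetaq 3.
Proof.
apply: quat_order => //.
- move=> _ /eisqP[a [b ->]]; apply/eisqP; exists (a - b), (- b).
  by rewrite !castE /= /eismk; qcoords; field.
- by move=> r /and4P[+ _ _ _]; rewrite !qE addr0.
- by apply/eisqP; exists 1, 2; rewrite /eismk; qcoords; field.
- exact: normq_theta.
- move=> _ /eisqP[a [b ->]]; apply/eisqP; exists a, b.
  by rewrite thetaqV /eismk; qcoords; field.
- move=> _ /eisqP[a [b ->]]; apply/eisqP; exists a, b.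
  by rewrite thetaqV /eismk; qcoords; field.
apply/eisqP; exists (-1), 0.
by rewrite thetaqV !castE /= /eismk; qcoords; field.
Qed.

Lemma normq_eismk a b : normq (eismk a b) = a ^+ 2 - a * b + b ^+ 2.
Proof. by rewrite normq_mk; field. Qed.
Lemma eismkB a b c d : eismk a b - eismk c d = eismk (a - c) (b - d).
Proof. by rewrite /eismk; qcoords; ring. Qed.
Lemma qrat_eismk r a b : qrat r * eismk a b = eismk (r * a) (r * b).
Proof. by rewrite /eismk; qcoords; ring. Qed.

(** After reduction to 0 <= x, y < 1 the point x + y omega lies in one of the two
    equilateral triangles of side 1 with vertices 0, 1, 1 + omega and 0, omega,
    1 + omega. With barycentric coordinates u, v, w the average of the squared
    distances to the vertices is uv + uw + vw <= 1/3, so some vertex is within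
    1/3. *)
Lemma eis_covering (x y : rat) : exists a b : int,
  (x - a%:~R) ^+ 2 - (x - a%:~R) * (y - b%:~R) + (y - b%:~R) ^+ 2 <= 1 / 3.
Proof.
wlog : x y / 0 <= x < 1 /\ 0 <= y < 1 => [th|].
  have frac (z : rat) : 0 <= z - (Num.floor z)%:~R < 1.
    by have := floor_le z; have := floorD1_gt z; rewrite intrD; move: (_%:~R) => w; lra.
  have [a [b ab]] := th _ _ (conj (frac x) (frac y)).
  exists (Num.floor x + a), (Num.floor y + b).
  by move: ab; rewrite !intrD !opprD !addrA.
move=> [/andP[x0 x1] /andP[y0 y1]].
have n00 : (exists a b : int,
    (x - a%:~R) ^+ 2 - (x - a%:~R) * (y - b%:~R) + (y - b%:~R) ^+ 2 <= 1 / 3) \/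
    [/\ 1 / 3 < x ^+ 2 - x * y + y ^+ 2,
        1 / 3 < (x - 1) ^+ 2 - (x - 1) * y + y ^+ 2,
        1 / 3 < x ^+ 2 - x * (y - 1) + (y - 1) ^+ 2 &
        1 / 3 < (x - 1) ^+ 2 - (x - 1) * (y - 1) + (y - 1) ^+ 2].
  have [n|n0] := leP (x ^+ 2 - x * y + y ^+ 2) (1 / 3).
    by left; exists 0, 0; rewrite !subr0.
  have [n|n1] := leP ((x - 1) ^+ 2 - (x - 1) * y + y ^+ 2) (1 / 3).
    by left; exists 1, 0; rewrite !subr0.
  have [n|n2] := leP (x ^+ 2 - x * (y - 1) + (y - 1) ^+ 2) (1 / 3).
    by left; exists 0, 1; rewrite !subr0.
  have [n|n3] := leP ((x - 1) ^+ 2 - (x - 1) * (y - 1) + (y - 1) ^+ 2) (1 / 3).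
    by left; exists 1, 1.
  by right.
case: n00 => // -[n0 n1 n2 n3]; exfalso.
have sq (u v w : rat) : u + v + w = 1 -> u * v + u * w + v * w <= 1 / 3.
  move=> e; have -> : w = 1 - u - v by rewrite -e; ring.
  have := sqr_ge0 (2 * u + v - 1); have := sqr_ge0 (3 * v - 1); nra.
have pos (l N : rat) : 0 < l -> 1 / 3 < N -> 0 < l * (N - 1 / 3).
  by move=> l0 N0; rewrite mulr_gt0 // subr_gt0.
have nneg (l N : rat) : 0 <= l -> 1 / 3 < N -> 0 <= l * (N - 1 / 3).
  by move=> l0 N0; rewrite mulr_ge0 // subr_ge0 ltW.
have [xy|/ltW xy] := leP y x.
  have := pos (1 - x) _ _ n0; rewrite subr_gt0 => /(_ x1).
  have := nneg (x - y) _ _ n1; rewrite subr_ge0 => /(_ xy).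
  have := nneg y _ y0 n3; have := sq (1 - x) (x - y) y; clear=> a b c d.
  have {}a := a ltac:(ring); lra.
have := pos (1 - y) _ _ n0; rewrite subr_gt0 => /(_ y1).
have := nneg (y - x) _ _ n2; rewrite subr_ge0 => /(_ xy).
have := nneg x _ x0 n3; have := sq (1 - y) (y - x) x; clear=> a b c d.
have {}a := a ltac:(ring); lra.
Qed.

Theorem eisq_covering (x : quat) k : x \in Eisq -> (0 < k)%N ->
  exists2 a, a \in Eisq & normq (k%:R^-1 * x - a) <= 1 - 2 / 3.
Proof.
move=> /eisqP[a [b ->]] _; set r : rat := k%:R^-1.
have -> : k%:R^-1 = qrat r by rewrite -qrat_natV.
have [c [d cd]] := eis_covering (r * a%:~R) (r * b%:~R).
exists (eismk c%:~R d%:~R); first by apply/eisqP; exists c, d.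
by rewrite qrat_eismk eismkB normq_eismk; apply: le_trans cd _; lra.
Qed.

Lemma eisq_unit (m : nat) (a b d0 d1 q0 q1 : int) : (0 < m)%N ->
    d0 ^+ 2 - d0 * d1 + d1 ^+ 2 = 1 -> a = m%:R * q0 + d0 -> b = m%:R * q1 + d1 ->
  exists e, [/\ e \in Eisq, normq e = 1 & m%:R^-1 * (eismk a%:~R b%:~R - e) \in Eisq].
Proof.
move=> m0 d1E -> ->; exists (eismk d0%:~R d1%:~R); split.
- by apply/eisqP; exists d0, d1.
- by rewrite normq_eismk -!rmorphXn -rmorphM -rmorphB -rmorphD /= d1E.
apply/eisqP; exists q0, q1; rewrite eismkB -qrat_natV qrat_eismk !intrD !addrK !intrM.
by rewrite -[m%:R%:~R]/((m%:R : int)%:~R) rmorph_nat !mulKf // pnatr_eq0 -lt0n.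
Qed.

Lemma eisq_units2 x : x \in Eisq -> 2%:R^-1 * x \in Eisq \/
  exists e, [/\ e \in Eisq, normq e = 1 & 2%:R^-1 * (x - e) \in Eisq].
Proof.
move=> /eisqP[a [b ->]]; have [a' [->|->]] := parity a;
  have [b' [->|->]] := parity b.
- left; apply/eisqP; exists a', b'; rewrite natV2 qrat_eismk !castE /= /eismk.
  by qcoords; field.
- by right; apply: (@eisq_unit 2 _ _ 0 1 a' b') => //; rewrite addr0.
- by right; apply: (@eisq_unit 2 _ _ 1 0 a' b') => //; rewrite addr0.
by right; apply: (@eisq_unit 2 _ _ 1 1 a' b').
Qed.

(** For x = a + b omega, theta divides x when 3 divides a + b; the other six
    residues of (a, b) modulo 3 are those of the six units. *)
Lemma eisq_units3 x : x \in Eisq -> thetaq^-1 * x \in Eisq \/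
  exists e, [/\ e \in Eisq, normq e = 1 & 3%:R^-1 * (x - e) \in Eisq].
Proof.
move=> /eisqP[a [b ->]].
have theta_dvd (m : int) : a + b = 3 * m -> thetaq^-1 * eismk a%:~R b%:~R \in Eisq.
  move=> /(canRL (addKr _)) ->; apply/eisqP; exists (2 * m - a), (m - a).
  by rewrite thetaqV /eismk !castE /=; qcoords; field.
have [a' ea] := residue3 a; have [b' eb] := residue3 b.
case: ea eb => [ea|ea|ea] [eb|eb|eb].
- by left; apply: (theta_dvd (a' + b')); rewrite ea eb; ring.
- by right; apply: (@eisq_unit 3 _ _ 0 1 a' b'); rewrite ?addr0.
- by right; apply: (@eisq_unit 3 _ _ 0 (-1) a' (b' + 1)); rewrite ?ea ?eb //; ring.
- by right; apply: (@eisq_unit 3 _ _ 1 0 a' b'); rewrite ?addr0.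
- by right; apply: (@eisq_unit 3 _ _ 1 1 a' b').
- by left; apply: (theta_dvd (a' + b' + 1)); rewrite ea eb; ring.
- by right; apply: (@eisq_unit 3 _ _ (-1) 0 (a' + 1) b'); rewrite ?ea ?eb //; ring.
- by left; apply: (theta_dvd (a' + b' + 1)); rewrite ea eb; ring.
by right; apply: (@eisq_unit 3 _ _ (-1) (-1) (a' + 1) (b' + 1)); rewrite ?ea ?eb //; ring.
Qed.

Theorem eisq_euclidean : euclidean_order Eisq thetaq 3 (2 / 3).
Proof.
split; [exact: eisq_order|by []|by []|exact: eisq_covering|exact: eisq_units3].
Qed.

Definition omegaq : quat := eismk 0 1.
Lemma omegaq_facts : [/\ omegaq \in Eisq, normq omegaq = 1 & qcoord 0 omegaq = - (1 / 2)].
Proof.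
split; first by apply/eisqP; exists 0, 1.
  by rewrite normq_eismk; ring.
by rewrite mkE; ring.
Qed.

(** * Hermitian spaces with a diagonal form *)

(** Elimination of one unknown, with coefficients on the left and unknowns on the
    right, as the coefficients need not commute. *)
Lemma underdetermined m k (A : 'I_m -> 'I_k -> quat) : (m < k)%N ->
  exists2 x : 'I_k -> quat, exists j, x j != 0 & forall i, \sum_j A i j * x j = 0.
Proof.
elim: m k A => [|m IH] k A mk.
  exists (fun _ => 1); last by case.
  by exists (Ordinal mk); exact: oner_neq0.
have split_row (x : 'I_k -> quat) : \sum_j A ord0 j * x j = 0 ->
    (forall i, \sum_j A (lift ord0 i) j * x j = 0) -> forall i, \sum_j A i j * x j = 0.
  by move=> e0 e i; case: (unliftP ord0 i) => [l ->|->].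
have [j0 Aj0|A0] := pickP (fun j => A ord0 j != 0); last first.
  have [x x0 xA] := IH k (fun i => A (lift ord0 i)) (ltnW mk).
  exists x => //; apply: split_row => //; rewrite big1 // => j _.
  by have /negbFE/eqP -> := A0 j; rewrite mul0r.
case: k A mk split_row j0 Aj0 => // k A mk split_row j0 Aj0.
pose c := (A ord0 j0)^-1.
have [y [j1 y0] yA] := IH k (fun i j => A (lift ord0 i) (lift j0 j)
  - A (lift ord0 i) j0 * c * A ord0 (lift j0 j)) mk.
pose r := \sum_j A ord0 (lift j0 j) * y j.
pose x j := oapp y (- (c * r)) (unlift j0 j).
have xj0 : x j0 = - (c * r) by rewrite /x unlift_none.
have xl j : x (lift j0 j) = y j by rewrite /x liftK.
have sumE (a : 'I_k.+1 -> quat) : \sum_j a j * x j =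
    - (a j0 * c * r) + \sum_j a (lift j0 j) * y j.
  rewrite (bigD1_ord j0) //= xj0 mulrN mulrA; congr (_ + _).
  by apply: eq_bigr => j _; rewrite xl.
exists x; first by exists (lift j0 j1); rewrite xl.
apply: split_row => [|i]; rewrite sumE.
  by rewrite divrr // mul1r addNr.
rewrite -[RHS](yA i) /r mulr_sumr -sumrN -big_split /=; apply: eq_bigr => j _.
by rewrite mulrBl addrC mulrA.
Qed.

Section Diagonal.
Variables (n : nat) (q : 'I_n -> nat).
Hypothesis q_gt0 : forall i, (0 < q i)%N.

Definition diag_h (x y : 'cV[quat^c]_n) : quat :=
  \sum_i qrat (q i)%:R^-1 * (conjq (x i 0) * (y i 0 : quat)).

Lemma diag_hBr x y z : diag_h x (y - z) = diag_h x y - diag_h x z.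
Proof.
rewrite /diag_h -sumrB; apply: eq_bigr => i _.
by rewrite !mxE -mulrBr -mulrBr.
Qed.

Lemma diag_hZr x y (a : quat) : diag_h x (y *r a) = diag_h x y * a.
Proof.
rewrite /diag_h mulr_suml; apply: eq_bigr => i _.
rewrite mxE -!mulrA; reflexivity.
Qed.

Lemma diag_hC x y : diag_h x y = conjq (diag_h y x).
Proof.
rewrite /diag_h (big_morph conjq (id1 := 0) (op1 := +%R)).
- apply: eq_bigr => i _; rewrite conjqM conjqM conjqK conjq_rat.
  by rewrite qratC.
- by move=> u v; rewrite -[v in LHS]opprK conjqB conjqN opprK.
- exact: conjq0.
Qed.

Lemma diag_nrm x : nrm diag_h x = \sum_i (q i)%:R^-1 * normq (x i 0).
Proof.
rewrite /nrm /diag_h (big_morph (qcoord 0) (id1 := 0) (op1 := +%R)).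
- by apply: eq_bigr => i _; rewrite conjq_mul -qratM qcoord0rat.
- exact: qcoordD.
- exact: qcoord_0.
Qed.

(** Both dimension conditions come from [underdetermined]: more than n orthogonal
    vectors would be linearly dependent, and orthogonality to fewer than n
    vectors is an underdetermined system. *)
Theorem diag_herm_space : herm_space diag_h n.
Proof.
have h_pos x : x != 0 -> 0 < nrm diag_h x.
  move=> x0; rewrite diag_nrm.
  have pos i : 0 <= (q i)%:R^-1 * normq (x i 0) by rewrite mulr_ge0 ?normq_ge0 // invr_ge0.
  rewrite lt0r sumr_ge0 // andbT psumr_eq0 //; apply: contraNN x0 => /allP x0.
  apply/eqP/colP => i; rewrite mxE; have := x0 i (mem_index_enum i).
  by rewrite mulf_eq0 invr_eq0 pnatr_eq0 -leqn0 leqNgt q_gt0 normq_eq0 => /eqP.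
have h0r x : diag_h x 0 = 0 by rewrite -(subrr (0 : 'cV_n)) diag_hBr subrr.
split; [exact: diag_hBr|exact: diag_hZr|exact: diag_hC|exact: h_pos| |].
- move=> s /andP[/allP s0 /(pairwiseP 0) sorth]; rewrite leqNgt; apply/negP => ns.
  have [x [j0 xj0] xs] := underdetermined (fun i (j : 'I_(size s)) => s`_j i 0) ns.
  have orth (i j : 'I_(size s)) : i != j -> diag_h s`_i s`_j = 0.
    move=> ij; have [lt|gt|e] := ltngtP i j.
    - by apply/eqP/sorth => //; rewrite inE.
    - have /eqP e : diag_h s`_j s`_i == 0 by apply: sorth => //; rewrite inE.
      by rewrite diag_hC e conjq0.
    - by rewrite (val_inj e) eqxx in ij.
  have : diag_h s`_j0 (\sum_j s`_j *r x j) = 0.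
    rewrite (_ : \sum_j _ = 0) //; apply/colP => i; rewrite summxE [RHS]mxE.
    rewrite -[RHS](xs i); apply: eq_bigr => j _; rewrite mxE; reflexivity.
  rewrite (big_morph (diag_h s`_j0) (id1 := 0) (op1 := +%R)); last 2 first.
  + by move=> u v; rewrite -[v in LHS]opprK diag_hBr -[- v]sub0r diag_hBr h0r sub0r opprK.
  + exact: h0r.
  rewrite (bigD1 j0) //= big1 => [|j jj0]; last by rewrite diag_hZr orth ?mul0r // eq_sym.
  rewrite addr0 diag_hZr => e; have sj0 : s`_j0 != 0 by apply: s0; rewrite mem_nth.
  have := h_pos _ sj0; rewrite /nrm.
  have U : diag_h s`_j0 s`_j0 \is a GRing.unit.
    by rewrite quat_unit; apply: contraTneq (h_pos _ sj0) => e0; rewrite /nrm e0 qcoord_0 ltxx.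
  by move: e => /(canRL (mulKr U)); rewrite mulr0 => /eqP; rewrite (negPf xj0).
move=> s sn.
have [x [j0 xj0] xs] := underdetermined
  (fun (i : 'I_(size s)) j => qrat (q j)%:R^-1 * conjq (s`_i j 0)) sn.
exists (\col_j x j); first by apply: contraNneq xj0 => /colP/(_ j0); rewrite !mxE => ->.
move=> y /(nthP 0)[i iy <-]; rewrite -[RHS](xs (Ordinal iy)); apply: eq_bigr => j _.
by rewrite mxE mulrA.
Qed.
End Diagonal.

(** * Gram-Schmidt in a lattice *)

Section PairingTheory.
Variables (D : unitRingType) (cj : D -> D) (S : subringClosed D).
Variables (p : D) (pi : nat).
Hypothesis ordS : order_with_prime cj S p pi.
Variables (L : hermModule S) (n : nat).
Hypothesis latL : is_lattice cj L n.
Local Notation "x *s a" := ((a : (subring_of S)^c) *: x) (at level 40, left associativity).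
Implicit Types x y z : L.

Lemma pairing0r x : pairing x 0 = 0.
Proof. by apply: (addrI (pairing x 0)); rewrite -(pairingDr latL) !addr0. Qed.
Lemma pairingNr x y : pairing x (- y) = - pairing x y.
Proof. by apply: (addrI (pairing x y)); rewrite -(pairingDr latL) !subrr pairing0r. Qed.
Lemma pairingBr x y z : pairing x (y - z) = pairing x y - pairing x z.
Proof. by rewrite (pairingDr latL) pairingNr. Qed.
Lemma pairing_sumr I (r : seq I) (P : pred I) F x :
  pairing x (\sum_(i <- r | P i) F i) = \sum_(i <- r | P i) pairing x (F i).
Proof. exact: (big_morph (pairing x) (pairingDr latL x) (pairing0r x)). Qed.
Lemma pairingMnr x y k : pairing x (y *+ k) = pairing x y *+ k.
Proof. by elim: k => [|k IH]; rewrite ?mulr0n ?pairing0r // !mulrS (pairingDr latL) IH. Qed.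
Lemma pairing_sym0 x y : pairing x y = 0 -> pairing y x = 0.
Proof. by move=> e; rewrite (pairing_conj latL) e (cj0 ordS). Qed.

Definition gram_coef x y : subring_of S := SubringOf (pairing_in latL x y).

Hypothesis posL : posdef L.

Lemma pairing_nat x : x != 0 -> exists2 k : nat, (0 < k)%N & pairing x x = k%:R.
Proof. by move=> /posL[[[|k]|k] // _ ->]; exists k.+1. Qed.

Lemma pairing_eq0 x : pairing x x = 0 -> x = 0.
Proof.
move=> e; apply/eqP; apply: contraT => /pairing_nat[k k0 kE].
by have := natr_unit ordS k0; rewrite -kE e unitr0.
Qed.

Section GramSchmidt.
Variable b : 'I_n -> L.
Hypothesis bP : forall v : L, exists! c : {ffun 'I_n -> (subring_of S)^c}, v = \sum_i c i *: b i.

Lemma basis_free (c c' : {ffun 'I_n -> (subring_of S)^c}) :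
  \sum_i c i *: b i = \sum_i c' i *: b i -> c = c'.
Proof.
move=> e; have [d [_ du]] := bP (\sum_i c i *: b i).
by rewrite -(du c) // -(du c').
Qed.

(** Orthogonalisation without denominators: the next vector is the basis vector b_k
    multiplied by the product Q of the previous norms, minus a combination of the
    previous orthogonal vectors. It is nonzero as its coefficient on b_k is Q. *)
Lemma gram_schmidt_partial k : (k <= n)%N -> exists g : seq L,
    [/\ size g = k, uniq g, {in g, forall x, x != 0}
      & {in g &, forall x y, x != y -> pairing x y = 0}] /\
    [/\ {in g, forall y, exists2 c : {ffun 'I_n -> (subring_of S)^c},
           y = \sum_i c i *: b i & forall i : 'I_n, (k <= i)%N -> c i = 0}
     & forall x, {in g, forall y, pairing y x = 0} ->
         forall i : 'I_n, (i < k)%N -> pairing (b i) x = 0].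
Proof.
elim: k => [|k IH] kn; first by exists [::].
have [g [[sg ug g0 go] [gs gb]]] := IH (ltnW kn).
have [q qP] : exists q : L -> nat, forall y, y \in g -> (0 < q y)%N /\ pairing y y = (q y)%:R.
  apply: (@choice_on_seq _ _ 0%N (fun y k => (0 < k)%N /\ pairing y y = k%:R)) => y yg.
  by have [m m0 mE] := pairing_nat (g0 y yg); exists m.
pose bk := b (Ordinal kn); pose Q := (\prod_(y <- g) q y)%N.
have Q0 : (0 < Q)%N by rewrite /Q big_seq prodn_cond_gt0 // => y /qP[].
have qQ y : y \in g -> ((Q %/ q y) * q y)%N = Q.
  by move=> yg; rewrite divnK // /Q (big_rem y) //= dvdn_mulr.
pose w := \sum_(y <- g) (y *s gram_coef y bk) *+ (Q %/ q y)%N.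
pose v := bk *+ Q - w.
have gw z : z \in g -> pairing z w = pairing z bk *+ Q.
  move=> zg; rewrite pairing_sumr (bigD1_seq z) //= big_seq_cond big1 => [|y /andP[yg yz]].
    rewrite addr0 pairingMnr (pairingZr latL) /= (proj2 (qP z zg)).
    by rewrite mulr_natl -mulrnA mulnC qQ.
  by rewrite pairingMnr (pairingZr latL) go ?mul0r ?mul0rn // eq_sym.
have gv z : z \in g -> pairing z v = 0.
  by move=> zg; rewrite pairingBr pairingMnr gw // subrr.
have Mn_scale (x : L) (m : nat) : x *+ m = x *s m%:R.
  by rewrite scaler_nat.
have gspan : exists2 c : {ffun 'I_n -> (subring_of S)^c},
    w = \sum_i c i *: b i & forall i : 'I_n, (k <= i)%N -> c i = 0.
  rewrite /w; elim: (g) gs {qQ gw} => [|z s IHs] ss.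
    by exists [ffun => 0]; rewrite ?big_nil ?big1 // => i *; rewrite ffunE ?scale0r.
  have [c cE c0] := ss z (mem_head z s).
  have [|d dE d0] := IHs; first by move=> y ys; apply: ss; rewrite inE ys orbT.
  pose m := (Q %/ q z)%N; pose a : (subring_of S)^c := gram_coef z bk.
  exists [ffun i => (m%:R * (a * c i) : (subring_of S)^c) + d i].
    have zE : (z *s a) *+ m = \sum_i (m%:R * (a * c i)) *: b i.
      rewrite Mn_scale cE !scaler_sumr; apply: eq_bigr => i _.
      by rewrite !scalerA mulrA.
    rewrite big_cons dE zE -big_split /=.
    by apply: eq_bigr => i _; rewrite ffunE scalerDl.
  by move=> i ki; rewrite ffunE c0 // d0 // !mulr0 addr0.
have [c wE c0] := gspan; pose k0 := Ordinal kn.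
pose cv : {ffun 'I_n -> (subring_of S)^c} := [ffun i => (Q * (i == k0))%:R - c i].
have bkE : bk *+ Q = \sum_i ((Q * (i == k0))%:R : (subring_of S)^c) *: b i.
  rewrite (bigD1 k0) //= big1 => [|i /negPf ik]; last by rewrite ik muln0 scale0r.
  by rewrite eqxx muln1 addr0 Mn_scale.
have vE : v = \sum_i cv i *: b i.
  by rewrite /v bkE wE -sumrB; apply: eq_bigr => i _; rewrite ffunE scalerBl.
have QU : (Q%:R : D) \is a GRing.unit := natr_unit ordS Q0.
have v0 : v != 0.
  apply: contraTneq QU => v0; have : cv = [ffun => 0].
    apply: basis_free; rewrite -vE v0 big1 // => i _; by rewrite ffunE scale0r.
  move=> /ffunP/(_ k0); rewrite !ffunE eqxx muln1 c0 // subr0 => /(congr1 val).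
  by rewrite rmorph_nat /= => ->; rewrite unitr0.
have vg : v \notin g.
  by apply: contra v0 => vg; apply/eqP/pairing_eq0/gv.
exists (rcons g v); split; split.
- by rewrite size_rcons sg.
- by rewrite rcons_uniq vg.
- by move=> y; rewrite mem_rcons inE => /predU1P[->|/g0].
- move=> y z; rewrite !mem_rcons !inE => /predU1P[->|yg] /predU1P[->|zg] yz.
  + by rewrite eqxx in yz.
  + exact/pairing_sym0/gv.
  + exact: gv.
  + exact: go.
- move=> y; rewrite mem_rcons inE => /predU1P[->|yg].
    exists cv => // i ki; rewrite ffunE c0 1?ltnW // subr0.
    by rewrite (_ : i == k0 = false) ?muln0 // -val_eqE /= gtn_eqF.
  by have [d dE d0] := gs y yg; exists d => // i /ltnW/d0.
move=> x xg i; have xg' : {in g, forall y, pairing y x = 0}.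
  by move=> y yg; apply: xg; rewrite mem_rcons inE yg orbT.
rewrite ltnS leq_eqVlt => /predU1P[ik|]; last exact: gb.
have -> : b i = bk by congr (b _); apply: val_inj.
have : pairing x v = 0 by apply/pairing_sym0/xg; rewrite mem_rcons mem_head.
rewrite pairingBr pairingMnr pairing_sumr big_seq big1 ?subr0 => [|y yg].
  rewrite -mulr_natr => /(canRL (mulrK QU)); rewrite mul0r.
  exact: pairing_sym0.
by rewrite pairingMnr (pairingZr latL) pairing_sym0 ?xg' // mul0r mul0rn.
Qed.
End GramSchmidt.

(** A vector orthogonal to the whole family is orthogonal to the basis, hence to
    itself. *)
Lemma gram_schmidt : exists g : seq L, [/\ size g = n, uniq g,
  {in g, forall x, x != 0}, {in g &, forall x y, x != y -> pairing x y = 0}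
  & forall x, {in g, forall y, pairing y x = 0} -> x = 0].
Proof.
have [b bP] := lattice_free latL.
have [g [[sg ug g0 go] [_ gb]]] := gram_schmidt_partial bP (leqnn n).
exists g; split=> // x xg; apply: pairing_eq0; have [c [xE _]] := bP x.
rewrite [X in pairing _ X]xE.
rewrite pairing_sumr big1 // => i _; rewrite (pairingZr latL).
by rewrite pairing_sym0 ?mul0r // gb.
Qed.

End PairingTheory.

(** * Quaternionic models of lattices *)

(** An isomorphism of the order Sq of quaternions with S, compatible with the
    conjugations and the primes. Only on Sq is j a morphism. *)
Record order_iso (D : unitRingType) (cj : D -> D) (S : subringClosed D) (p : D)
    (Sq : subringClosed quat) (pq : quat) (j : quat -> D) : Prop := OrderIso {
  iso_in : forall a, a \in Sq -> j a \in S;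
  iso_surj : forall s, s \in S -> exists2 a, a \in Sq & j a = s;
  iso_inj : forall a, a \in Sq -> j a = 0 -> a = 0;
  isoB : forall a b, a \in Sq -> b \in Sq -> j (a - b) = j a - j b;
  isoM : forall a b, a \in Sq -> b \in Sq -> j (a * b) = j a * j b;
  isoC : forall a, a \in Sq -> j (conjq a) = cj (j a);
  iso1 : j 1 = 1;
  iso_prime : j pq = p
}.

Section Model.
Variables (D : unitRingType) (cj : D -> D) (S : subringClosed D) (p : D) (pi : nat).
Variables (Sq : subringClosed quat) (pq : quat) (j : quat -> D) (beta : rat).
Hypothesis ordS : order_with_prime cj S p pi.
Hypothesis eucq : euclidean_order Sq pq pi beta.
Hypothesis isoj : order_iso cj S p Sq pq j.
Let ordq := order_prime eucq.

Lemma iso0 : j 0 = 0.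
Proof. by rewrite -(subrr 0) (isoB isoj) ?rpred0 // subrr. Qed.
Lemma isoD a b : a \in Sq -> b \in Sq -> j (a + b) = j a + j b.
Proof.
move=> aS bS; rewrite -[b in LHS]opprK (isoB isoj) ?rpredN //.
by rewrite -[- b]sub0r (isoB isoj) ?rpred0 // iso0 sub0r opprK.
Qed.
Lemma iso_sum I (r : seq I) (F : I -> quat) : (forall i, F i \in Sq) ->
  j (\sum_(i <- r) F i) = \sum_(i <- r) j (F i).
Proof.
move=> FS; elim: r => [|i r IH]; first by rewrite !big_nil iso0.
by rewrite !big_cons isoD ?rpred_sum // IH.
Qed.
Lemma iso_nat k : j k%:R = k%:R.
Proof. by elim: k => [|k IH]; rewrite ?iso0 // !mulrS isoD ?rpred1 ?rpred_nat // (iso1 isoj) IH. Qed.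
Lemma iso_eq a b : a \in Sq -> b \in Sq -> j a = j b -> a = b.
Proof.
move=> aS bS e; apply/eqP; rewrite -subr_eq0; apply/eqP/(iso_inj isoj).
  exact: rpredB.
by rewrite (isoB isoj) // e subrr.
Qed.

Lemma iso_inverse : exists phi : D -> quat, forall s, s \in S -> phi s \in Sq /\ j (phi s) = s.
Proof.
have ex s : s \in S -> exists a, (a \in Sq) && (j a == s).
  by move=> /(iso_surj isoj)[a aS <-]; exists a; rewrite aS eqxx.
exists (fun s => if @idP (s \in S) is ReflectT h then xchoose (ex s h) else 0) => s sS.
case: {-}_ / idP => // h; by have /andP[? /eqP] := xchooseP (ex s h).
Qed.

Variables (L : hermModule S) (n : nat).
Hypothesis latL : is_lattice cj L n.
Hypothesis posL : posdef L.
Hypothesis sdL : selfdual L.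
Local Notation "x *s a" := ((a : (subring_of S)^c) *: x) (at level 40, left associativity).

Record lattice_model (V : lmodType quat^c) (h : V -> V -> quat) (iota : L -> V) : Prop :=
  LatticeModel {
  model_space : herm_space h n;
  modelB : {morph iota : x y / x - y};
  modelZ : forall x (a : quat) (s : subring_of S), a \in Sq -> j a = val s ->
     iota (x *s s) = iota x *r a;
  model_h : forall x y, h (iota x) (iota y) \in Sq /\ j (h (iota x) (iota y)) = pairing x y;
  model_selfdual : selfdual_in h Sq (fun v => exists x, v = iota x)
}.

(** Let g be an orthogonal family from [gram_schmidt] with norms q_i. The coordinates
    <g_i|x> embed L isometrically for the form \sum q_i^-1 (conj x_i) y_i. If v
    has integral products with the image of L, these products define a linear
    form on L, which is represented by some x as L is selfdual; v and the image
    of x agree as they have the same products with the g_i. *)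
Theorem model_exists : exists (V : lmodType quat^c) (h : V -> V -> quat) (iota : L -> V),
  lattice_model h iota.
Proof.
have [phi phiP] := iso_inverse.
have phi_in s : s \in S -> phi s \in Sq by case/phiP.
have phiK s : s \in S -> j (phi s) = s by case/phiP.
have jphi a s : a \in Sq -> j a = s -> phi s = a.
  move=> aS <-; apply: iso_eq => //; first exact/phi_in/(iso_in isoj).
  by rewrite phiK // (iso_in isoj).
have [g [sg ug g0 go gmax]] := gram_schmidt ordS latL posL.
have pin := pairing_in latL.
have gi (i : 'I_n) : g`_i \in g by rewrite mem_nth // sg.
have [q qP] : exists q : L -> nat, forall y, y \in g -> (0 < q y)%N /\ pairing y y = (q y)%:R.
  apply: (@choice_on_seq _ _ 0%N (fun y k => (0 < k)%N /\ pairing y y = k%:R)) => y yg.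
  by have [m m0 mE] := pairing_nat posL (g0 y yg); exists m.
pose qi (i : 'I_n) := q g`_i.
have qi0 i : (0 < qi i)%N by have [] := qP _ (gi i).
pose iota (x : L) : 'cV[quat^c]_n := \col_i phi (pairing g`_i x).
have phiB s t : s \in S -> t \in S -> phi (s - t) = phi s - phi t.
  move=> sS tS; apply: jphi; first by rewrite rpredB ?phi_in.
  by rewrite (isoB isoj) ?phi_in ?phiK.
have iotaB : {morph iota : x y / x - y}.
  by move=> x y; apply/colP => i; rewrite !mxE (pairingBr latL) phiB.
have iotaZ x (a : quat) (s : subring_of S) : a \in Sq -> j a = val s ->
     iota (x *s s) = iota x *r a.
  move=> aS ja; apply/colP => i; rewrite !mxE (pairingZr latL).
  apply: jphi; first by rewrite rpredM ?phi_in.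
  by rewrite (isoM isoj) ?phi_in ?phiK ?ja.
have hspV := diag_herm_space qi0.
pose Q := (\prod_(y <- g) q y)%N.
have Q0 : (0 < Q)%N by rewrite /Q big_seq prodn_cond_gt0 // => y /qP[].
have qQ y : y \in g -> ((Q %/ q y) * q y)%N = Q.
  by move=> yg; rewrite divnK // /Q (big_rem y) //= dvdn_mulr.
have expand x y : Q%:R * pairing x y =
    \sum_(i < n) (Q %/ qi i)%:R * (pairing x g`_i * pairing g`_i y).
  pose w := \sum_(z <- g) (z *s gram_coef latL z y) *+ (Q %/ q z)%N.
  suff e : y *+ Q - w = 0.
    have /eqP := congr1 (pairing x) e.
    rewrite (pairingBr latL) (pairing0r latL) subr_eq0 (pairingMnr latL) mulr_natl => /eqP ->.
    rewrite (pairing_sumr latL) (big_nth 0) sg big_mkord; apply: eq_bigr => i _.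
    by rewrite (pairingMnr latL) (pairingZr latL) mulr_natl.
  apply: gmax => z zg; rewrite (pairingBr latL) (pairingMnr latL) (pairing_sumr latL).
  rewrite (bigD1_seq z) //= big_seq_cond big1 => [|t /andP[tg tz]].
    rewrite addr0 (pairingMnr latL) (pairingZr latL) /= (proj2 (qP z zg)).
    by rewrite mulr_natl -mulrnA mulnC qQ // subrr.
  by rewrite (pairingMnr latL) (pairingZr latL) go ?mul0r ?mul0rn // eq_sym.
have hE x y : diag_h qi (iota x) (iota y) = phi (pairing x y).
  have coordS i z : phi (pairing g`_i z) \in Sq by rewrite phi_in.
  have termS i : (Q %/ qi i)%:R * (conjq (phi (pairing g`_i x)) * phi (pairing g`_i y)) \in Sq.
    by rewrite !rpredM ?rpred_nat ?(cj_in ordq).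
  have e : Q%:R * phi (pairing x y) = \sum_i (Q %/ qi i)%:R *
      (conjq (phi (pairing g`_i x)) * phi (pairing g`_i y)).
    apply: iso_eq; rewrite ?rpredM ?rpred_nat ?phi_in ?rpred_sum //.
    rewrite iso_sum // (isoM isoj) ?rpred_nat ?phi_in // iso_nat phiK // expand.
    apply: eq_bigr => i _.
    rewrite !(isoM isoj) ?rpredM ?rpred_nat ?(cj_in ordq) // (isoC isoj) // iso_nat.
    by rewrite !phiK // -(pairing_conj latL).
  have QU : (Q%:R : quat) \is a GRing.unit := natr_unit ordq Q0.
  rewrite -[RHS](mulKr QU) e mulr_sumr; apply: eq_bigr => i _; rewrite !mxE [RHS]mulrA.
  rewrite -qrat_natV -(qrat_nat (Q %/ qi i)) -qratM; have -> // : (qi i)%:R^-1 = Q%:R^-1 * (Q %/ qi i)%:R :> rat.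
  have qi1 : (qi i)%:R != 0 :> rat by rewrite pnatr_eq0 -lt0n.
  have m0 : (Q %/ qi i)%:R != 0 :> rat.
    have : (0 < Q %/ qi i * qi i)%N by rewrite qQ.
    by rewrite muln_gt0 pnatr_eq0 -lt0n => /andP[].
  have -> : Q%:R = (Q %/ qi i)%:R * (qi i)%:R :> rat by rewrite -natrM qQ.
  by rewrite invfM mulrAC mulVf ?mul1r.
have hS x y : diag_h qi (iota x) (iota y) \in Sq by rewrite hE phi_in.
have jh x y : j (diag_h qi (iota x) (iota y)) = pairing x y by rewrite hE phiK.
exists 'cV[quat^c]_n, (diag_h qi), iota; split=> // v; split=> [[x ->] _ [y ->]//|hv].
have hvS y : diag_h qi v (iota y) \in Sq by apply: hv; exists y.
have jS y : j (diag_h qi v (iota y)) \in S by apply: (iso_in isoj).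
pose f (y : L) : (subring_of S)^c^o := SubringOf (jS y).
have f_lin : linear f.
  move=> a y z; apply: val_inj; rewrite /=.
  have [b bS ba] := iso_surj isoj (valP (a : subring_of S)).
  have -> : iota (a *: y + z) = iota y *r b + iota z.
    have -> : a *: y + z = a *: y - (- z) by rewrite opprK.
    rewrite iotaB (iotaZ _ _ _ bS ba); congr (_ + _).
    have i0 : iota 0 = 0 by have := iotaB 0 0; rewrite !subrr.
    by rewrite -[- z]sub0r iotaB i0 sub0r opprK.
  rewrite (hDr hspV) (hZr hspV) isoD ?rpredM // (isoM isoj) // ba.
  by [].
pose F : {linear L -> (subring_of S)^c^o} :=
  HB.pack f (GRing.isLinear.Build _ _ _ _ f f_lin).
have [x xP] := (proj2 sdL) F; exists x.
apply/eqP; rewrite -subr_eq0; apply/eqP/colP => i; rewrite [RHS]mxE.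
have : diag_h qi (v - iota x) (iota g`_i) = 0.
  apply: iso_eq; rewrite ?rpred0 // (hBl hspV) ?rpredB //.
  by rewrite (isoB isoj) // jh -xP subrr iso0.
rewrite /diag_h (bigD1 i) //= big1 => [|k ki]; last first.
  rewrite [iota _ k 0]mxE go // ?nth_uniq ?sg //.
  by rewrite (jphi 0 0) ?rpred0 ?iso0 // !mulr0.
rewrite addr0 [iota _ i 0]mxE (proj2 (qP _ (gi i))) (jphi (qi i)%:R (qi i)%:R) ?rpred_nat ?iso_nat //.
rewrite -qrat_nat -[conjq _ * _]qratC mulrA -qratM mulVf ?mul1r; last first.
  by rewrite pnatr_eq0 -lt0n.
by move=> e; rewrite -[LHS]conjqK e conjq0.
Qed.

End Model.

(** * Isometries with the standard and the exceptional lattice *)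

Lemma inj_surj_bij (A : choiceType) (B : eqType) (f : A -> B) :
  injective f -> (forall b, exists a, f a = b) -> bijective f.
Proof.
move=> inj surj; have ex b : exists a, f a == b by have [a <-] := surj b; exists a.
have fK b : f (xchoose (ex b)) = b by apply/eqP/(xchooseP (ex b)).
by exists (fun b => xchoose (ex b)) => // a; apply: inj.
Qed.

Section Forward.
Variables (D : unitRingType) (cj : D -> D) (S : subringClosed D) (p : D) (pi : nat).
Variables (Sq : subringClosed quat) (pq : quat) (j : quat -> D) (beta : rat).
Hypothesis ordS : order_with_prime cj S p pi.
Hypothesis eucq : euclidean_order Sq pq pi beta.
Hypothesis isoj : order_iso cj S p Sq pq j.
Let ordq := order_prime eucq.
Variables (L : hermModule S) (n : nat).
Hypothesis latL : is_lattice cj L n.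
Hypothesis posL : posdef L.
Hypothesis sdL : selfdual L.
Variables (V : lmodType quat^c) (h : V -> V -> quat) (iota : L -> V).
Hypothesis model : lattice_model Sq j n h iota.
Let hsp := model_space model.

Variable F : 'I_n -> V.
Hypothesis h_sum : forall x y, h x y = \sum_i conjq (h (F i) x) * h (F i) y.

Let hS x y : h (iota x) (iota y) \in Sq. Proof. by have [] := model_h model x y. Qed.
Let jh x y : j (h (iota x) (iota y)) = pairing x y.
Proof. by have [] := model_h model x y. Qed.
Let iotaB := modelB model.
Let iotaD x y : iota (x + y) = iota x + iota y.
Proof.
have i0 : iota 0 = 0 by have := iotaB 0 0; rewrite !subrr.
by rewrite -[y in LHS]opprK iotaB -[- y]sub0r iotaB i0 sub0r opprK.
Qed.

Lemma isometric_std : (forall i, exists x, F i = iota x) ->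
  (forall i k, h (F i) (F k) = (i == k)%:R) -> isometric L (std_lattice cj S n).
Proof.
move=> FP FF.
have FL i : {x : L | F i == iota x}.
  by apply/sig_eqW; have [x ->] := FP i; exists x; rewrite eqxx.
pose E i := sval (FL i).
have EP i : iota (E i) = F i by rewrite (eqP (svalP (FL i))).
have EE i k : pairing (E i) (E k) = (i == k)%:R.
  by rewrite -jh !EP FF (iso_nat isoj).
pose c i x : (subring_of S)^c := gram_coef latL (E i) x.
pose f (x : L) : 'cV[(subring_of S)^c]_n := \col_i c i x.
have f_lin : linear f.
  move=> a x y; apply/colP => i; apply: val_inj; rewrite !mxE /=.
  by rewrite (pairingDr latL) (pairingZr latL).
pose G : {linear L -> std_lattice cj S n} := HB.pack f (GRing.isLinear.Build _ _ _ _ f f_lin).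
have fh x y : pairing (G x) (G y) = pairing x y.
  rewrite /= -[RHS]jh h_sum (iso_sum isoj); last first.
    by move=> i; rewrite -EP rpredM ?(cj_in ordq).
  apply: eq_bigr => i _; rewrite !mxE /=.
  by rewrite -EP (isoM isoj) ?(cj_in ordq) // (isoC isoj) // !jh.
exists G; split=> //; apply: inj_surj_bij.
  move=> x y e; apply/eqP; rewrite -subr_eq0; apply/eqP/(pairing_eq0 ordS posL).
  have e0 : G (x - y) = 0 by rewrite linearB e subrr.
  by rewrite -fh e0 /= big1 // => i _; rewrite !mxE mulr0.
move=> v; exists (\sum_i (v i 0 : (subring_of S)^c) *: E i).
apply/colP => i; apply: val_inj; rewrite !mxE /= (pairing_sumr latL) (bigD1 i) //=.
rewrite big1 => [|k ki]; last by rewrite (pairingZr latL) EE eq_sym (negPf ki) mul0r.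
by rewrite addr0 (pairingZr latL) EE eqxx mul1r.
Qed.

Let pU := prime_unit ordS.
Let pqU := prime_unit ordq.

Lemma isometric_congr : (forall i k, h (F i) (F k) = (i == k)%:R) ->
  (forall v, (exists x, v = iota x) <->
    [/\ forall i, pq * h (F i) v \in Sq,
       forall i k, pq^-1 * (pq * h (F i) v - pq * h (F k) v) \in Sq
     & pi%:R^-1 * (\sum_i pq * h (F i) v) \in Sq]) ->
  isometric L (congr_lattice cj S p pi%:R n).
Proof.
move=> FF FP.
have FPi x : [/\ forall i, pq * h (F i) (iota x) \in Sq,
       forall i k, pq^-1 * (pq * h (F i) (iota x) - pq * h (F k) (iota x)) \in Sq
     & pi%:R^-1 * (\sum_i pq * h (F i) (iota x)) \in Sq].
  by apply/FP; exists x.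
pose X x i : quat := pq * h (F i) (iota x).
have XS x i : X x i \in Sq by have [x1 _ _] := FPi x; exact: x1.
pose f0 x : 'cV[D]_n := \col_i (p^-1 * j (X x i)).
have pf0 x i : p * f0 x i 0 = j (X x i) by rewrite mxE (mulVKr pU).
have piU : (pi%:R : D) \is a GRing.unit := natr_unit ordS (ltnW (pi_gt1 ordS)).
have piqU : (pi%:R : quat) \is a GRing.unit := natr_unit ordq (ltnW (pi_gt1 ordq)).
(* The isomorphism j is multiplicative on Sq only, so divisibility by p and by pi is transferred separately. *)
have dvd_p a : a \in Sq -> (p^-1 * j a \in S) = (pq^-1 * a \in Sq).
  move=> aS; apply/idP/idP => [/(iso_surj isoj)[b bS]|bS].
    move/(canLR (mulVKr pU)); rewrite -(iso_prime isoj) -(isoM isoj) ?(prime_in ordq) //.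
    by move=> /(iso_eq isoj)<-; rewrite ?(mulKr pqU) // rpredM // (prime_in ordq).
  rewrite -{1}[a](mulVKr pqU) (isoM isoj) ?(prime_in ordq) // (iso_prime isoj) mulKr //.
  exact: (iso_in isoj).
have dvd_pi a : a \in Sq -> (pi%:R^-1 * j a \in S) = (pi%:R^-1 * a \in Sq).
  move=> aS; apply/idP/idP => [/(iso_surj isoj)[b bS]|bS].
    move/(canLR (mulVKr piU)); rewrite -(iso_nat isoj) -(isoM isoj) ?rpred_nat //.
    by move=> /(iso_eq isoj)<-; rewrite ?(mulKr piqU) // rpredM // rpred_nat.
  rewrite -{1}[a](mulVKr piqU) (isoM isoj) ?rpred_nat // (iso_nat isoj) mulKr //.
  exact: (iso_in isoj).
have f0P x : f0 x \in congr_pred S p pi%:R (n := n).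
  have [x1 x2 x3] := FPi x; apply/and3P; split.
  - by apply/forallP => i; rewrite pf0 (iso_in isoj).
  - apply/'forall_forallP => i k; rewrite !pf0 -(isoB isoj) // dvd_p ?rpredB //.
    exact: x2.
  rewrite (eq_bigr _ (fun i _ => pf0 x i)) -(iso_sum isoj) // dvd_pi ?rpred_sum //.
pose f x : congr_vec S p pi%:R n := CongrVec (f0P x).
have XE (x y : L) (a : (subring_of S)^c) b : b \in Sq -> j b = val (a : subring_of S) ->
    forall i, X (a *: x + y) i = X x i * b + X y i.
  move=> bS ba i; rewrite /X iotaD (modelZ model _ bS ba) (hDr hsp) (hZr hsp).
  by rewrite mulrDr mulrA.
have f_lin : linear f.
  move=> a x y; apply/val_inj/colP => i; rewrite !mxE /=.
  have [b bS ba] := iso_surj isoj (valP (a : subring_of S)).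
  have Xb : X x i * b \in Sq := rpredM (XS x i) bS.
  by rewrite (XE _ _ _ _ bS ba) (isoD isoj) // (isoM isoj) // ba mulrDr mulrA.
pose G : {linear L -> congr_lattice cj S p pi%:R n} :=
  HB.pack f (GRing.isLinear.Build _ _ _ _ f f_lin).
have fh x y : pairing (G x) (G y) = pairing x y.
  apply: (mulrI piU); rewrite /= mulr_sumr.
  have -> : pi%:R * pairing x y = j (pi%:R * h (iota x) (iota y)).
    by rewrite (isoM isoj) ?rpred_nat // (iso_nat isoj) jh.
  rewrite h_sum mulr_sumr.
  have -> : \sum_i pi%:R * (conjq (h (F i) (iota x)) * h (F i) (iota y)) =
      \sum_i conjq (X x i) * X y i.
    apply: eq_bigr => i _; rewrite conjqM -mulrA [conjq pq * _]mulrA (prime_norm ordq).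
    by rewrite !mulrA natr_comm.
  rewrite (iso_sum isoj) => [|i]; last by apply: rpredM; [apply: (cj_in ordq)|].
  apply: eq_bigr => i _; rewrite (isoM isoj) ?(cj_in ordq) // (isoC isoj) // !mxE.
  rewrite (cjM ordS) -mulrA [cj p^-1 * _]mulrA (cjV ordS pU) (pVcjp ordS).
  by rewrite [cj _ * (_ * _)]mulrA -natrV_comm -mulrA (mulVKr piU).
exists G; split=> //; apply: inj_surj_bij.
  move=> x y e; apply/eqP; rewrite -subr_eq0; apply/eqP/(pairing_eq0 ordS posL).
  have e0 : G (x - y) = 0 by rewrite linearB e subrr.
  by rewrite -fh e0 /= big1 // => i _; rewrite !mxE mulr0.
move=> [v vP]; have /and3P[/forallP v1 /'forall_forallP v2 v3] := vP.
have aP i : {a | (a \in Sq) && (j a == p * v i 0)}.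
  by apply/sig_eqW; have [a aS <-] := iso_surj isoj (v1 i); exists a; rewrite aS eqxx.
pose a i := sval (aP i).
have aS i : a i \in Sq by have /andP[] := svalP (aP i).
have aE i : j (a i) = p * v i 0 by have /andP[_ /eqP] := svalP (aP i).
pose w := \sum_i F i *r (pq^-1 * a i).
have Fw i : pq * h (F i) w = a i.
  rewrite (h_sumr hsp) (bigD1 i) //= big1 => [|k ki].
    by rewrite addr0 (hZr hsp) FF eqxx mul1r (mulVKr pqU).
  by rewrite (hZr hsp) FF eq_sym (negPf ki) mul0r.
have [x wE] : exists x, w = iota x.
  apply/FP; split=> [i|i k|]; rewrite ?Fw //.
    by rewrite -dvd_p ?rpredB // (isoB isoj) // !aE.
  rewrite (eq_bigr a) => [|i _]; last exact: Fw.
  by rewrite -dvd_pi ?rpred_sum // (iso_sum isoj) // (eq_bigr _ (fun i _ => aE i)).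
exists x; apply/val_inj/colP => i; rewrite mxE /X -wE Fw aE mulKr //.
Qed.

End Forward.

Definition has_short_vectors (Sq : subringClosed quat) (pi n : nat) : Prop :=
  forall (V : lmodType quat^c) (h : V -> V -> quat), herm_space h n ->
  forall P e, selfdual_in h Sq P -> orthonormal h e -> {in e, forall x, P x} ->
  (size e < n)%N -> exists v, [/\ P v, perp h e v & nrm h v = 1 \/ nrm h v = pi%:R].

Theorem selfdual_classification (D : unitRingType) (cj : D -> D) (S : subringClosed D)
    (p : D) (pi : nat) (Sq : subringClosed quat) (pq : quat) (j : quat -> D) (beta : rat) :
  order_with_prime cj S p pi -> euclidean_order Sq pq pi beta ->
  order_iso cj S p Sq pq j ->
  forall (n : nat) (L : hermModule S), (n <= 2 * pi)%N -> has_short_vectors Sq pi n ->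
  is_lattice cj L n -> posdef L -> selfdual L ->
  isometric L (std_lattice cj S n) \/
  (n = (2 * pi)%N /\ isometric L (congr_lattice cj S p pi%:R n)).
Proof.
move=> ordS eucq isoj n L n_le short latL posL sdL.
have [V [h [iota model]]] := model_exists ordS eucq isoj latL posL sdL.
have hsp := model_space model; have sdP := model_selfdual model.
have onb_sum F : orthonormal h F -> size F = n -> forall x y : V,
    h x y = \sum_(i < n) conjq (h F`_i x) * h F`_i y.
  by move=> oF sF x y; rewrite (frame_h hsp oF sF) (big_nth 0) sF big_mkord.
have onb_h F : orthonormal h F -> size F = n -> forall i k : 'I_n,
    h F`_i F`_k = (i == k)%:R.
  by move=> [uF hF] sF i k; rewrite hF ?mem_nth ?sF // nth_uniq ?sF.
have [|||[f [sf of_ fP]]|[_ nE [F [sF oF FP]]]] :=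
  frame_or_congr hsp eucq (short V h hsp) n_le sdP (e := [::]) (d := n) => //.
  left; apply: (isometric_std ordS eucq isoj latL posL model (onb_sum f of_ sf) _
    (onb_h f of_ sf)) => i.
  by apply: fP; rewrite mem_nth ?sf.
right; split=> //; apply: (isometric_congr ordS eucq isoj posL model
  (F := fun i : 'I_n => F`_i) (onb_sum F oF sF) (onb_h F oF sF)) => v.
apply: (iff_trans (FP v)).
have nthF f : f \in F -> exists i : 'I_n, f = F`_i.
  by move=> /(nthP 0)[i]; rewrite sF => iF <-; exists (Ordinal iF).
have Fnth (i : 'I_n) : F`_i \in F by rewrite mem_nth ?sF.
have sumE : \sum_(f <- F) pq * h f v = \sum_(i < n) pq * h F`_i v.
  by rewrite (big_nth 0) sF big_mkord.
split=> -[v1 v2 v3]; split.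
- by move=> i; exact: v1 (Fnth i).
- by move=> i k; exact: v2 (Fnth i) (Fnth k).
- by move: v3; rewrite sumE.
- by move=> f /nthF[i ->]; apply: v1.
- by move=> f g /nthF[i ->] /nthF[k ->]; apply: v2.
by rewrite sumE; exact: v3.
Qed.

(** * Transport along isometries *)

Section Transport.
Variables (D : unitRingType) (cj : D -> D) (S : subringClosed D).
Variables (L M : hermModule S) (n : nat).
Hypothesis isoLM : isometric L M.

Lemma isometric_lattice : is_lattice cj M n -> is_lattice cj L n.
Proof.
have [f [[g fK gK] fh]] := isoLM => latM; split.
- have [b bP] := lattice_free latM; exists (fun i => g (b i)) => v.
  have gsum (c : {ffun 'I_n -> (subring_of S)^c}) :
      \sum_i c i *: g (b i) = g (\sum_i c i *: b i).
    by apply: (can_inj fK); rewrite gK linear_sum; apply: eq_bigr => i _; rewrite linearZ /= gK.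
  have [c [cE cu]] := bP (f v); exists c; split.
    by rewrite gsum -cE fK.
  by move=> c' vE; apply: cu; rewrite vE gsum gK.
- by move=> x y; rewrite -fh (pairing_in latM).
- by move=> x1 x2 y; rewrite -!fh linearD (pairingDl latM).
- by move=> x y1 y2; rewrite -!fh linearD (pairingDr latM).
- by move=> x y; rewrite -!fh (pairing_conj latM).
by move=> x y a; rewrite -!fh linearZ /= (pairingZr latM).
Qed.

Lemma isometric_neq0 (f : {linear L -> M}) v : bijective f -> v != 0 -> f v != 0.
Proof. by move=> [g fK _]; apply: contraNneq => e; rewrite -(fK v) e -(fK 0) linear0. Qed.

Lemma isometric_posdef : posdef M -> posdef L.
Proof.
have [f [bf fh]] := isoLM => pos v v0.
by have [m m0 mE] := pos _ (isometric_neq0 bf v0); exists m => //; rewrite -fh.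
Qed.

Lemma isometric_even_image : even L -> even M.
Proof.
have [f [[g fK gK] fh]] := isoLM => ev v.
by have [m mE] := ev (g v); exists m; rewrite -mE -fh gK.
Qed.

Lemma isometric_even : even M -> even L.
Proof. by have [f [_ fh]] := isoLM => ev v; have [m mE] := ev (f v); exists m; rewrite -fh. Qed.

Lemma isometric_selfdual : selfdual M -> selfdual L.
Proof.
have [f [[g fK gK] fh]] := isoLM => -[ns sd]; split.
  move=> x x0; rewrite -(fK x) (ns (f x)) => [|y]; first by rewrite -(fK 0) linear0.
  by rewrite -(gK y) fh x0.
move=> F; pose G y := F (g y).
have G_lin : linear G.
  move=> a x y; rewrite /G -linearP; congr (F _).
  by apply: (can_inj fK); rewrite linearP /= !gK.
pose Gl : {linear M -> (subring_of S)^c^o} := HB.pack G (GRing.isLinear.Build _ _ _ _ G G_lin).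
have [x xP] := sd Gl; exists (g x) => y.
by rewrite -fh gK -xP /= /G fK.
Qed.
End Transport.

(** * The standard lattice *)

Section Std.
Variables (D : unitRingType) (cj : D -> D) (S : subringClosed D).
Variables (p : D) (pi : nat).
Hypothesis ordS : order_with_prime cj S p pi.
Variable n : nat.
Local Notation M := (std_lattice cj S n).

Let valD (a b : (subring_of S)^c) :
  subring_val (a + b : subring_of S) = subring_val a + subring_val b.
Proof. exact: (rmorphD val). Qed.

Let e (i : 'I_n) : M := \col_k ((k == i)%:R : (subring_of S)^c).

Let pairing_e (x : M) i : pairing x (e i) = cj (val (x i 0 : subring_of S)).
Proof.
rewrite /= (bigD1 i) //= big1 => [|k /negPf ki]; rewrite mxE ?eqxx ?ki.
  by rewrite addr0 mulr1.
by rewrite mulr0.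
Qed.

Let std_sum (c : {ffun 'I_n -> (subring_of S)^c}) : \sum_i c i *: e i = \col_i c i :> M.
Proof.
apply/colP => k; rewrite summxE mxE (bigD1 k) //= big1 => [|i ik].
  by rewrite !mxE eqxx mulr1 addr0.
by rewrite !mxE eq_sym (negPf ik) mulr0.
Qed.

Lemma std_is_lattice : is_lattice cj M n.
Proof.
split.
- exists e => v; exists [ffun i => v i 0]; split.
    by rewrite std_sum; apply/colP => i; rewrite mxE ffunE.
  by move=> c ->; rewrite std_sum; apply/ffunP => i; rewrite ffunE mxE.
- by move=> x y; rewrite rpred_sum // => i _; rewrite rpredM ?(cj_in ordS) //; apply: valP.
- move=> x1 x2 y; rewrite /= -big_split /=; apply: eq_bigr => i _.
  by rewrite mxE valD (cjD ordS) mulrDl.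
- move=> x y1 y2; rewrite /= -big_split /=; apply: eq_bigr => i _.
  by rewrite mxE valD mulrDr.
- move=> x y; rewrite /= (cj_sum ordS); apply: eq_bigr => i _.
  by rewrite (cjM ordS) (cjK ordS).
move=> x y a; rewrite /= mulr_suml; apply: eq_bigr => i _.
by rewrite mxE -mulrA; congr (_ * _).
Qed.

Lemma std_posdef : posdef M.
Proof.
move=> v v0; have [|K [KE K0]] := sum_norms ordS (x := fun i => val (v i 0 : subring_of S)).
  by move=> i; apply: valP.
exists K%:Z; last by rewrite /= KE.
rewrite ltz_nat lt0n; apply: contra_neq v0 => /K0 v0; apply/colP => i.
by apply: val_inj; rewrite v0 mxE.
Qed.

Lemma std_selfdual : selfdual M.
Proof.
split=> [x x0|F].
  apply/colP => i; apply: val_inj; rewrite mxE /=.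
  by have := x0 (e i); rewrite pairing_e => /(congr1 cj); rewrite (cjK ordS) (cj0 ordS).
pose x : M := \col_i (SubringOf (cj_in ordS (valP (F (e i) : subring_of S))) : (subring_of S)^c).
exists x => y; have yE : y = \sum_i [ffun i => y i 0] i *: e i.
  by rewrite std_sum; apply/colP => i; rewrite mxE ffunE.
rewrite {1}yE linear_sum raddf_sum /=; apply: eq_bigr => i _.
by rewrite linearZ ffunE mxE /= (cjK ordS).
Qed.

Lemma std_unit_vector : (0 < n)%N -> exists v : M, pairing v v = 1.
Proof. by move=> n0; exists (e (Ordinal n0)); rewrite pairing_e mxE eqxx /= (cj1 ordS). Qed.

End Std.

(** * The exceptional lattice *)

Section Congr.
Variables (D : unitRingType) (cj : D -> D) (S : subringClosed D).
Variables (p : D) (pi n : nat).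
Hypothesis ordS : order_with_prime cj S p pi.
Hypothesis nE : n = (2 * pi)%N.
Local Notation M := (congr_lattice cj S p pi%:R n).
Let pU := prime_unit ordS.
Let cpU := cj_unit ordS pU.
Let piU : (pi%:R : D) \is a GRing.unit := natr_unit ordS (ltnW (pi_gt1 ordS)).
Let pS := prime_in ordS.
Let cS x : x \in S -> cj x \in S := cj_in ordS (x := x).

Lemma congrP (y : 'cV[D]_n) : reflect
  [/\ forall i, p * y i 0 \in S, forall i k, y i 0 - y k 0 \in S
    & (cj p)^-1 * \sum_i y i 0 \in S] (y \in congr_pred S p pi%:R (n := n)).
Proof.
have sumE : pi%:R^-1 * (\sum_i p * y i 0) = (cj p)^-1 * \sum_i y i 0.
  by rewrite -mulr_sumr mulrA (pVpi ordS).
apply: (iffP and3P) => [[/forallP y1 /'forall_forallP y2 y3]|[y1 y2 y3]].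
  split=> [//|i k|]; last by rewrite -sumE.
  by have := y2 i k; rewrite -mulrBr mulKr.
split; first exact/forallP; last by rewrite sumE.
by apply/'forall_forallP => i k; rewrite -mulrBr mulKr.
Qed.

Lemma congr_pairing_in (x y : M) : pairing x y \in S.
Proof.
have /congrP[x1 x2 x3] := valP x; have /congrP[y1 y2 y3] := valP y.
have sumE (z : 'I_n -> D) : pi%:R^-1 * (\sum_i p * z i) = (cj p)^-1 * \sum_i z i.
  by rewrite -mulr_sumr mulrA (pVpi ordS).
have diffE (z : 'I_n -> D) i k : p^-1 * (p * z i - p * z k) = z i - z k.
  by rewrite -mulrBr mulKr.
have szE : size (index_enum 'I_n) = (2 * pi)%N.
  by rewrite -nE /index_enum -enumT size_enum_ord.
apply: (congr_integral ordS szE); rewrite ?sumE // => i k _ _.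
  by rewrite (diffE (fun i => val x i 0)).
by rewrite (diffE (fun i => val y i 0)).
Qed.

Definition col_delta (i : 'I_n) (a : D) : 'cV[D]_n := \col_k (a *+ (k == i)).

Lemma sum_col_delta i a : \sum_k col_delta i a k 0 = a.
Proof.
rewrite (bigD1 i) //= big1 => [|k /negPf ki]; first by rewrite mxE eqxx addr0.
by rewrite mxE ki.
Qed.

Lemma col_deltaS i a k : a \in S -> col_delta i a k 0 \in S.
Proof. by move=> aS; rewrite mxE rpredMn. Qed.

(** In particular the vectors e_i p and e_i (conj p) belong to the lattice. *)
Lemma congr_single i a : (cj p)^-1 * a \in S -> col_delta i a \in congr_pred S p pi%:R (n := n).
Proof.
move=> ha; have aS : a \in S by rewrite -[a](mulVKr cpU) rpredM ?cS.
apply/congrP; split=> [k|k l|]; rewrite ?sum_col_delta //.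
  by rewrite rpredM ?col_deltaS.
by rewrite rpredB ?col_deltaS.
Qed.

Lemma congr_diff i k : col_delta i 1 - col_delta k 1 \in congr_pred S p pi%:R (n := n).
Proof.
have dS j l : col_delta j 1 l 0 \in S by rewrite col_deltaS ?rpred1.
have E l : (col_delta i 1 - col_delta k 1) l 0 = col_delta i 1 l 0 - col_delta k 1 l 0.
  by rewrite !mxE.
apply/congrP; split=> [l|l m|].
- by rewrite E rpredM // rpredB.
- by rewrite !E rpredB // rpredB.
rewrite (eq_bigr _ (fun l _ => E l)).
by rewrite sumrB !sum_col_delta subrr mulr0 rpred0.
Qed.

Lemma congr_all : const_mx p^-1 \in congr_pred S p pi%:R (n := n).
Proof.
apply/congrP; split=> [i|i k|]; rewrite ?mxE ?divrr ?subrr ?rpred1 ?rpred0 //.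
rewrite (eq_bigr (fun=> p^-1)) => [|i _]; last by rewrite mxE.
rewrite sumr_const card_ord nE mulnC mulrnA mulrnAr mulrnAr (pVcjp ordS).
by rewrite -[_ *+ pi]mulr_natl divrr // rpredMn ?rpred1.
Qed.

Let cpp : (cj p)^-1 * p \in S.
Proof. by rewrite (prime_dvd_cjp ordS) mulVr ?rpred1. Qed.
Let cpcp : (cj p)^-1 * cj p \in S.
Proof. by rewrite mulVr ?rpred1. Qed.

Definition congr_e i : M := CongrVec (congr_single i cpp).

Lemma pairing_col_delta (x : M) i a (h : col_delta i a \in congr_pred S p pi%:R (n := n)) :
  pairing x (CongrVec h) = cj (val x i 0) * a.
Proof.
rewrite /= (bigD1 i) //= big1 => [|k /negPf ki]; first by rewrite mxE eqxx addr0.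
by rewrite mxE ki mulr0.
Qed.

Lemma congr_val_sum I (r : seq I) (c : I -> (subring_of S)^c) (b : I -> M) k :
  val (\sum_(i <- r) c i *: b i) k 0 = \sum_(i <- r) val (b i) k 0 * val (c i : subring_of S).
Proof.
elim: r => [|i r IH]; first by rewrite !big_nil mxE.
by rewrite !big_cons -IH mxE; congr (_ + _); rewrite mxE.
Qed.

Lemma congr_bilinear :
  [/\ forall x1 x2 y : M, pairing (x1 + x2) y = pairing x1 y + pairing x2 y,
      forall x y1 y2 : M, pairing x (y1 + y2) = pairing x y1 + pairing x y2,
      forall x y : M, pairing x y = cj (pairing y x)
    & forall (x y : M) (a : subring_of S),
        pairing x ((a : (subring_of S)^c) *: y) = pairing x y * val a].
Proof.
split.
- move=> x1 x2 y; rewrite /= -big_split /=; apply: eq_bigr => i _.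
  by rewrite mxE (cjD ordS) mulrDl.
- move=> x y1 y2; rewrite /= -big_split /=; apply: eq_bigr => i _.
  by rewrite mxE mulrDr.
- move=> x y; rewrite /= (cj_sum ordS); apply: eq_bigr => i _.
  by rewrite (cjM ordS) (cjK ordS).
move=> x y a; rewrite /= mulr_suml; apply: eq_bigr => i _.
by rewrite mxE mulrA.
Qed.

Section Basis.
Variables (i0 i1 : 'I_n).
Hypothesis i01 : i0 != i1.

(** A vector y of the lattice has integral differences y_i - y_(i1), and the sum of
    these is divisible by p. So it is determined by y_(i1), which p^-1 (1, ..., 1)
    adjusts, by the differences for i other than i0 and i1, which e_i - e_(i0)
    adjusts, and by the quotient of the sum by conj p. *)
Definition congr_basis i : M :=
  if i == i1 then CongrVec congr_all else
  if i == i0 then CongrVec (congr_single i0 cpcp) else CongrVec (congr_diff i i0).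

Lemma congr_basis_sum (c : 'I_n -> (subring_of S)^c) k :
  val (\sum_i c i *: congr_basis i) k 0 =
  p^-1 * val (c i1 : subring_of S) + (k == i0)%:R * (cj p * val (c i0 : subring_of S)
    - \sum_(i | (i != i1) && (i != i0)) val (c i : subring_of S))
  + ((k != i1) && (k != i0))%:R * val (c k : subring_of S).
Proof.
rewrite congr_val_sum (bigD1 i1) //= (bigD1 i0) //= /congr_basis eqxx (negPf i01) eqxx /=.
rewrite mxE -addrA; congr (_ + _); rewrite mxE.
rewrite (eq_bigr (fun i => (k == i)%:R * val (c i : subring_of S)
   - (k == i0)%:R * val (c i : subring_of S))) => [|i /andP[/negPf i_1 /negPf i_0]]; last first.
  by rewrite i_1 i_0 /= !mxE mulrBl.
rewrite sumrB -mulr_sumr mulrBr addrA addrAC; congr (_ - _ + _).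
  by rewrite mulr_natl mulrnAl.
have [kk|] := boolP ((k != i1) && (k != i0)).
  rewrite (bigD1 k) //= eqxx big1 ?addr0 // => i /andP[_ /negPf ik].
  by rewrite eq_sym ik mul0r.
move=> nk; rewrite big1 ?mul0r // => i ii; have /negPf -> : k != i.
  by apply: contra nk => /eqP ->.
by rewrite mul0r.
Qed.

Lemma congr_basisP (v : M) : exists! c : {ffun 'I_n -> (subring_of S)^c},
  v = \sum_i c i *: congr_basis i.
Proof.
 have /congrP[v1 v2 v3] := valP v.
(* s is the coefficient of the basis vector e_(i0) (conj p). *)
pose y k := val v k 0; pose s := (cj p)^-1 * \sum_i (y i - y i1).
have n_pi (z : D) : z *+ n = z *+ pi *+ 2 by rewrite nE mulnC mulrnA.
have sS : s \in S.
  rewrite /s sumrB sumr_const card_ord mulrBr rpredB // n_pi mulrnAr rpredMn //.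
  by rewrite -mulr_natl -(prime_norm ordS) -mulrA (mulKr cpU); exact: v1.
have sum_mid : \sum_i (y i - y i1) =
    y i0 - y i1 + \sum_(i | (i != i1) && (i != i0)) (y i - y i1).
  by rewrite (bigD1 i1) //= subrr add0r (bigD1 i0).
pose r i := if i == i1 then p * y i1 else if i == i0 then s else y i - y i1.
have r1 : r i1 = p * y i1 by rewrite /r eqxx.
have r0 : r i0 = s by rewrite /r (negPf i01) eqxx.
have rm i : (i != i1) && (i != i0) -> r i = y i - y i1.
  by rewrite /r => /andP[/negPf-> /negPf->].
have rS i : r i \in S.
  by rewrite /r; do 2?case: eqP => // _; [apply: v1|apply: v2].
exists [ffun i => (SubringOf (rS i) : (subring_of S)^c)]; split.
  apply/val_inj/colP => k; rewrite congr_basis_sum !ffunE /= r1 r0 mulKr //.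
  rewrite (eq_bigr (fun i => y i - y i1)) => [|i im]; last by rewrite ffunE /= rm.
  rewrite /s mulVKr // sum_mid addrK -/(y k).
  have [->|k1] := eqVneq k i1.
    by rewrite eq_sym (negPf i01) /= !mul0r !addr0.
  have [->|k0] := eqVneq k i0; first by rewrite /= mul1r mul0r addr0 addrC subrK.
  by rewrite /= mul0r addr0 mul1r rm ?k1 // addrC subrK.
move=> c vE; have := congr_basis_sum c; rewrite -vE -/y => yE.
have {}yE k : y k = _ := yE k.
have c1 : val (c i1 : subring_of S) = p * y i1.
  by rewrite yE eq_sym (negPf i01) eqxx /= !mul0r !addr0 mulVKr.
have cm i : (i != i1) && (i != i0) -> val (c i : subring_of S) = y i - y i1.
  move=> /[dup] im /andP[j1 j0]; rewrite (yE i) im (negPf j0) c1 mulKr //=.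
  by rewrite mul0r addr0 mul1r [y i1 + _]addrC addrK.
have c0 : val (c i0 : subring_of S) = s.
  rewrite /s sum_mid (yE i0) c1 mulKr // eqxx andbF mul0r mul1r addr0.
  rewrite [y i1 + _]addrC addrK (eq_bigr _ cm) subrK mulKr //.
apply/ffunP => i; rewrite ffunE; apply: val_inj => /=.
have [->|i_1] := eqVneq i i1; first by rewrite r1 -c1.
have [->|i_0] := eqVneq i i0; first by rewrite r0 -c0.
by rewrite rm ?i_1 // cm ?i_1.
Qed.
End Basis.

Lemma congr_is_lattice : is_lattice cj M n.
Proof.
have [hDl hDr hC hZ] := congr_bilinear; split=> //; last exact: congr_pairing_in.
have n1 : (1 < n)%N by rewrite nE (leq_trans (pi_gt1 ordS)) // leq_pmull.
by exists (congr_basis (Ordinal (ltnW n1)) (Ordinal n1)); apply: congr_basisP.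
Qed.

Let coordS (v : M) i : p * val v i 0 \in S.
Proof. by have /congrP[v1 _ _] := valP v. Qed.

Lemma congr_norm (v : M) :
  pairing v v = (\sum_i cj (p * val v i 0) * (p * val v i 0)) / pi%:R.
Proof.
rewrite mulr_suml /=; apply: eq_bigr => i _.
have -> a : cj (p * a) * (p * a) = pi%:R * (cj a * a).
  by rewrite (cjM ordS) -mulrA [cj p * _]mulrA (prime_norm ordS) !mulrA natr_comm.
by rewrite natr_comm mulrK.
Qed.

Lemma congr_posdef : posdef M.
Proof.
move=> v v0; have [K [KE K0]] := sum_norms ordS (coordS v).
have := congr_pairing_in v v; rewrite congr_norm KE.
move=> /(order_frac ordS (ltnW (pi_gt1 ordS)))/dvdnP[m mE].
exists m%:Z; last by rewrite mE natrM mulrK.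
rewrite ltz_nat lt0n; apply: contra_neq v0 => m0.
have v0 := K0 _; apply/val_inj/colP => i; rewrite mxE.
by apply: (mulrI pU); rewrite v0 ?mulr0 // mE m0.
Qed.

(** A linear form F is determined by its values on the e_i p, as y p^2 is in their
    span for every y in the lattice. This gives the vector x representing F; its
    products with e_i p, e_i - e_k and p^-1 (1, ..., 1) are integral, and these
    are the three congruences defining the lattice. *)
Lemma congr_selfdual : selfdual M.
Proof.
split=> [x x0|F].
  apply/val_inj/colP => i; rewrite mxE; have := x0 (congr_e i).
  rewrite pairing_col_delta => /(canRL (mulrK pU)); rewrite mul0r.
  by move=> /(congr1 cj); rewrite (cjK ordS) (cj0 ordS).
pose x : 'cV[D]_n := \col_i cj (val (F (congr_e i) : subring_of S) * p^-1).
have FE (y : M) : val (F y : subring_of S) = \sum_i cj (x i 0) * val y i 0.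
  have ppS : p * p \in S by rewrite rpredM.
  have sS i : p^-1 * val y i 0 * (p * p) \in S.
    have -> : p^-1 * val y i 0 * (p * p) = p^-1 * (p^-1 * (p * val y i 0) * p) * p.
      by rewrite mulKr // !mulrA.
    by do 2!apply: (prime_conjl ordS).
  pose s i : (subring_of S)^c := SubringOf (sS i).
  have yE : (SubringOf ppS : (subring_of S)^c) *: y = \sum_i s i *: congr_e i.
    apply/val_inj/colP => k; rewrite congr_val_sum (bigD1 k) //= big1 => [|i ik].
      by rewrite !mxE eqxx addr0 !mulrA mulrV // mul1r.
    by rewrite !mxE eq_sym (negPf ik) mul0r.
  have := congr1 (fun z : subring_of S => val z) (congr1 F yE).
  rewrite linearZ linear_sum raddf_sum /= => E.
  have ppU : p * p \is a GRing.unit by rewrite unitrMl.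
  apply: (mulIr ppU); rewrite E mulr_suml; apply: eq_bigr => i _.
  by rewrite linearZ /= mxE (cjK ordS) !mulrA.
have xdual y : y \in congr_pred S p pi%:R (n := n) -> \sum_i cj (x i 0) * y i 0 \in S.
  by move=> hy; rewrite -(FE (CongrVec hy)); apply: valP.
have single i a : \sum_k cj (x k 0) * col_delta i a k 0 = cj (x i 0) * a.
  rewrite (bigD1 i) //= big1 => [|k /negPf ki]; rewrite [col_delta _ _ _ _]mxE ?eqxx ?ki.
    by rewrite addr0.
  by rewrite mulr0.
have xM : x \in congr_pred S p pi%:R (n := n).
  apply/congrP; split=> [i|i k|].
  - have := cS (xdual _ (congr_single i cpp)); rewrite single (cjM ordS) (cjK ordS) => h.
    rewrite -[x i 0](mulKr cpU) mulrA rpredM //.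
    by have := cS (prime_cj ordS); rewrite (cjM ordS) (cjK ordS) (cjV ordS pU).
  - have := cS (xdual _ (congr_diff i k)).
    rewrite (eq_bigr (fun l => cj (x l 0) * col_delta i 1 l 0 - cj (x l 0) * col_delta k 1 l 0)).
      by rewrite sumrB !single !mulr1 (cjB ordS) !(cjK ordS).
    by move=> l _; rewrite -mulrBr !mxE.
  have := cS (xdual _ congr_all).
  rewrite (eq_bigr (fun l => cj (x l 0) * p^-1)) => [|l _]; last by rewrite [const_mx _ _ _]mxE.
  rewrite -mulr_suml (cjM ordS) (cj_sum ordS) (cjV ordS pU).
  by rewrite (eq_bigr (fun l => x l 0)) // => l _; rewrite (cjK ordS).
by exists (CongrVec xM) => y; rewrite FE.
Qed.

(** If some coordinate v_l is in S, all are, and a vector of norm 1 has a single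
    nonzero coordinate; this is a unit, but also the sum of the coordinates,
    which is divisible by p. Otherwise no coordinate vanishes, and the 2 pi
    elements p v_i have norm at least 1 each, so that v has norm at least 2. *)
Lemma congr_no_unit (v : M) : pairing v v <> 1.
Proof.
have pi0 : (0 < pi)%N := ltnW (pi_gt1 ordS).
have /congrP[_ vd vs] := valP v; move=> v1.
have [/existsP[l vl]|/existsPn nov] := boolP [exists i, val v i 0 \in S].
  have vS i : val v i 0 \in S by rewrite -[val v i 0](subrK (val v l 0)) rpredD.
  have [k kP] := norms_fun ordS vS.
  have k1 : (\sum_i k i = 1)%N.
    apply: (natr_inj ordS); transitivity (pairing v v); last by rewrite v1.
    by rewrite natr_sum; apply: eq_bigr => i _; have [] := kP i.
  have [i ki] : exists i, (0 < k i)%N.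
    apply/existsP; apply: contraTT isT => /existsPn k0; move: k1.
    by rewrite big1 // => i _; apply/eqP; rewrite -leqn0 leqNgt k0.
  move: k1; rewrite (bigD1 i) //= => k1.
  have others m : m != i -> val v m 0 = 0.
    move=> mi; apply: (proj2 (kP m)); apply/eqP; rewrite -leqn0.
    move: k1; rewrite (bigD1 m) //= => /eqP; case: (k i) ki => // a _.
    by rewrite addSn eqSS addnCA addn_eq0 => /andP[/eqP->].
  have kE : k i = 1%N.
    by move: k1; rewrite big1 ?addn0 // => m mi; move: (kP m) => [];
      rewrite others // mulr0 => /(natr_inj ordS (k := 0)) <-.
  move: vs; rewrite (bigD1 i) //= big1 ?addr0 => [t|m mi]; last exact: others.
  set s := _ * _ in t; have vE : val v i 0 = cj p * s by rewrite mulVKr.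
  have [a [aE _]] := norm_nat ordS t.
  have [] := kP i; rewrite kE vE (cjM ordS) (cjK ordS) -mulrA [p * _]mulrA.
  rewrite (norm_prime ordS) natr_comm mulrA aE -natrM => /(natr_inj ordS)/eqP.
  by rewrite muln_eq1 => /andP[_ /eqP pi1]; have := pi_gt1 ordS; rewrite pi1.
have [k kP] := norms_fun ordS (coordS v).
move: v1; rewrite congr_norm => /(canRL (mulrVK piU)); rewrite mul1r.
rewrite (eq_bigr (fun i => (k i)%:R)) => [|i _]; last by have [] := kP i.
rewrite -natr_sum => /(natr_inj ordS) kE.
have : (\sum_(i < n) 1 <= \sum_(i < n) k i)%N.
  apply: leq_sum => i _; rewrite lt0n; apply: contra (nov i) => /eqP/(proj2 (kP i)) e.
  by have /(canRL (mulKr pU)) := e; rewrite mulr0 => ->; rewrite rpred0.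
rewrite sum_nat_const card_ord muln1 kE nE leqNgt -{1}[pi]mul1n ltn_pmul2r //.
Qed.

(** The norm of x + y is |x|^2 + |y|^2 plus the trace of <x|y>, so when traces are
    even it is enough to consider the basis vectors, which have norm 2 or pi. *)
Lemma congr_even : pi = 2%N ->
  (forall z, z \in S -> exists m : int, z + cj z = (2 * m)%:~R) -> even M.
Proof.
move=> pi2 trace v; have [hDl hDr hC hZ] := congr_bilinear.
have hZl (x y : M) (a : subring_of S) : pairing ((a : (subring_of S)^c) *: x) y = cj (val a) * pairing x y.
  by rewrite hC hZ (cjM ordS) -hC.
pose evenv (x : M) := exists m : int, pairing x x = (2 * m)%:~R.
have evenD x y : evenv x -> evenv y -> evenv (x + y).
  move=> [a aE] [b bE]; have [m mE] := trace _ (congr_pairing_in x y).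
  exists (a + b + m); rewrite hDl !hDr aE bE (hC y x) !mulrDr !intrD -mE.
  by rewrite addrACA [RHS]addrAC addrA; rewrite -!addrA; congr (_ + _); rewrite addrCA.
have evenZ x (a : (subring_of S)^c) : evenv x -> evenv (a *: x).
  move=> [m mE]; have [k [kE _]] := norm_nat ordS (valP (a : subring_of S)).
  have intC (c : D) (t : int) : c * t%:~R = t%:~R * c by rewrite mulrzr mulrzl.
  exists (m * k%:Z); rewrite hZ hZl mE intC -mulrA kE.
  by rewrite [2 * (m * _)]mulrA [RHS]intrM.
have n1 : (1 < n)%N by rewrite nE (leq_trans (pi_gt1 ordS)) // leq_pmull.
pose i0 := Ordinal (ltnW n1); pose i1 := Ordinal n1.
have i01 : i0 != i1 by [].
have even_basis i : evenv (congr_basis i0 i1 i).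
  exists 1; rewrite mulr1 /congr_basis; case: eqP => _.
    rewrite /= (eq_bigr (fun=> pi%:R^-1)) => [|l _].
      by rewrite sumr_const card_ord nE mulnC mulrnA -[_ *+ pi]mulr_natl mulrV.
    by rewrite !mxE (cjV ordS pU) (pVcjp ordS).
  case: eqP => [_|/eqP ii0].
    by rewrite pairing_col_delta mxE eqxx (cjK ordS) (norm_prime ordS) pi2.
  rewrite /= (bigD1 i) //= (bigD1 i0) 1?eq_sym //= big1 => [|l /andP[/negPf li /negPf l0]].
    rewrite !mxE !eqxx (negPf ii0) eq_sym (negPf ii0) subr0 sub0r addr0.
    by rewrite (cjN ordS) (cj1 ordS) mulrNN mulr1.
  by rewrite !mxE li l0 subrr mulr0.
have [c [-> _]] := congr_basisP i01 v.
elim/big_ind: _ => [|x y|i _]; [|exact: evenD|exact/evenZ/even_basis].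
by exists 0; rewrite /= big1 // => i _; rewrite mxE mulr0.
Qed.
End Congr.

(** * Gaussian and Eisenstein integers in algC *)

Lemma order_of_iso (S : subringClosed algC) (p : algC) (pi : nat)
    (Sq : subringClosed quat) (pq : quat) (j : quat -> algC) :
  order_with_prime conjq Sq pq pi -> order_iso Num.conj S p Sq pq j ->
  order_with_prime Num.conj S p pi.
Proof.
move=> ordq isoj; have [pS jp] := (prime_in ordq, iso_prime isoj).
have cS a : a \in Sq -> conjq a \in Sq by exact: (cj_in ordq).
have prime_normE : Num.conj p * p = pi%:R.
  by rewrite -jp -(isoC isoj) // -(isoM isoj) ?cS // (prime_norm ordq) (iso_nat isoj).
have pi0 : (pi%:R : algC) != 0 by rewrite pnatr_eq0 -lt0n ltnW ?(pi_gt1 ordq).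
have p0 : p != 0 by apply: contraNneq pi0 => p0; rewrite -prime_normE p0 mulr0.
split.
- exact: rmorphB.
- by move=> x y; rewrite rmorphM mulrC.
- exact: conjCK.
- move=> x /(iso_surj isoj)[a aS <-]; rewrite -(isoC isoj) //.
  exact/(iso_in isoj)/cS.
- move=> x /(iso_surj isoj)[a aS <-]; have [k [kE k0]] := norm_nat ordq aS.
  exists k; rewrite -(isoC isoj) // -(isoM isoj) ?cS // kE (iso_nat isoj).
  by split=> // /k0 ->; rewrite (iso0 isoj).
- by move=> k k0; rewrite unitfE pnatr_eq0 -lt0n.
- move=> k m m0 /(iso_surj isoj)[a aS aE]; apply: (order_frac ordq m0).
  have mU := natr_unit ordq m0; suff <- : a = k%:R / m%:R by [].
  apply: (mulIr mU); rewrite mulrVK //; apply: (iso_eq isoj); rewrite ?rpredM ?rpred_nat //.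
  rewrite (isoM isoj) ?rpred_nat // !(iso_nat isoj) aE mulfVK //.
  by rewrite pnatr_eq0 -lt0n.
- by rewrite -jp (iso_in isoj).
- exact: prime_normE.
- by rewrite mulrC.
- by rewrite unitfE.
- exact: (pi_gt1 ordq).
- by move=> x xS; rewrite mulrAC mulVf ?mul1r.
- by move=> x xS; rewrite mulrAC divff ?mul1r.
have uS := prime_cj ordq; have pqU := prime_unit ordq.
rewrite -{2}jp -(isoC isoj) // -[conjq pq](mulVKr pqU) (isoM isoj) // jp.
by rewrite mulKf // (iso_in isoj).
Qed.

Definition gauj (q : quat) : algC := ratr (qcoord 0 q) + ratr (qcoord 1 q) * 'i.

Lemma gauj_mk (a b : int) : gauj (mkq a%:~R b%:~R 0 0) = a%:~R + b%:~R * 'i.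
Proof. by rewrite /gauj !mkE !ratr_int. Qed.

Lemma gauj_iso : order_iso Num.conj Gau (1 + 'i) Gauq (1 + qi) gauj.
Proof.
split.
- by move=> _ /gauqP[a [b ->]]; rewrite gauj_mk; apply/Cint_span2P; exists a, b.
- move=> _ /Cint_span2P[a [b ->]]; exists (mkq a%:~R b%:~R 0 0); last exact: gauj_mk.
  by apply/gauqP; exists a, b.
- move=> _ /gauqP[a [b ->]]; rewrite gauj_mk => e.
  have := congr1 Num.conj e; rewrite rmorph0 rmorphD rmorphM /= !rmorph_int conjCi => e'.
  have e2 : b%:~R * 'i = 0 :> algC.
    transitivity ((a%:~R + b%:~R * 'i - (a%:~R + b%:~R * - 'i)) / 2 : algC).
      by field.
    by rewrite e e' subrr mul0r.
  have /eqP b0 : b == 0.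
    by move/eqP: e2; rewrite mulf_eq0 (negPf (neq0Ci _)) orbF intr_eq0.
  move: e; rewrite b0 mul0r addr0 => /eqP; rewrite intr_eq0 => /eqP ->.
  by qcoords.
- move=> _ _ /gauqP[a [b ->]] /gauqP[c [d ->]]; rewrite !gauj_mk.
  rewrite (_ : _ - _ = mkq (a - c)%:~R (b - d)%:~R 0 0).
    by rewrite gauj_mk !rmorphB /=; ring.
  by rewrite !rmorphB /=; qcoords; ring.
- move=> _ _ /gauqP[a [b ->]] /gauqP[c [d ->]]; rewrite !gauj_mk.
  rewrite (_ : _ * _ = mkq (a * c - b * d)%:~R (a * d + b * c)%:~R 0 0).
    transitivity (a%:~R * c%:~R + (a%:~R * d%:~R + b%:~R * c%:~R) * 'i
        + b%:~R * d%:~R * 'i ^+ 2 : algC); last by ring.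
    by rewrite sqrCi gauj_mk !castE /=; ring.
  by rewrite !castE /=; qcoords; ring.
- move=> _ /gauqP[a [b ->]]; rewrite gauj_mk.
  rewrite (_ : conjq _ = mkq a%:~R (- b)%:~R 0 0).
    by rewrite gauj_mk rmorphD rmorphM /= !rmorph_int conjCi rmorphN /= mulrN mulNr.
  by rewrite !castE /=; qcoords; ring.
- by rewrite /gauj !q1E rmorph1 rmorph0 mul0r addr0.
by rewrite /gauj !qE !mkE ?q1E addr0 add0r !rmorph1 mul1r.
Qed.

Definition eisj (q : quat) : algC := ratr (qcoord 0 q) + ratr (qcoord 1 q) * theta.

Lemma thetaM : theta * theta = -3.
Proof. by rewrite -expr2 sqrtCK. Qed.

(** The conjugate of theta has the same square; it is not theta, since theta is not
    real. *)
Lemma conj_theta : Num.conj theta = - theta.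
Proof.
have /eqP : (Num.conj theta) ^+ 2 = theta ^+ 2.
  by rewrite -rmorphXn /= expr2 thetaM rmorphN /= rmorph_nat.
rewrite eqf_sqr => /orP[/eqP/CrealP tR|/eqP//].
have : 0 <= theta ^+ 2 by rewrite -realEsqr.
by rewrite expr2 thetaM oppr_ge0 (ler_nat _ 3 0).
Qed.

Lemma theta_neq0 : theta != 0.
Proof. by apply/eqP => t0; have /eqP := thetaM; rewrite t0 mul0r eq_sym oppr_eq0 pnatr_eq0. Qed.

Lemma eisj_mk (a b : int) : eisj (eismk a%:~R b%:~R) = a%:~R + b%:~R * omega.
Proof.
rewrite /eisj /eismk !mkE rmorphB fmorph_div /= !ratr_int rmorph_nat /omega.
by field.
Qed.

Lemma omegaM : omega * omega = - 1 - omega.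
Proof.
have -> : omega * omega = (1 - 2 * theta + theta * theta) / 4 by rewrite /omega; field.
by rewrite thetaM /omega; field.
Qed.

Lemma conj_omega : Num.conj omega = - 1 - omega.
Proof.
rewrite /omega fmorph_div rmorphD rmorphN rmorph1 /= rmorph_nat conj_theta.
by field.
Qed.

Lemma eisj_iso : order_iso Num.conj Eis theta Eisq thetaq eisj.
Proof.
split.
- by move=> _ /eisqP[a [b ->]]; rewrite eisj_mk; apply/Cint_span2P; exists a, b.
- move=> _ /Cint_span2P[a [b ->]]; exists (eismk a%:~R b%:~R); last exact: eisj_mk.
  by apply/eisqP; exists a, b.
- move=> _ /eisqP[a [b ->]]; rewrite eisj_mk => e.
  have := congr1 Num.conj e; rewrite rmorph0 rmorphD rmorphM /= !rmorph_int conj_omega => e'.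
  have e2 : b%:~R * theta = 0.
    transitivity (a%:~R + b%:~R * omega - (a%:~R + b%:~R * (- 1 - omega))).
      by rewrite /omega; field.
    by rewrite e e' subrr.
  have /eqP b0 : b == 0.
    by move/eqP: e2; rewrite mulf_eq0 (negPf theta_neq0) orbF intr_eq0.
  move: e; rewrite b0 mul0r addr0 => /eqP; rewrite intr_eq0 => /eqP ->.
  by rewrite /eismk; qcoords; rewrite ?mul0r ?subr0.
- move=> _ _ /eisqP[a [b ->]] /eisqP[c [d ->]]; rewrite !eisj_mk.
  rewrite (_ : _ - _ = eismk (a - c)%:~R (b - d)%:~R).
    by rewrite eisj_mk !rmorphB /=; ring.
  by rewrite eismkB !rmorphB.
- move=> _ _ /eisqP[a [b ->]] /eisqP[c [d ->]]; rewrite !eisj_mk.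
  rewrite (_ : _ * _ = eismk (a * c - b * d)%:~R (a * d + b * c - b * d)%:~R).
    transitivity (a%:~R * c%:~R + (a%:~R * d%:~R + b%:~R * c%:~R) * omega
        + b%:~R * d%:~R * (omega * omega) : algC); last by ring.
    by rewrite omegaM eisj_mk !castE /=; ring.
  by rewrite !castE /= /eismk; qcoords; field.
- move=> _ /eisqP[a [b ->]]; rewrite eisj_mk.
  rewrite (_ : conjq _ = eismk (a - b)%:~R (- b)%:~R).
    have -> : Num.conj (a%:~R + b%:~R * omega) = a%:~R + b%:~R * (- 1 - omega).
      by rewrite rmorphD rmorphM /= !rmorph_int conj_omega.
    by rewrite eisj_mk !castE /=; ring.
  by rewrite !castE /= /eismk; qcoords; field.
- by rewrite /eisj !q1E rmorph1 rmorph0 mul0r addr0.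
by rewrite /eisj !mkE rmorph0 rmorph1 add0r mul1r.
Qed.

Lemma hur_iso : order_iso conjq Hur (1 + qi) Hur (1 + qi) id.
Proof. by split=> // s sS; exists s. Qed.

Lemma eis_order : order_with_prime Num.conj Eis theta 3.
Proof. exact: order_of_iso eisq_order eisj_iso. Qed.

Lemma gau_order : order_with_prime Num.conj Gau (1 + 'i) 2.
Proof. exact: order_of_iso gauq_order gauj_iso. Qed.

Lemma gau_trace z : z \in Gau -> exists m : int, z + Num.conj z = (2 * m)%:~R.
Proof.
move=> /Cint_span2P[a [b ->]]; exists a.
by rewrite rmorphD rmorphM /= !rmorph_int conjCi intrM; ring.
Qed.

(** * The classification *)

Lemma congr_nonisometric (D : unitRingType) (cj : D -> D) (S : subringClosed D)
    (p : D) (pi : nat) : order_with_prime cj S p pi ->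
  ~ isometric (std_lattice cj S (2 * pi)) (congr_lattice cj S p pi%:R (2 * pi)).
Proof.
move=> ordS [f [_ fh]]; have n0 : (0 < 2 * pi)%N by rewrite muln_gt0 /= (ltnW (pi_gt1 ordS)).
have [v v1] := std_unit_vector ordS n0.
by apply: (congr_no_unit ordS (erefl _) (v := f v)); rewrite fh v1.
Qed.

Theorem selfdual_iff (D : unitRingType) (cj : D -> D) (S : subringClosed D)
    (p : D) (pi : nat) (Sq : subringClosed quat) (pq : quat) (j : quat -> D) (beta : rat) :
  order_with_prime cj S p pi -> euclidean_order Sq pq pi beta ->
  order_iso cj S p Sq pq j ->
  forall (n : nat) (L : hermModule S), (n <= 2 * pi)%N -> has_short_vectors Sq pi n ->
  [/\ is_lattice cj L n, posdef L & selfdual L] <->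
  isometric L (std_lattice cj S n) \/
  (n = (2 * pi)%N /\ isometric L (congr_lattice cj S p pi%:R (2 * pi))).
Proof.
move=> ordS eucq isoj n L n_le short; split=> [[latL posL sdL]|[iL|[nE iL]]].
- have [|[nE]] := selfdual_classification ordS eucq isoj n_le short latL posL sdL.
    by left.
  by rewrite nE; right.
- split; first exact: (isometric_lattice iL (std_is_lattice ordS n)).
    exact: (isometric_posdef iL (@std_posdef _ _ _ _ _ ordS n)).
  exact: (isometric_selfdual iL (@std_selfdual _ _ _ _ _ ordS n)).
rewrite nE; split; first exact: (isometric_lattice iL (congr_is_lattice ordS (erefl _))).
  exact: (isometric_posdef iL (congr_posdef ordS (erefl _))).
exact: (isometric_selfdual iL (congr_selfdual ordS (erefl _))).
Qed.

Lemma std_gau_odd n : (0 < n)%N -> ~ even (std_lattice Num.conj Gau n).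
Proof.
move=> n0 ev; have [v v1] := std_unit_vector gau_order n0.
have [m mE] := ev v; move: mE; rewrite v1 => /eqP; rewrite -(rmorph1 intr) eqr_int => /eqP.
by move=> /(congr1 (fun z => (z %% 2)%Z)); rewrite mulrC modzMl.
Qed.

Theorem theorem7p2 :
  [/\ (forall (n : nat) (L : hermModule Eis), (n <= 6)%N ->
         [/\ is_lattice Num.conj L n, posdef L & selfdual L] <->
         isometric L (Eis_std n) \/ (n = 6%N /\ isometric L Lambda6E)),
      ~ isometric (Eis_std 6) Lambda6E,
      (forall (n : nat) (L : hermModule Hur), (n <= 4)%N ->
         [/\ is_lattice conjq L n, posdef L & selfdual L] <->
         isometric L (Hur_std n) \/ (n = 4%N /\ isometric L Lambda4H)),
      ~ isometric (Hur_std 4) Lambda4H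
    & (forall (n : nat) (L : hermModule Gau), (n <= 4)%N ->
         [/\ is_lattice Num.conj L n, posdef L, even L & selfdual L] <->
         (n = 0%N /\ isometric L Gau_zero) \/
         (n = 4%N /\ isometric L E8G))].
Proof.
have [omS om1 om0] := omegaq_facts.
split.
- move=> n L n6; apply: (selfdual_iff eis_order eisq_euclidean eisj_iso L n6).
  move=> V h hsp P e sdP oe eP en.
  exact: (short_two_thirds hsp eisq_euclidean erefl n6 eisq_units2 omS om1 om0).
- exact: (congr_nonisometric eis_order).
- move=> n L n4; apply: (selfdual_iff hurwitz_order hurwitz_euclidean hur_iso L n4).
  move=> V h hsp P e sdP oe eP en.
  exact: (short_half hsp hurwitz_euclidean erefl n4).
- exact: (congr_nonisometric hurwitz_order).
move=> n L n4.
have cls := selfdual_iff gau_order gauq_euclidean gauj_iso L n4.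
have {}cls : [/\ is_lattice Num.conj L n, posdef L & selfdual L] <->
  isometric L (std_lattice Num.conj Gau n) \/ (n = 4%N /\ isometric L E8G).
  apply: cls => V h hsp P e sdP oe eP en.
  exact: (short_half hsp gauq_euclidean erefl n4).
split=> [[latL posL evL sdL]|[[n0 iL]|[nE iL]]].
- have /cls[iL|] : [/\ is_lattice Num.conj L n, posdef L & selfdual L] by []; last by right.
  have [n0|n0] := posnP n; first by left; split=> //; rewrite n0 in iL.
  by case: (std_gau_odd n0); apply: isometric_even_image iL evL.
- have [|latL posL sdL] := proj2 cls; first by left; rewrite n0.
  split=> //; apply: isometric_even iL _ => v.
  by exists 0; rewrite /= big_ord0.
have [|latL posL sdL] := proj2 cls; first by right.
split=> //; apply: isometric_even iL _.
exact: (congr_even gau_order (erefl _) erefl gau_trace).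
Qed.
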